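(* Let $(M^n,g,f,\rho)$, $n\ge 3$, be a compact oriented static perfect fluid space-time with connected boundary $\partial M$ and positive scalar curvature $R$, satisfying $$\frac{n-2}{2(n-1)}R+\frac{n}{n-1}\rho=-\Lambda,$$ where $\Lambda$ is a positive constant. Then $$\mathrm{Vol}(M)\ \geq\ \frac{1}{\Lambda}\sqrt{\frac{R_{min}+3\Lambda}{2n}}\;|\partial M|,$$ where $R_{min}$ is the minimum value of $R$ on $M$ and $|\partial M|$ is the area of $\partial M$. Moreover, if equality holds, then $(M^n,g)$ is isometric to the round hemisphere $\mathbb{S}^n_+$.
   Context: A static perfect fluid space-time $(M^n,g,f,\rho)$ with non-empty boundary is a smooth Riemannian manifold $(M^n,g)$, $n\ge 3$, with boundary $\partial M\neq\emptyset$, together with smooth functions $f,\rho$ on $M$ such that $f>0$ in the interior of $M$, $f^{-1}(0)=\partial M$, and $$f\,\mathring{Ric}=\mathring{\nabla}^2 f,\qquad \Delta f=\left(\frac{n-2}{2(n-1)}R+\frac{n}{n-1}\rho\right)f .$$ Here $R$ is the scalar curvature of $g$, $\mathring{Ric}=Ric-\frac{R}{n}g$ is the traceless Ricci tensor, $\mathring{\nabla}^2 f=\nabla^2 f-\frac{\Delta f}{n}g$ is the traceless Hessian, and $\Delta f=\mathrm{tr}_g\nabla^2 f$. Area means $(n-1)$-dimensional Riemannian volume of the induced metric. *)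

(* Defs.v *)
(* A manifold with boundary of dimension m.+1 is given by an atlas of charts
   with values in a half-space of 'rV[R]_m.+1; tensors are given by their
   components in the charts of the atlas. *)
From mathcomp Require Import all_boot all_order all_algebra.
From mathcomp Require Import all_classical all_reals all_analysis.
Set Implicit Arguments.
Unset Strict Implicit.
Unset Printing Implicit Defensive.
Import Order.TTheory GRing.Theory Num.Theory.
Import numFieldNormedType.Exports.
Local Open Scope classical_set_scope.
Local Open Scope ring_scope.

Section Calculus.
Context {R : realType} {n : nat}.
Implicit Types (D U : set 'rV[R]_n) (F h : 'rV[R]_n -> R) (x : 'rV[R]_n).

Definition iter_partial (s : seq 'I_n) F : 'rV[R]_n -> R :=
  foldr (fun i h => fun x => 'D_(delta_mx 0 i) h x) F s.

Definition smooth_open U F : Prop :=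
  forall (s : seq 'I_n) x, U x ->
    {for x, continuous (iter_partial s F)} /\
    forall i, derivable (iter_partial s F) x (delta_mx 0 i).

(* Smoothness on an arbitrary subset D: local existence of smooth extensions. *)
Definition smooth_on D h : Prop :=
  forall x, D x -> exists U F,
    [/\ open U, U x, smooth_open U F & forall y, U y -> D y -> F y = h y].

(* i-th partial derivative relative to D: the difference quotient only uses
   points of D, so it is one-sided at boundary points of the half-space, where
   it agrees with the derivative of any smooth extension. *)
Definition partial D (i : 'I_n) h x : R :=
  lim (t^-1 * (h (x + t *: delta_mx 0 i) - h x)
       @[t --> within [set t : R | D (x + t *: delta_mx 0 i)] 0^']).

End Calculus.

(* Lebesgue integral over R^n, as an iterated integral (Tonelli); it is only
   used for nonnegative Borel integrands. *)
Fixpoint integral_rV (R : realType) (n : nat) :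
    ('rV[R]_n -> \bar R) -> \bar R :=
  match n with
  | 0 => fun F => F 0
  | n'.+1 => fun F =>
      (\int[@lebesgue_measure R]_t
          integral_rV (fun y : 'rV[R]_n' => F (row_mx (t%:M : 'rV_1) y)))%E
  end.

Section LocalGeometry.
Context {R : realType} {n : nat}.
Variables (D : set 'rV[R]_n) (G : 'rV[R]_n -> 'M[R]_n).
Implicit Types (i j k l : 'I_n) (x : 'rV[R]_n) (T : 'M[R]_n).

Definition christoffel k i j x : R :=
  2^-1 * \sum_l invmx (G x) k l *
    (partial D i (fun y => G y j l) x + partial D j (fun y => G y i l) x
     - partial D l (fun y => G y i j) x).

Definition ricci x : 'M[R]_n := \matrix_(i, j)
  (\sum_k (partial D k (christoffel k i j) x - partial D j (christoffel k i k) x)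
   + \sum_k \sum_l (christoffel k k l x * christoffel l i j x
                    - christoffel k j l x * christoffel l i k x)).

Definition hessian (h : 'rV[R]_n -> R) x : 'M[R]_n := \matrix_(i, j)
  (partial D i (partial D j h) x
   - \sum_k christoffel k i j x * partial D k h x).

Definition metric_trace x T : R := \tr (invmx (G x) *m T).

Definition traceless x T : 'M[R]_n :=
  T - (metric_trace x T / n%:R) *: G x.

Definition scalar_curvature x : R := metric_trace x (ricci x).

Definition laplacian (h : 'rV[R]_n -> R) x : R := metric_trace x (hessian h x).

End LocalGeometry.

Section Manifold.
Context {R : realType} {m : nat} {M : topologicalType}.

Definition half_space : set 'rV[R]_m.+1 := [set x | 0 <= x 0 ord0].

(* cmap and cinv are total; they are only meaningful on the domain cdom and
   the image cimg of the chart. *)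
Record chart := Chart {
  cdom : set M;
  cmap : M -> 'rV[R]_m.+1;
  cinv : 'rV[R]_m.+1 -> M }.

Definition cimg (c : chart) : set 'rV[R]_m.+1 := cmap c @` cdom c.

Definition is_chart (c : chart) : Prop :=
  [/\ open (cdom c),
      exists2 U, open U & cimg c = U `&` half_space,
      forall p, cdom c p -> cinv c (cmap c p) = p,
      {within cdom c, continuous (cmap c)} &
      {within cimg c, continuous (cinv c)}].

Definition overlap (c c' : chart) : set 'rV[R]_m.+1 :=
  cmap c @` (cdom c `&` cdom c').

Definition transition (c c' : chart) (j : 'I_m.+1) (x : 'rV[R]_m.+1) : R :=
  cmap c' (cinv c x) 0 j.

Definition jacobian (c c' : chart) (x : 'rV[R]_m.+1) : 'M[R]_m.+1 :=
  \matrix_(i, j) partial (overlap c c') i (transition c c' j) x.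

Variable A : set chart.

Record smooth_manifold : Prop := {
  manifold_hausdorff : hausdorff_space M;
  manifold_second_countable : @second_countable M;
  manifold_chart : forall c, A c -> is_chart c;
  manifold_cover : forall p : M, exists2 c, A c & cdom c p;
  manifold_compatible : forall c c' j, A c -> A c' ->
    smooth_on (overlap c c') (transition c c' j) }.

(* The orientation is the one for which all the charts of A are positive. *)
Definition oriented : Prop :=
  forall c c' x, A c -> A c' -> overlap c c' x -> 0 < \det (jacobian c c' x).

Definition boundary : set M :=
  [set p | exists2 c, A c & cdom c p /\ cmap c p 0 ord0 = 0].

Definition smooth_function (h : M -> R) : Prop :=
  forall c, A c -> smooth_on (cimg c) (h \o cinv c).

(* g c x is the matrix of the metric in the chart c at the point of
   coordinates x. *)
Variable g : chart -> 'rV[R]_m.+1 -> 'M[R]_m.+1.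

Record riemannian_metric : Prop := {
  metric_smooth : forall c i j, A c -> smooth_on (cimg c) (fun x => g c x i j);
  metric_sym : forall c x, A c -> cimg c x -> (g c x)^T = g c x;
  metric_pos : forall c x (v : 'rV[R]_m.+1), A c -> cimg c x -> v != 0 ->
    0 < (v *m g c x *m v^T) 0 0;
  metric_change : forall c c' x, A c -> A c' -> overlap c c' x ->
    g c x = jacobian c c' x *m g c' (cmap c' (cinv c x)) *m (jacobian c c' x)^T }.

Definition scal (c : chart) : 'rV[R]_m.+1 -> R :=
  scalar_curvature (cimg c) (g c).

Record static_perfect_fluid (f rho : M -> R) : Prop := {
  spf_manifold : smooth_manifold;
  spf_metric : riemannian_metric;
  spf_boundary : boundary !=set0;
  spf_smooth_f : smooth_function f;
  spf_smooth_rho : smooth_function rho;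
  spf_pos : forall p, ~ boundary p -> 0 < f p;
  spf_zero : f @^-1` [set 0] = boundary;
  spf_ricci : forall c x, A c -> cimg c x ->
    f (cinv c x) *: traceless (g c) x (ricci (cimg c) (g c) x)
    = traceless (g c) x (hessian (cimg c) (g c) (f \o cinv c) x);
  spf_laplacian : forall c x, A c -> cimg c x ->
    laplacian (cimg c) (g c) (f \o cinv c) x
    = ((m.+1%:R - 2) / (2 * (m.+1%:R - 1)) * scal c x
       + m.+1%:R / (m.+1%:R - 1) * rho (cinv c x)) * f (cinv c x) }.

Definition partition_of_unity (N : nat) (c : 'I_N -> chart)
    (chi : 'I_N -> M -> R) : Prop :=
  [/\ forall i, A (c i),
      forall i, smooth_function (chi i),
      forall i p, 0 <= chi i p,
      forall i, closure [set p | chi i p != 0] `<=` cdom (c i) &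
      forall p, \sum_i chi i p = 1].

Definition chart_volume (c : chart) (chi : M -> R) : \bar R :=
  integral_rV (fun x : 'rV[R]_m.+1 =>
    (\1_(cimg c) x * (chi (cinv c x) * Num.sqrt (\det (g c x))))%:E).

(* Inclusion of R^m as the boundary hyperplane of the half-space. *)
Definition face (y : 'rV[R]_m) : 'rV[R]_m.+1 := row_mx (0 : 'rV_1) y.

(* Matrix of the metric induced on the boundary. *)
Definition face_metric (c : chart) (y : 'rV[R]_m) : 'M[R]_m :=
  \matrix_(a, b) g c (face y) (lift ord0 a) (lift ord0 b).

Definition chart_area (c : chart) (chi : M -> R) : \bar R :=
  integral_rV (fun y : 'rV[R]_m =>
    (\1_(cimg c) (face y) *
     (chi (cinv c (face y)) * Num.sqrt (\det (face_metric c y))))%:E).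

(* The unique value obtained from a finite smooth partition of unity
   subordinate to charts of A, all such partitions giving the same value; the
   definitions are meaningful when M is compact. *)
Definition volume : R :=
  get [set V : R | exists N (c : 'I_N -> chart) (chi : 'I_N -> M -> R),
    partition_of_unity c chi /\
    V%:E = (\sum_(i < N) chart_volume (c i) (chi i))%E].

Definition boundary_area : R :=
  get [set V : R | exists N (c : 'I_N -> chart) (chi : 'I_N -> M -> R),
    partition_of_unity c chi /\
    V%:E = (\sum_(i < N) chart_area (c i) (chi i))%E].

Definition is_min_scal (r : R) : Prop :=
  (exists c x, [/\ A c, cimg c x & scal c x = r]) /\
  (forall c x, A c -> cimg c x -> r <= scal c x).

Definition hemisphere (r : R) : set 'rV[R]_m.+2 :=
  [set y | \sum_i y 0 i ^+ 2 = r ^+ 2 /\ 0 <= y 0 ord0].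

(* r is a parameter because the class of manifolds under study is invariant
   under homothety.  phi is a diffeomorphism onto the closed round hemisphere of radius r, with
   inverse psi, and pulls the metric induced by the Euclidean one back to g. *)
Definition isometric_to_hemisphere (r : R) : Prop :=
  exists (phi : M -> 'rV[R]_m.+2) (psi : 'rV[R]_m.+2 -> M),
  [/\ (forall p, hemisphere r (phi p)) /\ (forall p, psi (phi p) = p),
      forall y, hemisphere r y -> phi (psi y) = y,
      forall k, smooth_function (fun p => phi p 0 k),
      {within hemisphere r, continuous psi} /\
      forall c k, A c ->
        smooth_on (hemisphere r `&` psi @^-1` cdom c)
                  (fun y => cmap c (psi y) 0 k) &
      forall c x i j, A c -> cimg c x ->
        g c x i j = \sum_k partial (cimg c) i (fun z => phi (cinv c z) 0 k) x
                         * partial (cimg c) j (fun z => phi (cinv c z) 0 k) x].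

End Manifold.

Arguments chart R m M : clear implicits.

(* Main.v *)
(* Write n for the dimension, u = |grad f|^2, a = (Rmin + 3 Lambda) / (2 n) and
   beta = (Rmin + Lambda) / n.  The equations give Delta f = - Lambda f and
   Hess f = f Ric - (f (R + Lambda) / n) g.  Hence Hess f = 0 on the boundary, so
   that u is a constant k^2 on the (connected) boundary.  By the Bochner identity
   and |Hess f|^2 >= (Delta f)^2 / n, the field
     W = f grad u / 2 - (u + beta f^2 / 2 - 3 k^2) grad f
   satisfies
     div W >= Lambda (a f^3 - 3 k^2 f)
            = Lambda a ((f - s)^2 (f + 2 s) - 2 s^3),  s = k / sqrt a,
   while W = 2 k^2 grad f on the boundary has outward flux -2 k^3 per unit area.
   The divergence theorem yields k^3 |bd M| <= Lambda k^3 Vol(M) / sqrt a, with a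
   strict inequality because (f - s)^2 (f + 2 s) is not identically zero; this
   also forces k > 0.  The inequality of the theorem is therefore always strict,
   and the equality case is vacuous.

   The divergence theorem is obtained chart by chart.  The terms W(chi_i) coming
   from a partition of unity cancel by invariance of the integral under change of
   charts.  The latter rests on integrating h(y) K(z - phi(y)) over y and z in
   both orders, where phi is a transition map and K a kernel concentrated near 0
   depending only on the metric, for which
   int max(0, r - <v, G v>) dv * sqrt(det G) is independent of G. *)
Require Import Defs.
From mathcomp Require Import all_boot all_order all_algebra.
From mathcomp Require Import all_classical all_reals all_analysis.
From mathcomp Require Import perm measurable_realfun ring lra.
Import Order.TTheory GRing.Theory Num.Theory.
Import numFieldNormedType.Exports.
Local Open Scope classical_set_scope.
Local Open Scope ring_scope.
Set Implicit Arguments.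
Unset Strict Implicit.
Unset Printing Implicit Defensive.

(** * Integration of uniformly continuous functions *)

Section UniformContinuity.
Context {R : realType}.
Implicit Types (V W : normedZmodType R) (B e d k : R).

(** The coefficient 3 k^2 in W is the optimal one. With a constant C in its place, div W >= Lambda
    (a f^3 - C f), whose minimum over f >= 0 is - 2 Lambda a (C / (3 a))^(3/2), while the outward
    flux is - (C - k^2) k per unit area; the resulting bound on Vol(M) / |bd M| is proportional to
    (C - k^2) / C^(3/2), which is largest at C = 3 k^2. The coefficient of u is forced: it removes
    Hess f (grad f, grad f), whose sign is unknown. The value of beta is the largest one for which
    the remaining term f u ((R + Lambda) / n - beta) is nonnegative. The obstacle is integration.
    Volumes are iterated one-variable integrals, so Fubini, integration by parts and change of
    charts are established for uniformly continuous functions of bounded support, by induction on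
    the dimension. At the boundary the transition maps are smooth only relatively to the half-space,
    so the change of charts is proved in the interior, and a cut-off depending on f controls a thin
    boundary layer. *)

Definition ucont V W (H : set V) (F : V -> W) : Prop :=
  forall e : R, 0 < e -> exists2 d : R, 0 < d &
    forall x y, H x -> H y -> `|x - y| < d -> `|F x - F y| < e.

Definition supp V (H : set V) (B : R) (F : V -> R) : Prop :=
  forall x, H x -> B < `|x| -> F x = 0.

(** The class of integrands used throughout: it is stable under slicing and partial integration, so
    that iterated integrals can be treated by induction on the dimension with no measurability
    argument in several variables. The radius [B] is explicit because the estimates depend on it. *)
Definition ucs V (H : set V) (B : R) (F : V -> R) : Prop :=
  ucont H F /\ supp H B F.

Lemma ucsW V (H H' : set V) B B' F : H' `<=` H -> B <= B' ->
  ucs H B F -> ucs H' B' F.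
Proof.
move=> HH BB [uF sF]; split.
  move=> e e0; have [d d0 dP] := uF e e0; exists d => // x y Hx Hy.
  by apply: dP; apply: HH.
by move=> x Hx Bx; apply: sF; [exact: HH|exact: le_lt_trans Bx].
Qed.

Lemma ucsD V (H : set V) B F G : ucs H B F -> ucs H B G ->
  ucs H B (fun x => F x + G x).
Proof.
move=> [uF sF] [uG sG]; split; last by move=> x Hx Bx; rewrite sF// sG// addr0.
move=> e e0; have e2 : 0 < e / 2 by lra.
have [d d0 dP] := uF _ e2; have [d' d'0 d'P] := uG _ e2.
exists (Num.min d d'); first by rewrite lt_min d0.
move=> x y Hx Hy; rewrite lt_min => /andP[xd xd'].
have -> : F x + G x - (F y + G y) = (F x - F y) + (G x - G y) by ring.
rewrite (le_lt_trans (ler_normD _ _))//.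
by rewrite (lt_le_trans (ltrD (dP _ _ Hx Hy xd) (d'P _ _ Hx Hy xd')))//; lra.
Qed.

Lemma ucsZ V (H : set V) B k F : ucs H B F -> ucs H B (fun x => k * F x).
Proof.
move=> [uF sF]; split; last by move=> x Hx Bx; rewrite sF// mulr0.
move=> e e0; have k1 : 0 < `|k| + 1 by rewrite ltr_wpDl.
have [d d0 dP] := uF _ (divr_gt0 e0 k1); exists d => // x y Hx Hy xy.
rewrite -mulrBr normrM; have := dP _ _ Hx Hy xy; rewrite ltr_pdivlMr// => h.
rewrite (le_lt_trans _ h)// mulrC ler_wpM2l// lerDl ler01//.
Qed.

Lemma ucsN V (H : set V) B F : ucs H B F -> ucs H B (fun x => - F x).
Proof.
move=> /(@ucsZ _ _ _ (-1)); congr (ucs _ _ _).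
by apply/funext => x; rewrite mulN1r.
Qed.

Lemma ucsB V (H : set V) B F G : ucs H B F -> ucs H B G ->
  ucs H B (fun x => F x - G x).
Proof. by move=> uF /ucsN; exact: ucsD. Qed.

Lemma ucs_sum V (H : set V) B (I : Type) (r : seq I) (P : pred I)
    (F : I -> V -> R) :
  (forall i, ucs H B (F i)) -> ucs H B (fun x => \sum_(i <- r | P i) F i x).
Proof.
move=> uF; elim: r => [|i r ih].
  split=> [e e0|x _ _]; last by rewrite big_nil.
  by exists 1 => // x y _ _ _; rewrite !big_nil subrr normr0.
have -> : (fun x => \sum_(j <- i :: r | P j) F j x) =
  (fun x => (if P i then F i x else 0) + \sum_(j <- r | P j) F j x).
  by apply/funext => x; rewrite big_cons; case: ifP => // _; rewrite add0r.
apply: ucsD => //; case: (P i); first exact: uF.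
by split=> // e e0; exists 1 => // x y; rewrite subrr normr0.
Qed.

Lemma norm_max_sub (a b c d : R) :
  `|Num.max a b - Num.max c d| <= Num.max `|a - c| `|b - d|.
Proof.
rewrite le_max; apply/orP.
have [ab|ba] := leP a b; have [cd|dc] := leP c d; [right|..|left] => //.
- have [h|h] := leP 0 (b - c).
    by right; rewrite !ger0_norm//; lra.
  by left; rewrite !ler0_norm//; lra.
- have [h|h] := leP 0 (a - d).
    by left; rewrite !ger0_norm//; lra.
  by right; rewrite !ler0_norm//; lra.
Qed.

Lemma ucs_max V (H : set V) B F G : ucs H B F -> ucs H B G ->
  ucs H B (fun x => Num.max (F x) (G x)).
Proof.
move=> [uF sF] [uG sG]; split; last by move=> x Hx Bx; rewrite sF// sG// maxxx.
move=> e e0.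
have [d d0 dP] := uF _ e0; have [d' d'0 d'P] := uG _ e0.
exists (Num.min d d'); first by rewrite lt_min d0.
move=> x y Hx Hy; rewrite lt_min => /andP[xd xd'].
rewrite (le_lt_trans (norm_max_sub _ _ _ _))// gt_max.
by rewrite dP// d'P.
Qed.

Lemma ucont_continuous (F : R -> R) : ucont setT F -> continuous F.
Proof.
move=> uF x; apply/cvgrPdist_lt => e e0; have [d d0 dP] := uF e e0.
by apply: filterS (nbhsx_ballx x _ d0) => y xy; exact: dP.
Qed.

End UniformContinuity.

(** * Integrals over the line *)

Section Integral1.
Context {R : realType}.
Notation mu := (@lebesgue_measure R).
Implicit Types (f g : R -> R) (a b k B e d m x t : R).

Definition ible f : Prop := mu.-integrable setT (EFin \o f).
Definition int1 f : R := \int[mu]_x f x.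

Lemma ucs_ible_itv f a b : ucont setT f ->
  mu.-integrable `[a, b] (EFin \o f).
Proof.
move=> uf; apply: (@continuous_compact_integrable R f); first exact: segment_compact.
by apply: continuous_subspaceT; exact: ucont_continuous.
Qed.

Lemma supp_patch f B a b : supp setT B f -> a <= - B -> B <= b ->
  f \_ `[a, b] = f.
Proof.
move=> sf aB Bb; apply/funext => x; rewrite patchE; case: ifPn => // xab.
rewrite sf//; move: xab; apply: contraNlt => xB; rewrite inE/= in_itv/=.
by move: xB; rewrite ler_norml => /andP[h1 h2]; rewrite (le_trans aB)// (le_trans h2).
Qed.

Lemma int1_itv f B a b : supp setT B f -> a <= - B -> B <= b ->
  int1 f = \int[mu]_(x in `[a, b]) f x.
Proof. by move=> sf aB Bb; rewrite Rintegral_mkcond (supp_patch sf). Qed.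

Lemma ucs_ible f B : ucs setT B f -> ible f.
Proof.
move=> [uf sf]; have := @ucs_ible_itv f (- B) B uf.
by move=> /integrable_mkcond; rewrite restrict_EFin (supp_patch sf)//; apply.
Qed.

Lemma ible_half f : ible f -> ible (f \_ [set t | 0 <= t]).
Proof.
rewrite /ible -restrict_EFin => fi.
have -> : [set t : R | 0 <= t] = `[0, +oo[%classic.
  by apply/seteqP; split => x /=; rewrite in_itv/= andbT.
apply: (iffLR (integrable_mkcond _ _)); first exact: measurable_itv.
by apply: (@integrableS _ _ _ mu setT).
Qed.

Lemma ibleD f g : ible f -> ible g -> ible (fun x => f x + g x).
Proof. by move=> fi gi; exact: (integrableD measurableT fi gi). Qed.

Lemma ibleZ k f : ible f -> ible (fun x => k * f x).
Proof. by move=> fi; exact: (integrableZl measurableT k fi). Qed.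

Lemma int1D f g : ible f -> ible g ->
  int1 (fun x => f x + g x) = int1 f + int1 g.
Proof. by move=> fi gi; rewrite /int1 RintegralD. Qed.

Lemma int1Z k f : ible f -> int1 (fun x => k * f x) = k * int1 f.
Proof. by move=> fi; rewrite /int1 RintegralZl. Qed.

Lemma int1_le f g : ible f -> ible g -> (forall x, f x <= g x) ->
  int1 f <= int1 g.
Proof. by move=> fi gi h; exact: le_Rintegral. Qed.

Lemma int1_box (a b : R) : a <= b ->
  ible (\1_`[a, b]) /\ int1 (\1_`[a, b]) = b - a.
Proof.
move=> ab; have E : (\int[mu]_x (\1_`[a, b] x)%:E = (b - a)%:E)%E.
  rewrite integral_indic// setIT; rewrite /= lebesgue_measure_itv/= lte_fin.
  case: ltP => //; rewrite le_eqVlt ltNge ab orbF => /eqP ->.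
  by rewrite subrr.
split; last by rewrite /int1 /Rintegral E.
exact: integrable_indic_itv.
Qed.

Lemma int1_norm_le f B e : 0 <= B -> ible f -> supp setT B f ->
  (forall x, `|f x| <= e) -> `|int1 f| <= 2 * B * e.
Proof.
move=> B0 fi sf fe; have BB : - B <= B by lra.
have [bi bE] := int1_box BB.
have e0 : 0 <= e by apply: le_trans (fe 0).
have h x : `|f x| <= e * \1_`[(- B), B] x.
  have [xB|xB] := leP `|x| B.
    by rewrite indicE mem_set ?mulr1//= in_itv/= -ler_norml.
  by rewrite sf// normr0 mulr_ge0//.
rewrite ler_norml; apply/andP; split.
  have -> : - (2 * B * e) = - e * (B - (- B)) by ring.
  rewrite -bE -int1Z//; apply: int1_le => //; first exact: ibleZ.
  by move=> x; rewrite mulNr lerNl (le_trans _ (h x))// -normrN ler_norm.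
have -> : (2 * B * e) = e * (B - (- B)) by ring.
rewrite -bE -int1Z//; apply: int1_le => //; first exact: ibleZ.
by move=> x; rewrite (le_trans _ (h x))// ler_norm.
Qed.

Lemma int1_affine f B k a : 0 <= B -> 0 < k -> ucs setT B f ->
  int1 f = k * int1 (fun x => f (k * x + a)).
Proof.
move=> B0 k0 [uf sf].
pose F (x : R) : R := k * x + a.
(* This [q] makes the image of [[- q, q]] under [F] contain the support of [f], and [f \o F] vanish
   outside [[- q, q]], so that substitution takes place on a segment. *)
pose q := (B + `|a|) / k.
have q0 : 0 <= q by apply: divr_ge0; [exact: addr_ge0|exact: ltW].
have kq : k * q = B + `|a| by rewrite /q; field; rewrite gt_eqF.
have aa : - `|a| <= a <= `|a| by rewrite -ler_norml.
have Fq : B <= F q by rewrite /F kq; lra.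
have Fnq : F (- q) <= - B by rewrite /F mulrN kq; lra.
rewrite (int1_itv sf Fnq Fq).
have sfF : supp setT q (f \o F).
  move=> x _ xq; rewrite /= sf//.
  have : k * q < k * `|x| by rewrite ltr_pM2l.
  rewrite kq -[k in k * `|x|]gtr0_norm// -normrM => h.
  have : `|k * x| <= `|k * x + a| + `|a|.
    by rewrite -{1}(addrK a (k * x)) (le_trans (ler_normB _ _)).
  by rewrite /F; lra.
rewrite (int1_itv sfF (lexx (- q)) (lexx q)).
have dF (x : R) : is_derive x (1 : R) F k.
  have h : is_derive x (1 : R) ((k *: (@id R)) + cst a) (k *: 1 + 0).
    exact: is_deriveD.
  by apply: is_derive_eq h _; rewrite addr0; exact: mulr1.
have FE : derive1 F = cst k.
  by apply/funext => x; rewrite derive1E; apply: derive_val.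
have cF : continuous F.
  by move=> x; apply: differentiable_continuous; apply/derivable1_diffP.
rewrite /Rintegral integration_by_substitution_increasing//.
- rewrite FE -[X in fine X = _]/(\int[mu]_(x in _) ((f \o F) x * k)%:E)%E.
  have i1 : mu.-integrable `[(- q), q] (EFin \o (f \o F)).
    apply: (@continuous_compact_integrable R (f \o F)).
      exact: segment_compact.
    apply: continuous_subspaceT => x; apply: continuous_comp.
      exact: cF.
    exact: ucont_continuous.
  rewrite -/(Rintegral mu _ (fun x => (f \o F) x * k)) RintegralZr//.
  exact: mulrC.
- by lra.
- by move=> x y _ _ xy; rewrite /F ltrD2r ltr_pM2l.
- by rewrite FE => x _; exact: cvg_cst.
- by rewrite FE; apply/cvg_ex; exists k; exact: cvg_cst.
- by rewrite FE; apply/cvg_ex; exists k; exact: cvg_cst.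
- split.
  + by move=> x _; apply: ex_derive.
  + by apply: cvg_at_right_filter; exact: cF.
  + by apply: cvg_at_left_filter; exact: cF.
- by apply: continuous_subspaceT; exact: ucont_continuous.
Qed.

Lemma int1_gt0 f d t0 m : ible f -> 0 < d -> 0 < m -> (forall x, 0 <= f x) ->
  (forall x, t0 <= x <= t0 + d -> m <= f x) -> 0 < int1 f.
Proof.
move=> fi d0 m0 f0 fm; have tt : t0 <= t0 + d by lra.
have [bi bE] := int1_box tt.
apply: (@lt_le_trans _ _ (int1 (fun x => m * \1_`[t0, (t0 + d)] x))).
  by rewrite int1Z// bE mulr_gt0//; lra.
apply: int1_le => //; first exact: ibleZ.
move=> x; rewrite indicE; case: (boolP (x \in _)) => [|_]; last by rewrite mulr0.
by rewrite inE/= in_itv/= => h; rewrite mulr1 fm.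
Qed.

End Integral1.

(** * Row vectors, the first coordinate split off, and the sup norm *)

Section Rows.
Context {R : realType}.

Definition vcons n (t : R) (y : 'rV[R]_n) : 'rV[R]_n.+1 :=
  row_mx (t%:M : 'rV_1) y.

Lemma vcons0 n t (y : 'rV[R]_n) : vcons t y 0 ord0 = t.
Proof.
have -> : ord0 = lshift n (ord0 : 'I_1) by apply: val_inj.
by rewrite /vcons (@row_mxEl _ 1 1 n) mxE eqxx.
Qed.

Lemma vconsS n t (y : 'rV[R]_n) i : vcons t y 0 (lift ord0 i) = y 0 i.
Proof.
have -> : lift ord0 i = rshift 1 i by apply: val_inj.
by rewrite /vcons (@row_mxEr _ 1 1 n).
Qed.

Lemma vconsP n (x : 'rV[R]_n.+1) :
  x = vcons (x 0 ord0) (\row_i x 0 (lift ord0 i)).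
Proof.
apply/rowP => i; case: (unliftP ord0 i) => [j ->|->].
  by rewrite vconsS mxE.
by rewrite vcons0.
Qed.

Lemma rvD n (x y : 'rV[R]_n) i : (x + y) 0 i = x 0 i + y 0 i.
Proof. by rewrite mxE. Qed.

Lemma rvN n (x : 'rV[R]_n) i : (- x) 0 i = - x 0 i.
Proof. by rewrite mxE. Qed.

Lemma rvZ n k (x : 'rV[R]_n) i : (k *: x) 0 i = k * x 0 i.
Proof. by rewrite mxE. Qed.

Lemma vconsB n t s (y z : 'rV[R]_n) :
  vcons t y - vcons s z = vcons (t - s) (y - z).
Proof.
apply/rowP => i; case: (unliftP ord0 i) => [j ->|->].
  by rewrite !(rvD, rvN, vconsS).
by rewrite !(rvD, rvN, vcons0).
Qed.

Lemma vconsD n t s (y z : 'rV[R]_n) :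
  vcons t y + vcons s z = vcons (t + s) (y + z).
Proof.
apply/rowP => i; case: (unliftP ord0 i) => [j ->|->].
  by rewrite !(rvD, rvN, vconsS).
by rewrite !(rvD, rvN, vcons0).
Qed.

Lemma faceE n (y : 'rV[R]_n) : face y = vcons 0 y.
Proof. by rewrite /face /vcons raddf0. Qed.

Lemma normrv_le n (x : 'rV[R]_n) e : 0 <= e ->
  (`|x| <= e) <-> (forall i, `|x 0 i| <= e).
Proof.
move=> e0; have -> : `|x| = \big[Num.max/0]_ij `|x ij.1 ij.2| := mx_normrE x; split.
  by move=> /bigmax_leP[_ h] i; apply: (h (0, i)).
by move=> h; apply/bigmax_leP; split => // -[i j] _ /=; rewrite (ord1 i).
Qed.

Lemma normrv_lt n (x : 'rV[R]_n) e : 0 < e ->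
  (`|x| < e) <-> (forall i, `|x 0 i| < e).
Proof.
move=> e0; have -> : `|x| = \big[Num.max/0]_ij `|x ij.1 ij.2| := mx_normrE x; split.
  by move=> /bigmax_ltP[_ h] i; apply: (h (0, i)).
by move=> h; apply/bigmax_ltP; split => // -[i j] _ /=; rewrite (ord1 i).
Qed.

Lemma coord_le_norm n (x : 'rV[R]_n) i : `|x 0 i| <= `|x|.
Proof. exact: (normrv_le x (normr_ge0 x)).1. Qed.

Lemma vcons_norm_lt n t (y : 'rV[R]_n) e : 0 < e ->
  `|t| < e -> `|y| < e -> `|vcons t y| < e.
Proof.
move=> e0 te ye; apply/normrv_lt => // i.
case: (unliftP ord0 i) => [j ->|->]; last by rewrite vcons0.
by rewrite vconsS (le_lt_trans (coord_le_norm _ _)).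
Qed.

Lemma vcons_norml n t (y : 'rV[R]_n) : `|t| <= `|vcons t y|.
Proof. by have := coord_le_norm (vcons t y) ord0; rewrite vcons0. Qed.

Lemma vcons_normr n t (y : 'rV[R]_n) : `|y| <= `|vcons t y|.
Proof.
apply/normrv_le => // i.
by have := coord_le_norm (vcons t y) (lift ord0 i); rewrite vconsS.
Qed.

Lemma vcons_half n t (y : 'rV[R]_n) : half_space (vcons t y) <-> 0 <= t.
Proof. by rewrite /half_space/= vcons0. Qed.

End Rows.

(** * Iterated integrals over R^n *)

Section Integraln.
Context {R : realType}.
Implicit Types (B e k t : R).

Definition intn n (F : 'rV[R]_n -> R) : R := fine (integral_rV (EFin \o F)).

Lemma integral_rV0 n : integral_rV (fun _ : 'rV[R]_n => 0%E) = 0%E :> \bar R.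
Proof.
elim: n => [//|n ih] /=; under eq_integral do rewrite ih.
by rewrite integral0.
Qed.

Lemma intn0 n : intn (fun _ : 'rV[R]_n => 0) = 0.
Proof. by rewrite /intn (integral_rV0 n). Qed.

Lemma ucs_slice n (H : set 'rV[R]_n.+1) B F t :
  ucs H B F -> (forall y, H (vcons t y)) ->
  ucs setT B (fun y : 'rV[R]_n => F (vcons t y)).
Proof.
move=> [uF sF] Ht; split.
  move=> e e0; have [d d0 dP] := uF e e0; exists d => // x y _ _ xy.
  apply: dP => //; rewrite vconsB subrr.
  by apply: vcons_norm_lt; rewrite ?normr0.
by move=> y _ By; apply: sF => //; exact: lt_le_trans (vcons_normr _ _).
Qed.

(** Both conclusions go in one induction: finiteness of the outer integral needs the slice integral
    to be uniformly continuous in [t], and this follows from the distance estimate one dimension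
    lower. *)
Lemma intn_main n B (F G : 'rV[R]_n -> R) e : 0 <= B ->
  ucs setT B F -> ucs setT B G -> (forall x, `|F x - G x| <= e) ->
  integral_rV (EFin \o F) = (intn F)%:E
  /\ `|intn F - intn G| <= (2 * B) ^+ n * e.
Proof.
move=> B0; elim: n F G e => [|n ih] F G e uF uG FG.
  by split => //; rewrite expr0 mul1r; exact: FG.
have B20 : 0 <= 2 * B by rewrite mulr_ge0.
have e0 : 0 <= e by apply: le_trans (FG 0).
pose slice (K : 'rV[R]_n.+1 -> R) t (y : 'rV[R]_n) := K (vcons t y).
have us K t : ucs setT B K -> ucs setT B (slice K t).
  by move=> uK; apply: ucs_slice uK _.
have inS K : ucs setT B K -> ucs setT B (fun t => intn (slice K t)) /\
    integral_rV (EFin \o K) = (int1 (fun t => intn (slice K t)))%:E.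
  move=> uK; have uI : ucs setT B (fun t => intn (slice K t)).
    split.
      move=> d d0.
      (* The [+ 1] covers [B = 0], where the volume factor may vanish. *)
      have d'0 : 0 < d / ((2 * B) ^+ n + 1).
        by rewrite divr_gt0// ltr_wpDl// exprn_ge0.
      have [r r0 rP] := uK.1 _ d'0; exists r => // s t _ _ st.
      have h y : `|slice K s y - slice K t y| <= d / ((2 * B) ^+ n + 1).
        apply/ltW/rP => //; rewrite vconsB subrr.
        by apply: vcons_norm_lt; rewrite ?normr0.
      have := (ih _ _ _ (us _ s uK) (us _ t uK) h).2.
      move=> /le_lt_trans; apply.
      rewrite mulrA ltr_pdivrMr; last by rewrite ltr_wpDl// exprn_ge0.
      by rewrite mulrC ltr_pM2l// ltrDl.
    move=> t _ Bt; rewrite -[RHS](intn0 n); congr (intn _).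
    apply/funext => y; apply: uK.2 => //.
    exact: lt_le_trans (vcons_norml _ _).
  split=> //; rewrite /=.
  transitivity (\int[@lebesgue_measure R]_t (intn (slice K t))%:E)%E.
    apply: eq_integral => t _; rewrite /=.
    have h0 y : `|slice K t y - slice K t y| <= 0 by rewrite subrr normr0.
    exact: (ih _ _ _ (us _ t uK) (us _ t uK) h0).1.
  rewrite /int1 /Rintegral fineK//.
  by apply: integrable_fin_num => //; exact: (ucs_ible uI).
have [uIF EF] := inS F uF; have [uIG EG] := inS G uG.
split; first by rewrite /intn EF.
have -> : intn F = int1 (fun t => intn (slice F t)) by rewrite /intn EF.
have -> : intn G = int1 (fun t => intn (slice G t)) by rewrite /intn EG.
have := int1D (ucs_ible uIF) (ucs_ible (ucsN uIG)).
have -> : int1 (fun t => - intn (slice G t)) = - int1 (fun t => intn (slice G t)).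
  rewrite -[RHS]mulN1r -int1Z; last exact: ucs_ible uIG.
  by congr int1; apply/funext => t; rewrite mulN1r.
move=> <-; rewrite exprS -mulrA.
have uD := ucsB uIF uIG.
apply: (int1_norm_le B0 (ucs_ible uD) uD.2) => t.
apply: (ih _ _ _ (us _ t uF) (us _ t uG) _).2 => y; exact: FG.
Qed.

Lemma integral_rVE n B (F : 'rV[R]_n -> R) : 0 <= B -> ucs setT B F ->
  integral_rV (EFin \o F) = (intn F)%:E.
Proof.
move=> B0 uF; apply: (@intn_main n B F F 0 B0 uF uF _).1 => x.
by rewrite subrr normr0.
Qed.

Lemma intn_dist n B (F G : 'rV[R]_n -> R) e : 0 <= B ->
  ucs setT B F -> ucs setT B G -> (forall x, `|F x - G x| <= e) ->
  `|intn F - intn G| <= (2 * B) ^+ n * e.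
Proof. by move=> B0 uF uG FG; apply: (@intn_main n B F G e B0 uF uG FG).2. Qed.

Lemma intn_slice_ucont n B (H : set 'rV[R]_n.+1) (F : 'rV[R]_n.+1 -> R) :
  0 <= B -> ucs H B F ->
  ucs [set t | forall y, H (vcons t y)] B (fun t => intn (fun y => F (vcons t y))).
Proof.
move=> B0 uF; have us t : (forall y, H (vcons t y)) -> _ := ucs_slice uF.
split.
  move=> d d0.
  have d'0 : 0 < d / ((2 * B) ^+ n + 1).
    by rewrite divr_gt0// ltr_wpDl// exprn_ge0// mulr_ge0.
  have [r r0 rP] := uF.1 _ d'0; exists r => // s t Hs Ht st.
  have h y : `|F (vcons s y) - F (vcons t y)| <= d / ((2 * B) ^+ n + 1).
    apply/ltW/rP => //; rewrite vconsB subrr.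
    by apply: vcons_norm_lt; rewrite ?normr0.
  have := intn_dist B0 (us s Hs) (us t Ht) h.
  move=> /le_lt_trans; apply.
  rewrite mulrA ltr_pdivrMr; last by rewrite ltr_wpDl// exprn_ge0// mulr_ge0.
  by rewrite mulrC ltr_pM2l// ltrDl.
move=> t Ht Bt; rewrite -[RHS](intn0 n); congr (intn _).
apply/funext => y; apply: uF.2 => //.
exact: lt_le_trans (vcons_norml _ _).
Qed.

Lemma intn_slice_ucs n B (F : 'rV[R]_n.+1 -> R) : 0 <= B -> ucs setT B F ->
  ucs setT B (fun t => intn (fun y => F (vcons t y))).
Proof. by move=> B0 uF; apply: ucsW (intn_slice_ucont B0 uF). Qed.

Lemma intnS n B (F : 'rV[R]_n.+1 -> R) : 0 <= B -> ucs setT B F ->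
  intn F = int1 (fun t => intn (fun y => F (vcons t y))).
Proof.
move=> B0 uF; rewrite {1}/intn /=.
rewrite /int1 /Rintegral; congr fine; apply: eq_integral => t _.
exact: (integral_rVE B0 (ucs_slice uF _)).
Qed.

Lemma intnD n B (F G : 'rV[R]_n -> R) : 0 <= B ->
  ucs setT B F -> ucs setT B G ->
  intn (fun x => F x + G x) = intn F + intn G.
Proof.
move=> B0; elim: n F G => [|n ih] F G uF uG; first by rewrite /intn.
rewrite (intnS B0 uF) (intnS B0 uG) (intnS B0 (ucsD uF uG)) -int1D.
- congr int1; apply/funext => t; apply: ih; [exact: ucs_slice uF _|exact: ucs_slice uG _].
- exact: ucs_ible (intn_slice_ucs B0 uF).
- exact: ucs_ible (intn_slice_ucs B0 uG).
Qed.

Lemma intnZ n B k (F : 'rV[R]_n -> R) : 0 <= B -> ucs setT B F ->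
  intn (fun x => k * F x) = k * intn F.
Proof.
move=> B0; elim: n F => [|n ih] F uF; first by rewrite /intn.
rewrite (intnS B0 uF) (intnS B0 (ucsZ k uF)) -int1Z.
  congr int1; apply/funext => t; apply: ih; exact: ucs_slice uF _.
exact: ucs_ible (intn_slice_ucs B0 uF).
Qed.

Lemma intn_sum n B (I : Type) (r : seq I) (F : I -> 'rV[R]_n -> R) : 0 <= B ->
  (forall i, ucs setT B (F i)) ->
  intn (fun x => \sum_(i <- r) F i x) = \sum_(i <- r) intn (F i).
Proof.
move=> B0 uF; elim: r => [|i r ih].
  rewrite big_nil -[RHS](intn0 n); congr intn; apply/funext => x.
  by rewrite big_nil.
rewrite big_cons -ih -(intnD B0)//; last exact: ucs_sum.
by congr intn; apply/funext => x; rewrite big_cons.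
Qed.

Lemma intn_le n B (F G : 'rV[R]_n -> R) : 0 <= B ->
  ucs setT B F -> ucs setT B G -> (forall x, F x <= G x) ->
  intn F <= intn G.
Proof.
move=> B0; elim: n F G => [|n ih] F G uF uG FG; first exact: FG.
rewrite (intnS B0 uF) (intnS B0 uG); apply: int1_le => //.
- exact: ucs_ible (intn_slice_ucs B0 uF).
- exact: ucs_ible (intn_slice_ucs B0 uG).
by move=> t; apply: ih => //; [exact: ucs_slice uF _|exact: ucs_slice uG _].
Qed.

(** The function [G + e] does not have bounded support, so the bound passes through the maximum of
    [F] and [G], which stays in the class and is within [e] of [G]. *)
Lemma intn_le_add n B (F G : 'rV[R]_n -> R) e : 0 <= B -> 0 <= e ->
  ucs setT B F -> ucs setT B G -> (forall x, F x <= G x + e) ->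
  intn F <= intn G + (2 * B) ^+ n * e.
Proof.
move=> B0 e0 uF uG FG; have uM := ucs_max uF uG.
apply: (@le_trans _ _ (intn (fun x => Num.max (F x) (G x)))).
  by apply: (intn_le B0) => // x; rewrite le_max lexx.
rewrite -lerBlDl; apply: le_trans (ler_norm _) _; apply: intn_dist => // x.
have := FG x; case: (leP (F x) (G x)) => h h'; first by rewrite subrr normr0.
by rewrite ger0_norm; lra.
Qed.

Lemma intn_ge0 n (F : 'rV[R]_n -> R) : (forall x, 0 <= F x) -> 0 <= intn F.
Proof.
rewrite /intn => F0; apply: fine_ge0.
elim: n F F0 => [|n ih] F F0; first by rewrite lee_fin.
by apply: integral_ge0 => t _; exact: ih.
Qed.

Lemma intn_gt0 n B (F : 'rV[R]_n -> R) x0 : 0 <= B -> ucs setT B F ->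
  (forall x, 0 <= F x) -> 0 < F x0 -> 0 < intn F.
Proof.
move=> B0; elim: n F x0 => [|n ih] F x0 uF F0 Fx0.
  by move: Fx0; rewrite /intn /= (_ : x0 = 0)//; apply/rowP => -[].
rewrite (intnS B0 uF); set I := (fun t => intn _).
have uI : ucs setT B I := intn_slice_ucs B0 uF.
have I0 : 0 < I (x0 0 ord0).
  apply: (ih _ (\row_i x0 0 (lift ord0 i))); first exact: ucs_slice uF _.
    by move=> y; exact: F0.
  by rewrite -vconsP.
have I20 : 0 < I (x0 0 ord0) / 2 by lra.
have [d d0 dP] := uI.1 _ I20.
apply: (@int1_gt0 R I (d / 2) (x0 0 ord0) (I (x0 0 ord0) / 2)).
- exact: ucs_ible uI.
- by lra.
- by [].
- by move=> x; exact: intn_ge0.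
- move=> x xd; have : `|x0 0 ord0 - x| < d by rewrite ltr_norml; lra.
  by move=> /(dP _ _ Logic.I Logic.I); rewrite ltr_norml; lra.
Qed.

Lemma ucs_shift n B (F : 'rV[R]_n -> R) (a : 'rV[R]_n) : ucs setT B F ->
  ucs setT (B + `|a|) (fun x => F (x + a)).
Proof.
move=> [uF sF]; split.
  move=> e e0; have [d d0 dP] := uF e e0; exists d => // x y _ _ xy.
  by apply: dP => //; rewrite opprD addrACA subrr addr0.
move=> x _ xB; apply: sF => //.
have := ler_normB (x + a) a; rewrite addrK; lra.
Qed.

Lemma intn_shift n B (F : 'rV[R]_n -> R) a : 0 <= B -> ucs setT B F ->
  intn (fun x => F (x + a)) = intn F.
Proof.
move=> B0; elim: n F a => [|n ih] F a uF.
  by congr intn; apply/funext => x; congr F; apply/rowP => -[].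
rewrite (intnS B0 uF) (intnS (addr_ge0 B0 (normr_ge0 a)) (ucs_shift a uF)).
rewrite [RHS](int1_affine (a 0 ord0) B0 ltr01 (intn_slice_ucs B0 uF)) mul1r.
congr int1; apply/funext => t; rewrite mul1r.
rewrite -[RHS](ih _ (\row_i a 0 (lift ord0 i)))//; last exact: ucs_slice uF _.
by congr intn; apply/funext => y; rewrite {1}(vconsP a) vconsD.
Qed.

End Integraln.

(** * Uniform continuity from compactness *)

Section Compactness.
Context {R : realType}.

(** Heine's theorem takes care of every pair with a point in [C], and two points outside [C] both
    give 0. Continuity relative to [H] is thus required at points of [C] only, which suits functions
    extended by 0 from a compact part of a chart. *)
Lemma compact_ucont n (W : normedZmodType R) (H C : set 'rV[R]_n)
    (F : 'rV[R]_n -> W) : compact C ->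
  (forall x, C x -> H x -> forall e : R, 0 < e -> exists2 d : R, 0 < d &
     forall y, H y -> `|x - y| < d -> `|F x - F y| < e) ->
  C `<=` H ->
  (forall x, H x -> ~ C x -> F x = 0) -> ucont H F.
Proof.
move=> /compact_near_coveringP cC cF CH F0 e e0.
have e20 : 0 < e / 2 by lra.
pose P (d : R) x := forall y, H x -> H y -> `|x - y| < d -> `|F x - F y| < e.
have [d d0 dP] : exists2 d : R, 0 < d & C `<=` P d.
  have := cC _ (0 : R)^'+ P _.
  have h : forall x, C x -> \forall x' \near x & d \near (0 : R)^'+, P d x'.
    move=> x Cx; have [d d0 dP] := cF x Cx (CH _ Cx) _ e20.
    exists (ball x (d / 2), [set t | t < d / 2]).
      split; first by apply: nbhsx_ballx; rewrite divr_gt0.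
      by apply: nbhs_right_lt; rewrite divr_gt0.
    move=> [x' t] [/= xx' td] y Hx' Hy x'y.
    rewrite -ball_normE/= in xx'.
    have h1 : `|F x - F x'| < e / 2 by apply: dP => //; lra.
    have h2 : `|F x - F y| < e / 2.
      apply: dP => //; have -> : x - y = (x - x') + (x' - y) by rewrite addrA subrK.
      by rewrite (le_lt_trans (ler_normD _ _))//; lra.
    have -> : F x' - F y = (F x - F y) - (F x - F x').
      by rewrite opprB [RHS]addrC addrA subrK.
    by rewrite (le_lt_trans (ler_normB _ _))//; lra.
  move=> /(_ _ h) h'.
  have : \forall t \near (0 : R)^'+, 0 < t /\ C `<=` P t.
    near=> t; split; first by near: t; exact: nbhs_right_gt.
    by near: t; exact: h'.
  by move=> /filter_ex[t [t0 tP]]; exists t.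
exists d => // x y Hx Hy xy.
have [Cx|nCx] := pselect (C x); first exact: (dP x).
have [Cy|nCy] := pselect (C y); first by rewrite distrC; apply: (dP y); rewrite 1?distrC.
by rewrite !F0// subrr normr0.
Unshelve. all: by end_near. Qed.

Lemma compact_ball n (B : R) : compact [set x : 'rV[R]_n | `|x| <= B].
Proof.
apply: bounded_closed_compact.
  by exists B; split; [exact: num_real|move=> M BM x /= xB; rewrite (le_trans xB)// ltW].
rewrite (_ : mkset _ = (fun x : 'rV[R]_n => `|x|) @^-1` [set t | t <= B])//.
by apply: preimage_closed; [move=> x _; exact: norm_continuous|exact: closed_le].
Qed.

Lemma continuous_ucs n B (F : 'rV[R]_n -> R) : continuous F ->
  supp setT B F -> ucs setT B F.
Proof.
move=> cF sF; split=> //.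
apply: (compact_ucont (@compact_ball n B)) => //.
  move=> x _ _ e e0; have /cvgrPdist_lt/(_ e e0) := cF x.
  move=> /nbhs_ballP[d d0 dP]; exists d => // y _ xy.
  by apply: dP; rewrite -ball_normE.
by move=> x _ /negP; rewrite -ltNge; exact: sF.
Qed.

End Compactness.

(** * Exchange of the order of integration *)

Section Swap.
Context {R : realType}.
Implicit Types (B e h t : R).

Definition ucs2 (V W : normedZmodType R) B (F : V -> W -> R) : Prop :=
  (forall e : R, 0 < e -> exists2 d : R, 0 < d & forall x x' y y',
     `|x - x'| < d -> `|y - y'| < d -> `|F x y - F x' y'| < e) /\
  (forall x y, B < `|x| \/ B < `|y| -> F x y = 0).

Lemma ucs2l (V W : normedZmodType R) B (F : V -> W -> R) x : ucs2 B F ->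
  ucs setT B (F x).
Proof.
move=> [uF sF]; split; last by move=> y _ By; apply: sF; right.
move=> e e0; have [d d0 dP] := uF e e0; exists d => // y y' _ _ yy.
by apply: dP; rewrite // subrr normr0.
Qed.

Lemma ucs2C (V W : normedZmodType R) B (F : V -> W -> R) : ucs2 B F ->
  ucs2 B (fun y x => F x y).
Proof.
move=> [uF sF]; split; last by move=> y x h; apply: sF; case: h => ?; [right|left].
move=> e e0; have [d d0 dP] := uF e e0; exists d => // y y' x x' yy xx.
exact: dP.
Qed.

Lemma ucs2_intn (V : normedZmodType R) n B (F : V -> 'rV[R]_n -> R) : 0 <= B ->
  ucs2 B F -> ucs setT B (fun x => intn (F x)).
Proof.
move=> B0 uF; split.
  move=> d d0.
  have d'0 : 0 < d / ((2 * B) ^+ n + 1).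
    by rewrite divr_gt0// ltr_wpDl// exprn_ge0// mulr_ge0.
  have [r r0 rP] := uF.1 _ d'0; exists r => // s t _ _ st.
  have h y : `|F s y - F t y| <= d / ((2 * B) ^+ n + 1).
    by apply/ltW/rP => //; rewrite subrr normr0.
  have := intn_dist B0 (ucs2l s uF) (ucs2l t uF) h.
  move=> /le_lt_trans; apply.
  rewrite mulrA ltr_pdivrMr; last by rewrite ltr_wpDl// exprn_ge0// mulr_ge0.
  by rewrite mulrC ltr_pM2l// ltrDl.
move=> t _ Bt; rewrite -[RHS](intn0 n); congr (intn _).
by apply/funext => y; apply: uF.2; left.
Qed.

Lemma ucs2_int1 (V : normedZmodType R) B (F : V -> R -> R) : 0 <= B ->
  ucs2 B F -> ucs setT B (fun x => int1 (F x)).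
Proof.
move=> B0 uF; split.
  move=> d d0.
  have d'0 : 0 < d / (2 * B + 1) by rewrite divr_gt0// ltr_wpDl// mulr_ge0.
  have [r r0 rP] := uF.1 _ d'0; exists r => // s t _ _ st.
  have h y : `|F s y - F t y| <= d / (2 * B + 1).
    by apply/ltW/rP => //; rewrite subrr normr0.
  have uD := ucsB (ucs2l s uF) (ucs2l t uF).
  have := int1_norm_le B0 (ucs_ible uD) uD.2 h.
  have -> : int1 (fun y => F s y - F t y) = int1 (F s) - int1 (F t).
    rewrite int1D; first last.
      exact: ucs_ible (ucsN (ucs2l t uF)).
      exact: ucs_ible (ucs2l s uF).
    congr (_ + _); rewrite -[RHS]mulN1r -int1Z; last exact: ucs_ible (ucs2l t uF).
    by congr int1; apply/funext => y; rewrite mulN1r.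
  move=> /le_lt_trans; apply.
  rewrite mulrA ltr_pdivrMr; last by rewrite ltr_wpDl// mulr_ge0.
  by rewrite mulrC ltr_pM2l// ltrDl.
move=> t _ Bt; rewrite (_ : F t = fun=> 0); last first.
  by apply/funext => y; apply: uF.2; left.
by rewrite /int1 Rintegral_cst// mul0r.
Qed.

Definition clamp (u : R) : R := Num.max 0 (Num.min 1 u).

Lemma clamp_bounds u : 0 <= clamp u <= 1.
Proof.
rewrite /clamp; case: (leP 1 u) => h; first by rewrite max_r ?ler01 ?lexx.
by case: (leP 0 u) => h2; apply/andP; split => //; exact: ltW.
Qed.

Lemma clamp0 u : u <= 0 -> clamp u = 0.
Proof.
move=> u0; rewrite /clamp; case: (leP 1 u) => h; last by rewrite max_l.
by have := lt_le_trans ltr01 (le_trans h u0); rewrite ltxx.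
Qed.

Lemma clamp1 u : 1 <= u -> clamp u = 1.
Proof. by move=> u0; rewrite /clamp min_l// max_r. Qed.

Lemma clamp_le u v : u <= v -> clamp u <= clamp v.
Proof.
move=> uv; rewrite /clamp ge_max le_max lexx/= le_max; apply/orP; right.
by rewrite le_min ge_min lexx/= ge_min uv orbT.
Qed.

Lemma clamp_lip u v : `|clamp u - clamp v| <= `|u - v|.
Proof.
rewrite (le_trans (norm_max_sub _ _ _ _))// subrr normr0 ge_max normr_ge0/=.
by case: (leP 1 u) => a; case: (leP 1 v) => b; case: (leP 0 (u - v)) => c;
  rewrite ?(ger0_norm c) ?(ltr0_norm c) ?ler_norml ?lexx//; apply/andP; split; lra.
Qed.

Lemma int1_sum (I : Type) (r : seq I) (F : I -> R -> R) :
  (forall i, ible (F i)) ->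
  ible (fun x => \sum_(i <- r) F i x) /\
  int1 (fun x => \sum_(i <- r) F i x) = \sum_(i <- r) int1 (F i).
Proof.
move=> iF; elim: r => [|i r [ih1 ih2]].
  have -> : (fun x => \sum_(i <- [::]) F i x) = fun=> 0.
    by apply/funext => x; rewrite big_nil.
  split; first exact: integrable0.
  by rewrite big_nil /int1 Rintegral_cst// mul0r.
have -> : (fun x => \sum_(j <- i :: r) F j x) =
    (fun x => F i x + \sum_(j <- r) F j x).
  by apply/funext => x; rewrite big_cons.
by split; [exact: ibleD|rewrite big_cons int1D// ih2].
Qed.

Lemma eq0_of_small (x C : R) : 0 <= C -> (forall e, 0 < e -> `|x| <= C * e) ->
  x = 0.
Proof.
move=> C0 h; apply/eqP; rewrite -normr_le0 leNgt; apply/negP => x0.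
have d0 : 0 < `|x| / (2 * (C + 1)) by rewrite divr_gt0// mulr_gt0// ltr_wpDl.
have := h _ d0; rewrite mulrA ler_pdivlMr; last by rewrite mulr_gt0// ltr_wpDl.
nra.
Qed.

(** Fubini by approximation: [G t y] is uniformly close to a finite sum of products
    [b k t * G (T k) y], for which the exchange is mere linearity (both orders give [J]), and each
    iterated integral is Lipschitz for the uniform distance. *)
Lemma swap1 n B (G : R -> 'rV[R]_n -> R) : 0 <= B -> ucs2 B G ->
  int1 (fun t => intn (G t)) = intn (fun y => int1 (fun t => G t y)).
Proof.
move=> B0 uG; apply/eqP; rewrite -subr_eq0; apply/eqP.
(* Large enough to contain the supports of the tents [b k] below, which lie within [B + 1 + 2 * h]
   of the origin, with [h <= 1]. *)
set B2 := 3 * B + 5.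
have B20 : 0 <= B2 by rewrite /B2; lra.
have BB2 : B <= B2 by rewrite /B2; lra.
have P0 : 0 <= (2 * B) ^+ n by rewrite exprn_ge0// mulr_ge0.
apply: (@eq0_of_small _ (2 * (2 * B2 * (2 * B) ^+ n))).
  by rewrite mulr_ge0// mulr_ge0// mulr_ge0.
move=> e e0; have [d d0 dP] := uG.1 _ e0.
set h := Num.min (d / 2) 1.
have h0 : 0 < h by rewrite lt_min; apply/andP; split; lra.
have hd : h <= d / 2 by rewrite ge_min lexx.
have h1 : h <= 1 by rewrite ge_min lexx orbT.
(* With this [N] the nodes run from [T 0 = - B - h] to a point [T N] between [B] and [B + h]. *)
have [N [N1 N2]] : exists N : nat,
    N%:R * h >= 2 * B + h /\ N%:R * h <= 2 * B + 2 * h.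
  have q0 : 0 <= (2 * B + h) / h by rewrite divr_ge0//; lra.
  exists (Num.truncn ((2 * B + h) / h)).+1.
  have /andP[t1 t2] := truncn_itv q0.
  split; first by rewrite -ler_pdivrMr// ltW.
  rewrite -addn1 natrD mulrDl mul1r.
  have : (Num.truncn ((2 * B + h) / h))%:R * h <= 2 * B + h by rewrite -ler_pdivlMr.
  by lra.
pose T (k : nat) : R := - B - h + k%:R * h.
have TS k : T k.+1 = T k + h by rewrite /T -addn1 natrD mulrDl mul1r addrA.
pose c (k : nat) t := clamp ((t - T k) / h).
(* Differences of consecutive ramps: tents of width [2 * h], whose sum telescopes and equals 1 on
   [[- B, B]]. *)
pose b (k : nat) t := c k t - c k.+1 t.
have b_ge0 k t : 0 <= b k t.
  rewrite subr_ge0; apply: clamp_le; rewrite ler_pM2r ?invr_gt0//.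
  by rewrite TS; lra.
have b_near k t : 2 * h <= `|t - T k| -> b k t = 0.
  rewrite /b /c TS; have [u0|u0] := leP 0 (t - T k).
    rewrite ger0_norm// => u.
    rewrite !clamp1 ?subrr// ler_pdivlMr// mul1r; lra.
  rewrite ltr0_norm// => u.
  by rewrite !clamp0 ?subrr// pmulr_lle0 ?invr_gt0//; lra.
have Tb k : (k < N)%N -> - B - 1 <= T k /\ T k <= B + 1.
  move=> kN; have : k%:R + 1 <= N%:R :> R by rewrite natr1 ler_nat.
  rewrite /T => kN'; have : 0 <= k%:R * h by rewrite mulr_ge0// ltW.
  have : (k%:R + 1) * h <= N%:R * h by rewrite ler_pM2r.
  by rewrite mulrDl mul1r; split; lra.
have ub (k : 'I_N) : ucs setT B2 (b k).
  split.
    move=> e1 e10; exists (e1 * h / 2); first by rewrite divr_gt0// mulr_gt0.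
    move=> x y _ _ xy; rewrite /b.
    have l j : `|c j x - c j y| < e1 / 2.
      rewrite (le_lt_trans (clamp_lip _ _))// -mulrBl.
      have -> : x - T j - (y - T j) = x - y by ring.
      rewrite normrM [ `|h^-1|]gtr0_norm ?invr_gt0// ltr_pdivrMr//; lra.
    have -> : c k x - c k.+1 x - (c k y - c k.+1 y) =
      (c k x - c k y) - (c k.+1 x - c k.+1 y) by ring.
    rewrite (le_lt_trans (ler_normB _ _))//.
    by have := l k; have := l k.+1; lra.
  move=> x _ Bx; apply: b_near.
  have [t1 t2] := Tb k (ltn_ord k).
  have : `|T k| <= B + 1 by rewrite ler_norml; lra.
  have := ler_normD (x - T k) (T k); rewrite subrK /B2 in Bx *; lra.
have bsum t : \sum_(k < N) b k t = c 0%N t - c N t.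
  rewrite -(big_mkord xpredT (fun k => b k t)).
  by rewrite (eq_bigr (fun k => - (c k.+1 t - c k t))) ?sumrN ?telescope_sumr ?opprB// => k _; rewrite opprB.
pose A t y := \sum_(k < N) b k t * G (T k) y.
have GA t y : `|G t y - A t y| <= e.
  have -> : G t y - A t y = \sum_(k < N) b k t * (G t y - G (T k) y).
    transitivity ((\sum_(k < N) b k t) * G t y - A t y); last first.
      rewrite mulr_suml /A -sumrB; apply: eq_bigr => k _; by rewrite mulrBr.
    congr (_ - _); have [tB|tB] := leP `|t| B; last first.
      by rewrite uG.2 ?mulr0//; left.
    move: tB; rewrite ler_norml => /andP[t1 t2].
    rewrite bsum /c clamp1 ?clamp0 ?subr0 ?mul1r//.
      by rewrite pmulr_lle0 ?invr_gt0// /T; lra.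
    by rewrite ler_pdivlMr// mul1r /T; lra.
  rewrite (le_trans (ler_norm_sum _ _ _))//.
  apply: (@le_trans _ _ (\sum_(k < N) b k t * e)).
    apply: ler_sum => k _; rewrite normrM [ `|b k t|]ger0_norm//.
    have [far|close] := leP (2 * h) `|t - T k|; first by rewrite b_near ?mul0r.
    rewrite ler_wpM2l//; apply/ltW/dP; last by rewrite subrr normr0.
    by rewrite (lt_le_trans close)//; lra.
  rewrite -mulr_suml bsum -[leRHS]mul1r; apply: ler_wpM2r; first exact: ltW.
  have /andP[_ ?] := clamp_bounds ((t - T 0%N) / h).
  have /andP[? _] := clamp_bounds ((t - T N) / h).
  by rewrite /c; lra.
have uGT t : ucs setT B (G t) := ucs2l t uG.
have uGy y : ucs setT B (fun t => G t y) := ucs2l y (ucs2C uG).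
have uA t : ucs setT B (A t) by apply: ucs_sum => k; apply: ucsZ.
have uAy y : ucs setT B2 (fun t => A t y).
  apply: ucs_sum => k; rewrite (_ : (fun _ => _) = fun t => G (T k) y * b k t).
    exact: ucsZ.
  by apply/funext => t; rewrite [LHS]mulrC.
pose J := \sum_(k < N) int1 (b k) * intn (G (T k)).
have E1 : int1 (fun t => intn (A t)) = J.
  rewrite (_ : (fun t => intn (A t)) =
     fun t => \sum_(k < N) intn (G (T k)) * b k t).
    rewrite (int1_sum _ _).2; last by move=> k; apply: ibleZ; exact: ucs_ible (ub k).
    by apply: eq_bigr => k _; rewrite (int1Z _ (ucs_ible (ub k))) [LHS]mulrC.
  apply/funext => t; rewrite (intn_sum _ B0); last by move=> k; exact: ucsZ.
  by apply: eq_bigr => k _; rewrite (intnZ _ B0 (uGT _)) [LHS]mulrC.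
have E2 : intn (fun y => int1 (fun t => A t y)) = J.
  rewrite (_ : (fun y => int1 (fun t => A t y)) =
     fun y => \sum_(k < N) int1 (b k) * G (T k) y).
    rewrite (intn_sum _ B0); last by move=> k; exact: ucsZ.
    by apply: eq_bigr => k _; rewrite (intnZ _ B0).
  apply/funext => y.
  rewrite (_ : (fun t => A t y) = fun t => \sum_(k < N) G (T k) y * b k t).
    rewrite (int1_sum _ _).2; last by move=> k; apply: ibleZ; exact: ucs_ible (ub k).
    by apply: eq_bigr => k _; rewrite (int1Z _ (ucs_ible (ub k))) [LHS]mulrC.
  by apply/funext => t; apply: eq_bigr => k _; rewrite [LHS]mulrC.
have uIG := ucs2_intn B0 uG.
have int1_dist f g d' : ucs setT B2 f -> ucs setT B2 g ->
    (forall t, `|f t - g t| <= d') -> `|int1 f - int1 g| <= 2 * B2 * d'.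
  move=> uf ug fg; have uD := ucsB uf ug.
  have := int1_norm_le B20 (ucs_ible uD) uD.2 fg.
  rewrite int1D; [|exact: ucs_ible uf|exact: ucs_ible (ucsN ug)].
  rewrite (_ : int1 (fun t => - g t) = - int1 g)//.
  rewrite -[RHS]mulN1r -int1Z; last exact: ucs_ible ug.
  by congr int1; apply/funext => t; rewrite mulN1r.
have D1 : `|int1 (fun t => intn (G t)) - J| <= 2 * B2 * ((2 * B) ^+ n * e).
  rewrite -E1; apply: int1_dist.
  - exact: ucsW uIG.
  - rewrite (_ : (fun t => intn (A t)) =
      fun t => \sum_(k < N) intn (G (T k)) * b k t).
      by apply: ucs_sum => k; exact: ucsZ.
    apply/funext => t; rewrite (intn_sum _ B0); last by move=> k; exact: ucsZ.
    by apply: eq_bigr => k _; rewrite (intnZ _ B0 (uGT _)) [LHS]mulrC.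
  - by move=> t; apply: (intn_dist B0).
have D2 : `|intn (fun y => int1 (fun t => G t y)) - J| <=
    (2 * B) ^+ n * (2 * B2 * e).
  rewrite -E2; apply: (intn_dist B0).
  - exact: (ucs2_int1 B0 (ucs2C uG)).
  - rewrite (_ : (fun y => int1 (fun t => A t y)) =
      fun y => \sum_(k < N) int1 (b k) * G (T k) y).
      by apply: ucs_sum => k; exact: ucsZ.
    apply/funext => y.
    rewrite (_ : (fun t => A t y) = fun t => \sum_(k < N) G (T k) y * b k t).
      rewrite (int1_sum _ _).2; last by move=> k; apply: ibleZ; exact: ucs_ible (ub k).
      by apply: eq_bigr => k _; rewrite (int1Z _ (ucs_ible (ub k))) [LHS]mulrC.
    by apply/funext => t; apply: eq_bigr => k _; rewrite [LHS]mulrC.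
  - move=> y; apply: int1_dist; [exact: ucsW (uGy y)|exact: uAy|].
    by move=> t; exact: GA.
have := ler_normB (int1 (fun t => intn (G t)) - J)
  (intn (fun y => int1 (fun t => G t y)) - J).
rewrite opprB addrA subrK => /le_trans; apply.
rewrite (le_trans (lerD D1 D2))// le_eqVlt; apply/orP; left; apply/eqP; ring.
Qed.

Lemma intn_swap n k B (F : 'rV[R]_n -> 'rV[R]_k -> R) : 0 <= B -> ucs2 B F ->
  intn (fun x => intn (F x)) = intn (fun y => intn (fun x => F x y)).
Proof.
move=> B0; elim: n F => [|n ih] F uF; first by rewrite /intn.
have us t : ucs2 B (fun (x : 'rV[R]_n) y => F (vcons t x) y).
  split.
    move=> e e0; have [d d0 dP] := uF.1 e e0; exists d => // x x' y y' xx yy.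
    apply: dP => //; rewrite vconsB subrr.
    by apply: vcons_norm_lt; rewrite ?normr0.
  move=> x y h; apply: uF.2; case: h => h; [left|by right].
  exact: lt_le_trans (vcons_normr _ _).
rewrite (intnS B0 (ucs2_intn B0 uF)).
transitivity (int1 (fun t => intn (fun y => intn (fun x => F (vcons t x) y)))).
  by congr int1; apply/funext => t; exact: ih.
rewrite (@swap1 k B)//.
  congr intn; apply/funext => y.
  by rewrite (intnS B0 (ucs2l y (ucs2C uF))).
split.
  move=> d d0.
  have d'0 : 0 < d / ((2 * B) ^+ n + 1).
    by rewrite divr_gt0// ltr_wpDl// exprn_ge0// mulr_ge0.
  have [r r0 rP] := uF.1 _ d'0; exists r => // s t y z st yz.
  have h x : `|F (vcons s x) y - F (vcons t x) z| <= d / ((2 * B) ^+ n + 1).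
    apply/ltW/rP => //; rewrite vconsB subrr.
    by apply: vcons_norm_lt; rewrite ?normr0.
  have := intn_dist B0 (ucs2l y (ucs2C (us s))) (ucs2l z (ucs2C (us t))) h.
  move=> /le_lt_trans; apply.
  rewrite mulrA ltr_pdivrMr; last by rewrite ltr_wpDl// exprn_ge0// mulr_ge0.
  by rewrite mulrC ltr_pM2l// ltrDl.
move=> t y h; rewrite -[RHS](intn0 n); congr (intn _).
apply/funext => x; apply: uF.2; case: h => h; [left|by right].
exact: lt_le_trans (vcons_norml _ _).
Qed.

End Swap.

(** * Positive definite matrices *)

Lemma cvg_sumr (R : realType) (T : Type) (F : set_system T) {FF : Filter F}
    (I : Type) (r : seq I) (P : pred I) (f : I -> T -> R) (l : I -> R) :
  (forall i, P i -> f i x @[x --> F] --> l i) ->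
  \sum_(i <- r | P i) f i x @[x --> F] --> \sum_(i <- r | P i) l i.
Proof.
move=> h; elim: r => [|i r ih].
  rewrite big_nil (_ : (fun x => _) = cst 0); first exact: cvg_cst.
  by apply/funext => x; rewrite big_nil.
rewrite big_cons; case: ifPn => Pi.
  rewrite (_ : (fun x => _) = fun x => f i x + \sum_(j <- r | P j) f j x).
    by apply: cvgD => //; exact: h.
  by apply/funext => x; rewrite big_cons Pi.
rewrite (_ : (fun x => _) = fun x => \sum_(j <- r | P j) f j x)//.
by apply/funext => x; rewrite big_cons (negbTE Pi).
Qed.

Section Quadratic.
Context {R : realType}.

Definition quad n (G : 'M[R]_n) (v : 'rV[R]_n) : R := (v *m G *m v^T) 0 0.

Definition posdef n (G : 'M[R]_n) : Prop :=
  G^T = G /\ forall v, v != 0 -> 0 < quad G v.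

Lemma mx00D (A B : 'M[R]_1) : (A + B) 0 0 = A 0 0 + B 0 0.
Proof. by rewrite mxE. Qed.

Lemma mx00Z k (A : 'M[R]_1) : (k *: A) 0 0 = k * A 0 0.
Proof. by rewrite mxE. Qed.

Lemma quadE n (G : 'M[R]_n) v :
  quad G v = \sum_j (\sum_i v 0 i * G i j) * v 0 j.
Proof. by rewrite /quad mxE; apply: eq_bigr => j _; rewrite !mxE. Qed.

Lemma quad0 n (G : 'M[R]_n) : quad G 0 = 0.
Proof. by rewrite /quad !mul0mx mxE. Qed.

Lemma quad_scale n k (G : 'M[R]_n) v : quad (k *: G) v = k * quad G v.
Proof. by rewrite /quad -scalemxAr -scalemxAl mxE. Qed.

Lemma quad1 n (v : 'rV[R]_n) : quad 1%:M v = \sum_i v 0 i ^+ 2.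
Proof.
by rewrite /quad mulmx1 mxE; apply: eq_bigr => i _; rewrite mxE expr2.
Qed.

Lemma quad_ge0 n (G : 'M[R]_n) v : posdef G -> 0 <= quad G v.
Proof.
move=> [_ pG]; have [->|v0] := eqVneq v 0; first by rewrite quad0.
exact/ltW/pG.
Qed.

Lemma posdef1 n : posdef (1%:M : 'M[R]_n).
Proof.
split; first exact: trmx1.
move=> v v0; rewrite lt_neqAle quad1 sumr_ge0 ?andbT; last by move=> i _; exact: sqr_ge0.
apply: contra v0; rewrite eq_sym psumr_eq0; last by move=> i _; exact: sqr_ge0.
move=> /allP h; apply/eqP/rowP => i; rewrite mxE.
by have := h i (mem_index_enum _); rewrite /= sqrf_eq0 => /eqP.
Qed.

Lemma posdef_scale n k (G : 'M[R]_n) : 0 < k -> posdef G -> posdef (k *: G).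
Proof.
move=> k0 [sG pG]; split; first by rewrite linearZ/= sG.
by move=> v v0; rewrite quad_scale mulr_gt0// pG.
Qed.

Lemma posdef_unit n (G : 'M[R]_n) : posdef G -> G \in unitmx.
Proof.
move=> [_ pG]; rewrite -row_free_unit -kermx_eq0; apply/eqP/row_matrixP => i.
rewrite row0; apply/eqP/negPn/negP => /pG.
by rewrite /quad (sub_kermxP (row_sub i _)) mul0mx mxE ltxx.
Qed.

Lemma vcons_mul n t (y : 'rV[R]_n) (s : R) (b : 'rV[R]_n) (G : 'M[R]_n) :
  quad (block_mx (s%:M : 'M[R]_1) b b^T G  : 'M[R]_n.+1) (vcons t y) =
  s * t ^+ 2 + 2 * t * (b *m y^T) 0 0 + quad G y.
Proof.
rewrite /quad /vcons.
rewrite (@mul_row_block _ 1 1 n 1 n) (@tr_row_mx _ 1 1 n) (@mul_row_col _ 1 1 n 1).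
rewrite tr_scalar_mx mul_mx_scalar mul_scalar_mx mulmxDl mul_scalar_mx -scalemxAl.
have -> : y *m b^T = b *m y^T.
  by apply/matrixP => i j; rewrite !ord1 !mxE; apply: eq_bigr => k _; rewrite !mxE mulrC.
rewrite !(mx00D, mx00Z) [X in t * (t * X + _)]mxE eqxx mulr1n; ring.
Qed.

(** Completing the square in all coordinates but the first; [s] is the Schur complement. This one
    pivot step drives the inductions for the determinant, the lower bound, the factorisation and the
    kernel integral. *)
Lemma posdef_block n (G : 'M[R]_n.+1) : posdef G ->
  exists s (w : 'rV[R]_n) (G2 : 'M[R]_n),
  [/\ 0 < s, posdef G2, \det G = s * \det G2 &
      forall t y, quad G (vcons t y) = s * t ^+ 2 + quad G2 (y + t *: w)].
Proof.
move=> [sG pG].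
pose a := G ord0 ord0; pose b := @ursubmx _ 1 n 1 n G.
pose G2 := @drsubmx _ 1 n 1 n G.
have sG2 : G2^T = G2 by rewrite /G2 (@trmx_drsub _ 1 n 1 n) sG.
have GE : G = block_mx (a%:M : 'M[R]_1) b b^T G2.
  rewrite -[LHS](@submxK _ 1 n 1 n); congr (@block_mx _ 1 n 1 n).
    apply/matrixP => i j; rewrite !ord1 !mxE eqxx mulr1n /a.
    by congr (G _ _); apply: val_inj.
  by rewrite /b (@trmx_ursub _ 1 n 1 n) sG.
have qE t y : quad G (vcons t y) = a * t ^+ 2 + 2 * t * (b *m y^T) 0 0 + quad G2 y.
  by rewrite GE vcons_mul.
have pG2 : posdef G2.
  split => // v v0; have := pG (vcons 0 v).
  rewrite qE expr0n/= mulr0 mulr0 mul0r !add0r; apply.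
  apply: contra v0 => /eqP h; apply/eqP/rowP => i.
  by rewrite -(vconsS 0 v i) h !mxE.
have uG2 := posdef_unit pG2.
pose w := b *m invmx G2.
have wE : w *m G2 = b by rewrite /w -mulmxA mulVmx// mulmx1.
pose s := a - quad G2 w.
have qs t y : quad G2 (y + t *: w) =
    quad G2 y + 2 * t * (b *m y^T) 0 0 + t ^+ 2 * quad G2 w.
  rewrite /quad linearD/= linearZ/= !mulmxDl !mulmxDr -!scalemxAl -!scalemxAr wE.
  rewrite -[X in _ = X + _ + _]/((y *m G2 *m y^T) 0 0).
  have -> : y *m G2 *m w^T = b *m y^T.
    rewrite -mulmxA -{1}sG2 -trmx_mul wE; apply/matrixP => i j.
    by rewrite !ord1 !mxE; apply: eq_bigr => k _; rewrite !mxE mulrC.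
  by rewrite !mxE; ring.
have qE2 t y : quad G (vcons t y) = s * t ^+ 2 + quad G2 (y + t *: w).
  by rewrite qE qs /s; ring.
exists s, w, G2; split => //.
  (* At this vector the second square vanishes and the form takes the value [s]. *)
  have := pG (vcons 1 (- w)); rewrite qE2 scale1r addNr quad0 addr0 expr1n mulr1.
  apply; apply/negP => /eqP/(congr1 (fun v : 'rV_n.+1 => v 0 ord0)).
  by rewrite vcons0 mxE => /eqP; rewrite oner_eq0.
pose U : 'M[R]_n.+1 := block_mx (1%:M : 'M[R]_1) w 0 1%:M.
pose D : 'M[R]_n.+1 := block_mx (s%:M : 'M[R]_1) 0 0 G2.
have E : G = U *m D *m U^T.
  rewrite /U /D (@mulmx_block _ 1 n 1 n 1 n) (@tr_block_mx _ 1 n 1 n).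
  rewrite (@mulmx_block _ 1 n 1 n 1 n).
  rewrite !(mul1mx, mulmx1, mul0mx, mulmx0, addr0, add0r, trmx1, trmx0) wE GE.
  congr (@block_mx _ 1 n 1 n).
    apply/matrixP => i j; rewrite !ord1 mxE [RHS]mxE [in RHS]mxE eqxx !mulr1n.
    by rewrite -wE /s /quad subrK.
  by rewrite -wE trmx_mul sG2.
rewrite E !det_mulmx det_tr /U (@det_ublock _ 1 n) /D (@det_ublock _ 1 n).
by rewrite !det1 !mul1r mulr1 det_scalar1.
Qed.

Lemma posdef_det n (G : 'M[R]_n) : posdef G -> 0 < \det G.
Proof.
elim: n G => [|n ih] G pG; first by rewrite det_mx00.
have [s [w [G2 [s0 pG2 -> _]]]] := posdef_block pG.
by rewrite mulr_gt0// ih.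
Qed.

Lemma posdef_lower n (G : 'M[R]_n) : posdef G ->
  exists2 l, 0 < l & forall v, l * `|v| ^+ 2 <= quad G v.
Proof.
elim: n G => [|n ih] G pG.
  exists 1 => // v; have -> : v = 0 by apply/rowP => -[].
  by rewrite normr0 expr0n mulr0 quad0.
have [s [w [G2 [s0 pG2 _ qE]]]] := posdef_block pG.
have [l l0 lE] := ih G2 pG2.
pose W := 1 + 2 * `|w| ^+ 2.
have W0 : 0 < W by rewrite /W ltr_pwDl// mulr_ge0// sqr_ge0.
(* The first entry pays for the shift [t *: w], the second for the factor 2 in the estimate of
   [|y|^2] by [2 z^2 + 2 t^2 |w|^2]. *)
exists (Num.min (s / W) (l / 2)); first by rewrite lt_min !divr_gt0.
move=> v; rewrite (vconsP v); set t := v 0 ord0; set y := (\row_i _).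
set m := Num.min _ _.
have m0 : 0 < m by rewrite lt_min !divr_gt0.
have mW : m * W <= s by rewrite -ler_pdivlMr// ge_min lexx.
have ml : m * 2 <= l by rewrite -ler_pdivlMr// ge_min lexx orbT.
rewrite qE; apply: le_trans (lerD (lexx _) (lE _)).
set z := `|y + t *: w|.
have yz : `|y| <= z + `|t| * `|w|.
  by rewrite /z -normrZ -{1}(addrK (t *: w) y) (le_trans (ler_normB _ _)).
have h1 : `|y| ^+ 2 <= 2 * z ^+ 2 + 2 * t ^+ 2 * `|w| ^+ 2.
  rewrite -[t ^+ 2](real_normK (num_real t)).
  have := normr_ge0 y; have : 0 <= z by exact: normr_ge0.
  have : 0 <= `|t| * `|w| by exact: mulr_ge0.
  set p := _ * `|w| in yz *; move=> p0 z0 y0.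
  have -> : 2 * `|t| ^+ 2 * `|w| ^+ 2 = 2 * p ^+ 2 by rewrite /p; ring.
  have : `|y| ^+ 2 <= (z + p) ^+ 2 by rewrite ler_sqr ?nnegrE// addr_ge0.
  have := sqr_ge0 (z - p); rewrite !expr2; lra.
have h2 : `|vcons t y| ^+ 2 <= t ^+ 2 * W + 2 * z ^+ 2.
  have : `|vcons t y| <= Num.max `|t| `|y|.
    apply/normrv_le; first by rewrite le_max normr_ge0.
    move=> i; case: (unliftP ord0 i) => [j ->|->].
      by rewrite vconsS le_max coord_le_norm orbT.
    by rewrite vcons0 le_max lexx.
  have tt : `|t| ^+ 2 = t ^+ 2 by exact: real_normK (num_real t).
  have := sqr_ge0 z; have := sqr_ge0 t; have := sqr_ge0 `|w|.
  rewrite le_max /W => w0 t0 z0 /orP[|] h.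
    have : `|vcons t y| ^+ 2 <= `|t| ^+ 2 by rewrite ler_sqr ?nnegrE.
    have := mulr_ge0 t0 w0; rewrite tt; lra.
  have : `|vcons t y| ^+ 2 <= `|y| ^+ 2 by rewrite ler_sqr ?nnegrE.
  by lra.
apply: (@le_trans _ _ (m * (t ^+ 2 * W + 2 * z ^+ 2))); first by rewrite ler_pM2l.
have -> : m * (t ^+ 2 * W + 2 * z ^+ 2) = (m * W) * t ^+ 2 + (m * 2) * z ^+ 2 by ring.
by rewrite lerD// ler_wpM2r// sqr_ge0.
Qed.

Lemma posdef_factor n (G : 'M[R]_n) : posdef G -> exists B : 'M[R]_n, G = B *m B^T.
Proof.
elim: n G => [|n ih] G pG; first by exists 0; apply/matrixP => -[].
have [s [w [G2 [s0 pG2 _ qE]]]] := posdef_block pG.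
have [B2 B2E] := ih G2 pG2.
pose B : 'M[R]_n.+1 := block_mx ((Num.sqrt s)%:M : 'M[R]_1) (w *m B2) 0 B2.
have qB v : quad G v = quad (B *m B^T) v.
  rewrite (vconsP v); set t := v 0 ord0; set y := (\row_i _).
  rewrite qE B2E /quad.
  have F k (x : 'rV[R]_k) (C : 'M[R]_k) : x *m (C *m C^T) *m x^T = (x *m C) *m (x *m C)^T.
    by rewrite trmx_mul !mulmxA.
  rewrite !F /vcons /B (@mul_row_block _ 1 1 n 1 n).
  rewrite (@tr_row_mx _ 1 1 n) (@mul_row_col _ 1 1 n 1) mulmx0 addr0.
  rewrite mx00D; congr (_ + _).
    rewrite -scalar_mxM tr_scalar_mx -scalar_mxM mxE eqxx mulr1n.
    by rewrite -{1}(sqr_sqrtr (ltW s0)); ring.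
  have -> : t%:M *m (w *m B2) + y *m B2 = (y + t *: w) *m B2; last by [].
  by rewrite mul_scalar_mx mulmxDl addrC scalemxAl.
exists B; have symB : (B *m B^T)^T = B *m B^T by rewrite trmx_mul trmxK.
have sG := pG.1.
(* Polarisation: symmetric matrices with the same quadratic form are equal, so [qB] suffices. *)
have pol (M : 'M[R]_n.+1) i j : M^T = M ->
    2 * M i j = quad M (delta_mx 0 i + delta_mx 0 j)
      - quad M (delta_mx 0 i) - quad M (delta_mx 0 j).
  move=> sM; have ME k l : (delta_mx 0 k *m M *m (delta_mx 0 l)^T : 'M[R]_1) 0 0 = M k l.
    by rewrite trmx_delta -rowE -colE !mxE.
  rewrite /quad linearD/= !mulmxDl !mulmxDr [in RHS]mxE.
  rewrite [X in X + _ - _ - _]mxE [X in _ + X - _ - _]mxE !ME.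
  have -> : M j i = M i j by rewrite -{1}sM mxE.
  ring.
apply/matrixP => i j; have := pol G i j sG.
rewrite !qB -(pol _ i j symB); lra.
Qed.

Definition kern n (r : R) (G : 'M[R]_n) (v : 'rV[R]_n) : R :=
  Num.max 0 (r - quad G v).

Lemma kern_ge0 n r (G : 'M[R]_n) v : 0 <= kern r G v.
Proof. by rewrite /kern le_max lexx. Qed.

Lemma quad_continuous n (G : 'M[R]_n) : continuous (quad G).
Proof.
rewrite (_ : quad G = fun v => \sum_j (\sum_i v 0 i * G i j) * v 0 j); last first.
  by apply/funext => v; exact: quadE.
move=> v; apply: (@cvg_sumr R _ (nbhs v)) => j _; apply: cvgM; last exact: coord_continuous.
apply: (@cvg_sumr R _ (nbhs v)) => i _; apply: cvgM; last exact: cvg_cst.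
exact: coord_continuous.
Qed.

Lemma kern_ucs n r (G : 'M[R]_n) : posdef G ->
  exists2 B, 0 <= B & ucs setT B (kern r G).
Proof.
move=> pG; have [l l0 lE] := posdef_lower pG.
pose B := `|r| / l + 1.
have B1 : 1 <= B by rewrite /B lerDr divr_ge0// ltW.
exists B; first by rewrite (le_trans _ B1).
apply: continuous_ucs.
  move=> v; apply: (@continuous_max R _ (cst 0) (fun v => r - quad G v)).
    exact: (@cst_continuous _ _ (0 : R) v).
  apply: (@continuousB _ _ _ (cst r) (quad G)).
    exact: (@cst_continuous _ _ (r : R) v).
  exact: quad_continuous.
move=> v _ Bv; rewrite /kern max_l// subr_le0.
apply: le_trans (lE v); rewrite (le_trans (ler_norm r))//.
rewrite -ler_pdivrMl// mulrC (@le_trans _ _ B)//; first by rewrite /B lerDl.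
by rewrite expr2; apply: (@le_trans _ _ (B * B)); [rewrite ler_peMl//; lra|apply: ler_pM; lra].
Qed.

Definition Cn n (r : R) : R := intn (kern r (1%:M : 'M[R]_n)).

Lemma sum_sq_vcons n t (y : 'rV[R]_n) :
  quad 1%:M (vcons t y) = t ^+ 2 + quad 1%:M y.
Proof.
rewrite !quad1 big_ord_recl vcons0; congr (_ + _).
by apply: eq_bigr => i _; rewrite vconsS.
Qed.

(** By [posdef_block] the slice at [t] is a translate of a kernel for the smaller block, with [r]
    lowered by [s * t ^+ 2]; rescaling [t] by the square root of [s] then supplies the missing
    factor of the determinant. No sign is imposed on [r], because it becomes negative along the
    induction. *)
Lemma intn_kern n r (G : 'M[R]_n) : posdef G ->
  intn (kern r G) * Num.sqrt (\det G) = Cn n r.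
Proof.
elim: n r G => [|n ih] r G pG.
  rewrite det_mx00 sqrtr1 mulr1 /Cn; congr intn; apply/funext => v.
  by have -> : v = 0 by [apply/rowP => -[]]; rewrite /kern !quad0.
have [s [w [G2 [s0 pG2 dE qE]]]] := posdef_block pG.
have [B B0 uB] := kern_ucs r pG.
have [B1 B10 uB1] := kern_ucs r (@posdef1 n.+1).
have d20 := posdef_det pG2.
have sl t : intn (fun y => kern r G (vcons t y)) * Num.sqrt (\det G2) =
    Cn n (r - s * t ^+ 2).
  rewrite -(ih _ G2 pG2); congr (_ * _).
  have [B2 B20 uB2] := kern_ucs (r - s * t ^+ 2) pG2.
  rewrite -(intn_shift (t *: w) B20 uB2); congr intn; apply/funext => y.
  by rewrite /kern qE opprD addrA.
have sl1 t : intn (fun y => kern r (1%:M : 'M[R]_n.+1) (vcons t y)) =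
    Cn n (r - t ^+ 2).
  rewrite /Cn; congr intn; apply/funext => y.
  by rewrite /kern sum_sq_vcons opprD addrA.
rewrite dE sqrtrM; last exact: ltW.
rewrite (intnS B0 uB).
have uS := intn_slice_ucs B0 uB.
have := int1Z (Num.sqrt (\det G2)) (ucs_ible uS).
rewrite (_ : (fun x => Num.sqrt (\det G2) * _) = fun t => Cn n (r - s * t ^+ 2)); last first.
  by apply/funext => t; rewrite mulrC sl.
move=> E.
have -> : forall a b c : R, a * (b * c) = b * (c * a) by move=> *; ring.
rewrite -E [in RHS]/Cn (intnS B10 uB1).
have uS1 := intn_slice_ucs B10 uB1.
rewrite (_ : (fun t => intn (fun y => kern r 1%:M (vcons t y))) =
  fun t => Cn n (r - t ^+ 2)) in uS1 *; last first.
  by apply/funext => t; rewrite sl1.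
have ss : 0 < Num.sqrt s by rewrite sqrtr_gt0.
rewrite [RHS](int1_affine 0 B10 ss uS1); congr (_ * int1 _); apply/funext => t.
by rewrite addr0 exprMn sqr_sqrtr// ltW.
Qed.

Lemma Cn_gt0 n r : 0 < r -> 0 < Cn n r.
Proof.
move=> r0; have [B B0 uB] := kern_ucs r (@posdef1 n).
apply: (intn_gt0 (x0 := 0) B0 uB).
  by move=> v; exact: kern_ge0.
by rewrite /kern quad0 subr0 lt_max r0 orbT.
Qed.

End Quadratic.

(** * Change of variables *)

Section KernelBound.
Context {R : realType} {n : nat}.
Implicit Types (H : 'rV[R]_n -> R) (K : set 'rV[R]_n).

Lemma ucont_continuous_rv (W : pseudoMetricNormedZmodType R) (F : 'rV[R]_n -> W) :
  ucont setT F -> continuous F.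
Proof.
move=> uF x; apply/(@cvgrPdist_lt _ _ _ (nbhs x) (nbhs_filter x)) => e e0; have [d d0 dP] := uF e e0.
by apply: filterS (nbhsx_ballx x _ d0) => y; rewrite -ball_normE => xy; exact: dP.
Qed.

Lemma compact_bound (T : topologicalType) (K : set T) (F : T -> R) : compact K ->
  (forall x, K x -> {for x, continuous F}) ->
  exists2 M, 0 <= M & forall x, K x -> `|F x| <= M.
Proof.
move=> /compact_near_coveringP cK cF.
have := cK _ (+oo_R : set_system R) (fun M x => `|F x| <= M) _.
have h x : K x -> \forall x' \near x & M \near (+oo_R : set_system R), `|F x'| <= M.
  move=> Kx; have /cvgrPdist_lt/(_ 1 ltr01) := cF x Kx.
  move=> hx; exists ([set x' | `|F x - F x'| < 1], [set M | `|F x| + 1 < M]).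
    split => //; apply: nbhs_pinfty_gt; exact: num_real.
  move=> [x' M] /= [h1 h2]; have := ler_normB (F x) (F x - F x').
  by rewrite opprB addrC subrK; lra.
move=> /(_ _ h) h'.
have : \forall M \near (+oo_R : set_system R), 0 < M /\ K `<=` (fun x => `|F x| <= M).
  near=> M; split; first by near: M; apply: nbhs_pinfty_gt; exact: num_real.
  by near: M; exact: h'.
by move=> /filter_ex[M [M0 MP]]; exists M => //; exact: ltW.
Unshelve. all: by end_near. Qed.

Lemma ucs_bound B H : ucs setT B H -> exists2 M, 0 <= M & forall x, `|H x| <= M.
Proof.
move=> [uH sH].
have [M M0 MP] := compact_bound (@compact_ball R n B)
  (fun x _ => ucont_continuous_rv uH (x := x)).
exists M => // x; have [xB|xB] := leP `|x| B; first exact: MP.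
by rewrite sH// normr0.
Qed.

Lemma compact_open_dist (C O : set 'rV[R]_n) : compact C -> open O -> C `<=` O ->
  exists2 d : R, 0 < d & forall x z, C x -> `|x - z| < d -> O z.
Proof.
move=> /compact_near_coveringP cC oO CO.
have := cC _ (0 : R)^'+ (fun d x => forall z, `|x - z| < d -> O z) _.
have h x : C x -> \forall x' \near x & d \near (0 : R)^'+,
    forall z, `|x' - z| < d -> O z.
  move=> Cx; have /nbhs_ballP[d d0 dP] : nbhs x O by exact: open_nbhs_nbhs (conj oO (CO _ Cx)).
  exists (ball x (d / 2), [set t | t < d / 2]).
    split; first by apply: nbhsx_ballx; rewrite divr_gt0.
    by apply: nbhs_right_lt; rewrite divr_gt0.
  move=> [x' t] [/= xx' td] z x'z; apply: dP.
  rewrite -ball_normE/= in xx' *.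
  have -> : x - z = (x - x') + (x' - z) by rewrite addrA subrK.
  by rewrite (le_lt_trans (ler_normD _ _))//; move: (d) xx' td x'z => d' /=; lra.
move=> /(_ _ h) h'.
have : \forall t \near (0 : R)^'+, 0 < t /\ C `<=` (fun x => forall z, `|x - z| < t -> O z).
  near=> t; split; first by near: t; exact: nbhs_right_gt.
  by near: t; exact: h'.
by move=> /filter_ex[t [t0 tP]]; exists t => // x z Cx; exact: tP.
Unshelve. all: by end_near. Qed.

Lemma kern_le r (G : 'M[R]_n) v : posdef G -> 0 <= r -> kern r G v <= r.
Proof.
move=> pG r0; rewrite /kern ge_max r0/=; have := quad_ge0 v pG; lra.
Qed.

Lemma quadN (G : 'M[R]_n) v : quad G (- v) = quad G v.
Proof. by rewrite /quad linearN/= mulNmx mulNmx mulmxN opprK. Qed.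

Lemma kern_neq0 r (G : 'M[R]_n) v : kern r G v != 0 -> quad G v < r.
Proof.
move=> h; rewrite ltNge; apply/negP => rQ; move/eqP: h; apply.
by rewrite /kern max_l// subr_le0.
Qed.

Lemma ler_of_small (x y C : R) : 0 <= C ->
  (forall e, 0 < e -> x <= y + C * e) -> x <= y.
Proof.
move=> C0 h; apply/ler_addgt0Pr => e e0.
have C1 : 0 < C + 1 by lra.
have := h _ (divr_gt0 e0 C1); move=> /le_trans; apply.
rewrite lerD2l mulrA ler_pdivrMr// mulrC ler_pM2l//; lra.
Qed.

(* Integrating H(y) kern(z - phi y) first in z gives a multiple of H(y), and
   first in y a quantity concentrated at y = psi z. *)
Lemma kernel_bound (phi psi : 'rV[R]_n -> 'rV[R]_n) K H H' B B' Bphi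
    (G G' : 'M[R]_n) (d eta : R) :
  0 < d < 1 -> 0 < eta -> posdef G -> posdef G' ->
  0 <= B -> 0 <= B' -> ucs setT B H -> ucs setT B' H' ->
  (forall y, 0 <= H y) -> (forall z, 0 <= H' z) ->
  (forall y, ~ K y -> H y = 0) ->
  ucont K phi -> (forall y, K y -> `|phi y| <= Bphi) ->
  (forall y z, K y -> `|phi y - z| < eta ->
    (1 - d) * Num.sqrt (\det G') * H (psi z) <= Num.sqrt (\det G) * H' z /\
    (1 - d) * quad G (psi z - y) <= quad G' (z - phi y)) ->
  (1 - d) ^+ n.+1 * intn H <= intn H'.
Proof.
move=> /andP[d0 d1] eta0 pG pG' B0 B'0 uH uH' H0 H'0 KH uphi bphi hyp.
set k := 1 - d; have k0 : 0 < k by rewrite /k; lra.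
have k1 : k <= 1 by rewrite /k; lra.
have [l l0 lE] := posdef_lower pG; have [l' l'0 lE'] := posdef_lower pG'.
set w := Num.sqrt (\det G); set w' := Num.sqrt (\det G').
have w0 : 0 < w by rewrite sqrtr_gt0 posdef_det.
have w'0 : 0 < w' by rewrite sqrtr_gt0 posdef_det.
set B3 := B + B' + `|Bphi| + eta.
have B30 : 0 <= B3 by rewrite /B3; have := normr_ge0 Bphi; lra.
have BB3 : B <= B3 by rewrite /B3; have := normr_ge0 Bphi; lra.
have B'B3 : B' <= B3 by rewrite /B3; have := normr_ge0 Bphi; lra.
have P0 : 0 <= (2 * B3) ^+ n by rewrite exprn_ge0// mulr_ge0.
have [M M0 MP] := ucs_bound uH.
set q := Num.sqrt (k ^+ n).
have q0 : 0 < q by rewrite sqrtr_gt0 exprn_gt0.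
(* Replacing [G] by [k *: G] multiplies the density by [q], and [q] is at least [k ^+ n] since
   [k <= 1]. *)
suff main : q * k * intn H <= intn H'.
  apply: le_trans main; rewrite ler_wpM2r ?intn_ge0//.
  rewrite exprSr ler_wpM2r ?(ltW k0)//.
  have kn1 : k ^+ n <= 1 by rewrite exprn_ile1// ltW.
  have kn0 : 0 <= k ^+ n by rewrite exprn_ge0// ltW.
  by rewrite -{1}[k ^+ n]ger0_norm// -sqrtr_sqr ler_wsqrtr// expr2 ler_piMr.
apply: (@ler_of_small _ _ (w' * k * (2 * B3) ^+ n / w)).
  by rewrite divr_ge0// ?mulr_ge0// ltW.
move=> e e0; have [dd dd0 ddP] := uH.1 e e0.
(* The first bound confines the kernel to [|z - phi y| < eta], where [hyp] applies; the second then
   forces [|y - psi z| < dd], a distance over which [H] varies by less than [e]. *)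
pose r := Num.min (l' * eta ^+ 2) (k * l * dd ^+ 2).
have r0 : 0 < r by rewrite lt_min !mulr_gt0// exprn_gt0.
have sq_lt (a b c : R) : 0 <= a -> 0 < b -> 0 < c -> c * a ^+ 2 < c * b ^+ 2 -> a < b.
  by move=> a0 b0 c0; rewrite ltr_pM2l// ltr_sqr// nnegrE ltW.
have smallG' v : kern r G' v != 0 -> `|v| < eta.
  move=> /kern_neq0 h; apply: (sq_lt _ _ l') => //.
  by rewrite (le_lt_trans (lE' v))// (lt_le_trans h)// ge_min lexx.
pose F y z := H y * kern r G' (z - phi y).
have [Bk Bk0 uk] := kern_ucs r pG'.
have uF : ucs2 B3 F.
  split.
    move=> e1 e10.
    have r1 : 0 < e1 / (2 * (r + 1)) by rewrite divr_gt0//; lra.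
    have M1 : 0 < e1 / (2 * (M + 1)) by rewrite divr_gt0//; lra.
    have [t1 t10 t1P] := uH.1 _ r1.
    have [t2 t20 t2P] := uk.1 _ M1.
    have [t3 t30 t3P] := uphi (t2 / 2) (divr_gt0 t20 (ltr0Sn _ 1)).
    exists (Num.min t1 (Num.min (t2 / 2) t3)).
      by rewrite !lt_min t10 t30 divr_gt0.
    (* Since [phi] is controlled on [K] only, one end is taken in [K]; if [y] is not in [K], then
       [H y = 0] and [H y'] is itself small. *)
    have half (y y' z z' : 'rV[R]_n) : K y' -> `|y - y'| < t1 -> `|y - y'| < t3 ->
        `|z - z'| < t2 / 2 -> `|F y z - F y' z'| < e1.
      move=> Ky' y1 y3 z2.
      have hy := t1P y y' Logic.I Logic.I y1.
      have kr := kern_le (z - phi y) pG' (ltW r0).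
      have kr0 := kern_ge0 r G' (z - phi y).
      have -> : F y z - F y' z' = (H y - H y') * kern r G' (z - phi y) +
         H y' * (kern r G' (z - phi y) - kern r G' (z' - phi y')) by rewrite /F; ring.
      have [Ky|nKy] := pselect (K y); last first.
        rewrite (KH y nKy) sub0r.
        have -> : - H y' * kern r G' (z - phi y) +
           H y' * (kern r G' (z - phi y) - kern r G' (z' - phi y')) =
           - (H y') * kern r G' (z' - phi y') by ring.
        rewrite (KH y nKy) sub0r in hy.
        rewrite normrM [ `|kern _ _ _|]ger0_norm ?kern_ge0//.
        have kr' := kern_le (z' - phi y') pG' (ltW r0).
        have kr'0 := kern_ge0 r G' (z' - phi y').
        move: hy; rewrite ltr_pdivlMr; last by lra.
        by apply: le_lt_trans; rewrite ler_wpM2l//; lra.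
      have z3 : `|z - phi y - (z' - phi y')| < t2.
        have -> : z - phi y - (z' - phi y') = (z - z') - (phi y - phi y').
          by rewrite !opprD !opprK addrACA.
        rewrite (le_lt_trans (ler_normB _ _))//.
        by have := t3P y y' Ky Ky' y3; lra.
      have hk := t2P _ _ Logic.I Logic.I z3.
      rewrite (le_lt_trans (ler_normD _ _))// !normrM [ `|kern r G' (z - phi y)|]ger0_norm//.
      move: hy hk; rewrite !ltr_pdivlMr; [|lra|lra].
      set a := `|H y - H y'|; set b := `|_ - _|; set c := kern _ _ _ => ha hb.
      have a0 : 0 <= a by exact: normr_ge0.
      have b0 : 0 <= b by exact: normr_ge0.
      have h1 : a * c <= a * r by rewrite ler_wpM2l.
      have h2 : `|H y'| * b <= M * b by rewrite ler_wpM2r// MP.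
      clear - ha hb h1 h2 a0 b0; lra.
    move=> y y' z z'; rewrite !lt_min => /and3P[y1 y2 y3] /and3P[z1 z2 z3].
    have [Ky'|nKy'] := pselect (K y'); first exact: half.
    have [Ky|nKy] := pselect (K y).
      by rewrite distrC; apply: half => //; rewrite distrC.
    by rewrite /F !KH// !mul0r subrr normr0.
  move=> y z h; rewrite /F; have [Ky|nKy] := pselect (K y); last by rewrite KH// mul0r.
  case: h => [yB|zB]; first by rewrite uH.2// ?mul0r// (le_lt_trans BB3).
  have [->|kn0] := eqVneq (kern r G' (z - phi y)) 0; first by rewrite mulr0.
  have := smallG' _ kn0; have := bphi y Ky; have := ler_norm Bphi.
  have := ler_normD (z - phi y) (phi y); rewrite subrK.
  by rewrite /B3 in zB; lra.
set C := Cn n r; have C0 : 0 < C by exact: Cn_gt0.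
have E1 : intn (fun y => intn (F y)) = C / w' * intn H.
  rewrite -(intnZ _ B0 uH); congr intn; apply/funext => y.
  rewrite /F (intnZ (H y) (addr_ge0 Bk0 (normr_ge0 (- phi y))) (ucs_shift (- phi y) uk)).
  rewrite (intn_shift (- phi y) Bk0 uk) mulrC; congr (_ * _).
  by rewrite /C -(intn_kern r pG') mulfK// gt_eqF.
rewrite (intn_swap B30 uF) in E1.
have pkG : posdef (k *: G) by exact: posdef_scale.
have kd : Num.sqrt (\det (k *: G)) = q * w.
  by rewrite detZ sqrtrM// exprn_ge0// ltW.
have [Bk' Bk'0 uk'] := kern_ucs r pkG.
set c1 := C / (q * w).
have c10 : 0 < c1 by rewrite divr_gt0// mulr_gt0.
(* The comparison of quadratic forms in [hyp] bounds [kern r G' (z - phi y)] by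
   [kern r (k *: G) (y - psi z)], a translate in [y] of a kernel of known integral. *)
have E2 z : intn (fun y => F y z) <= w / (w' * k) * c1 * H' z + e * c1.
  have -> : w / (w' * k) * c1 * H' z + e * c1 = (w / (w' * k) * H' z + e) * c1 by ring.
  have -> : c1 = intn (fun y => kern r (k *: G) (y + - psi z)).
    rewrite (intn_shift (- psi z) Bk'0 uk') /c1 -kd /C -(intn_kern r pkG) mulfK// gt_eqF//.
    by rewrite kd mulr_gt0.
  have us := ucs_shift (- psi z) uk'.
  have Bs0 := addr_ge0 Bk'0 (normr_ge0 (- psi z)).
  rewrite -(intnZ _ Bs0 us).
  set B4 := B3 + (Bk' + `|- psi z|).
  have B40 : 0 <= B4 by rewrite addr_ge0.
  apply: (intn_le B40).
  - by apply: ucsW (ucs2l z (ucs2C uF)) => //; rewrite /B4 lerDl.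
  - by apply: ucsZ; apply: ucsW us => //; rewrite /B4 lerDr.
  move=> y; rewrite /F.
  have rhs0 : 0 <= (w / (w' * k) * H' z + e) * kern r (k *: G) (y - psi z).
    by rewrite mulr_ge0 ?kern_ge0// addr_ge0 ?(ltW e0)// mulr_ge0// divr_ge0 ?mulr_ge0// ltW.
  have [Ky|nKy] := pselect (K y); last by rewrite KH// mul0r.
  have [->|kn0] := eqVneq (kern r G' (z - phi y)) 0; first by rewrite mulr0.
  have zy : `|phi y - z| < eta by rewrite distrC smallG'.
  have [hH hQ] := hyp y z Ky zy.
  have Qr := kern_neq0 kn0.
  have ydd : `|y - psi z| < dd.
    rewrite distrC; apply: (sq_lt _ _ (k * l)) => //; first exact: mulr_gt0.
    apply: (@lt_le_trans _ _ r); last by rewrite ge_min lexx orbT.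
    apply: le_lt_trans Qr; apply: le_trans hQ; rewrite -mulrA ler_pM2l//.
  have hy : H y <= w / (w' * k) * H' z + e.
    have := ddP y (psi z) Logic.I Logic.I ydd.
    rewrite ltr_norml => /andP[_ h].
    have : H (psi z) <= w / (w' * k) * H' z.
      rewrite mulrAC ler_pdivlMr ?mulr_gt0// mulrC [w' * k]mulrC//.
    by lra.
  apply: ler_pM => //; first exact: kern_ge0.
  rewrite /kern ge_max !le_max lexx/=; apply/orP; right.
  by rewrite lerD2l lerN2 quad_scale -quadN opprB.
have E3 : C / w' * intn H <= w / (w' * k) * c1 * intn H' + (2 * B3) ^+ n * (e * c1).
  rewrite -E1 -(intnZ _ B'0 uH').
  apply: (intn_le_add B30).
  - by apply/ltW; rewrite mulr_gt0.
  - exact: ucs2_intn B30 (ucs2C uF).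
  - by apply: ucsZ; exact: ucsW uH'.
  - exact: E2.
have : (w' * q * k / C) * (C / w' * intn H) <=
   (w' * q * k / C) * (w / (w' * k) * c1 * intn H' + (2 * B3) ^+ n * (e * c1)).
  by rewrite ler_pM2l// divr_gt0// !mulr_gt0.
have -> : (w' * q * k / C) * (C / w' * intn H) = q * k * intn H.
  by field; rewrite !gt_eqF.
have -> : (w' * q * k / C) * (w / (w' * k) * c1 * intn H' + (2 * B3) ^+ n * (e * c1))
  = intn H' + w' * k * (2 * B3) ^+ n / w * e.
  by rewrite /c1; field; rewrite !gt_eqF.
by [].
Qed.

End KernelBound.

Lemma compact_seq_cover (T : topologicalType) (I : choiceType) (K : set T)
    (D : set I) (f : I -> set T) : compact K ->
  (forall i, D i -> open (f i)) -> K `<=` cover D f ->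
  exists2 s : seq I, forall i, i \in s -> D i &
    forall y, K y -> exists2 i, i \in s & f i y.
Proof.
move=> /compact_near_coveringP cK fo Kf.
(* The filter of finite index lists directed by inclusion: a property holds eventually when it holds
   for all sufficiently large lists. *)
pose F : set_system (seq I) := fun P => exists2 s0 : seq I,
  forall i, i \in s0 -> D i & forall s : seq I, {subset s0 <= s} ->
    (forall i, i \in s -> D i) -> P s.
have FF : Filter F.
  split.
  - by exists [::].
  - move=> P Q [s sD sP] [t tD tQ]; exists (s ++ t).
      by move=> i; rewrite mem_cat => /orP[/sD|/tD].
    move=> r sr rD; split; [apply: sP|apply: tQ] => // i ir; apply: sr.
      by rewrite mem_cat ir.
    by rewrite mem_cat ir orbT.
  - by move=> P Q PQ [s sD sP]; exists s => // t st tD; apply: PQ; exact: sP.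
have h x : K x -> \forall x' \near x & s \near F, exists2 i, i \in s & f i x'.
  move=> Kx; have [i Di fi] := Kf x Kx.
  exists (f i, [set s : seq I | i \in s]).
    split; first exact: open_nbhs_nbhs (conj (fo i Di) fi).
    exists [:: i]; first by move=> j; rewrite inE => /eqP ->.
    by move=> s /(_ i); rewrite inE eqxx => /(_ isT).
  by move=> [y s] /= [fy si]; exists i.
have [s sD sP] := cK _ F _ FF h.
exists s => // y Ky; have := sP s (fun _ => id) sD; exact.
Qed.

Lemma continuous_distB (R : realType) (V : normedModType R) (c : R) (a z : V) :
  {for z, continuous (fun y => c - `|a - y|)}.
Proof.
rewrite /prop_for /continuous_at; apply: cvgB; first exact: cvg_cst.
by apply: cvg_norm; apply: cvgB; [exact: cvg_cst|exact: cvg_id].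
Qed.

Lemma continuous_near_eq (S T : topologicalType) (f g : S -> T) (z : S) :
  nbhs z [set y | f y = g y] -> {for z, continuous g} -> {for z, continuous f}.
Proof.
move=> h cg A; rewrite /= (nbhs_singleton h) => /cg nA.
by apply: filterS (filterI h nA) => y [/= e ga]; rewrite /= e.
Qed.

Section ChartChange.
Context {R : realType} {n : nat}.
Implicit Types (H : 'rV[R]_n -> R) (K : set 'rV[R]_n).

Lemma compact_sub_ucs K : compact K -> exists2 B : R, 0 <= B &
  forall F : 'rV[R]_n -> R, (forall x, K x -> {for x, continuous F}) ->
  (forall x, ~ K x -> F x = 0) -> ucs setT B F.
Proof.
move=> cK.
have [B B0 BP] : exists2 B : R, 0 <= B & forall x, K x -> `|x| <= B.
  have := @compact_bound R _ K (fun x : 'rV[R]_n => `|x|) cK _.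
  case; first by move=> x _; exact: norm_continuous.
  by move=> B B0 BP; exists B => // x Kx; have := BP x Kx; rewrite normr_id.
exists B => // F cF F0; split.
  apply: (compact_ucont cK) => //; last by move=> x _; exact: F0.
  move=> x Kx _ e e0.
  have /(@cvgrPdist_lt _ _ _ (nbhs x) (nbhs_filter x))/(_ e e0) := cF x Kx.
  move=> /nbhs_ballP[d d0 dP]; exists d => // y _ xy.
  by apply: dP; rewrite -ball_normE.
move=> x _ Bx; apply: F0 => Kx; have := BP x Kx; rewrite leNgt => /negP; exact.
Qed.

(* One-sided comparison of the integrals of h in two charts, phi being the
   transition map and w, w' the volume densities. *)
Lemma chart_le (U U' : set 'rV[R]_n) (phi psi : 'rV[R]_n -> 'rV[R]_n)
    (w w' : 'rV[R]_n -> R) K (h : 'rV[R]_n -> R) :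
  open U -> open U' -> (forall y, U y -> U' (phi y)) ->
  (forall z, U' z -> U (psi z)) ->
  (forall y, U y -> psi (phi y) = y) -> (forall z, U' z -> phi (psi z) = z) ->
  (forall y, U y -> {for y, continuous phi}) ->
  (forall z, U' z -> {for z, continuous psi}) ->
  (forall y, U y -> {for y, continuous w}) ->
  (forall z, U' z -> {for z, continuous w'}) ->
  (forall y0, U y0 -> exists G G' : 'M[R]_n,
    [/\ posdef G, posdef G', w y0 = Num.sqrt (\det G),
       w' (phi y0) = Num.sqrt (\det G') &
       forall d, 0 < d < 1 -> exists2 r : R, 0 < r & forall y z,
         `|y0 - y| < r -> `|y0 - z| < r -> U y -> U z ->
         (1 - d) * quad G (z - y) <= quad G' (phi z - phi y)]) ->
  compact K -> K `<=` U ->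
  (forall y, K y -> {for y, continuous h}) -> (forall y, ~ K y -> h y = 0) ->
  (forall y, 0 <= h y) -> (forall y, U y -> 0 <= w y) ->
  (forall z, U' z -> 0 <= w' z) ->
  intn (fun y => h y * w y) <=
  intn (fun z => \1_U' z * (h (psi z) * w' z)).
Proof.
move=> oU oU' UU' U'U psiK phiK cphi cpsi cw cw' metric cK KU ch h0 hpos wpos w'pos.
pose tr (k : 'rV[R]_n -> R) z := \1_U' z * (k (psi z) * w' z).
have trE k z : U' z -> tr k z = k (psi z) * w' z.
  by move=> Uz; rewrite /tr indicE mem_set// mul1r.
have trN k z : ~ U' z -> tr k z = 0.
  by move=> Uz; rewrite /tr indicE memNset// mul0r.
have phiKc : compact (phi @` K).
  apply: continuous_compact => //; apply: continuous_in_subspaceT => y /set_mem Ky.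
  by apply: cphi; exact: KU.
have phiKU' : phi @` K `<=` U' by move=> _ [y Ky <-]; apply: UU'; exact: KU.
have tr0 (k : 'rV[R]_n -> R) : (forall y, ~ K y -> k y = 0) ->
    forall z, ~ (phi @` K) z -> tr k z = 0.
  move=> k0 z nz; have [Uz|] := pselect (U' z); last exact: trN.
  by rewrite trE// k0 ?mul0r// => Kz; apply: nz; exists (psi z) => //; exact: phiK.
have trc (k : 'rV[R]_n -> R) : (forall y, K y -> {for y, continuous k}) ->
    forall z, (phi @` K) z -> {for z, continuous (tr k)}.
  move=> ck z Kz; have Uz := phiKU' _ Kz.
  have cc : {for z, continuous (fun z => k (psi z) * w' z)}.
    apply: continuousM; last exact: cw'.
    apply: continuous_comp; first exact: cpsi.
    by case: Kz => y Ky <-; rewrite psiK; [exact: ck|exact: KU].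
  apply: continuous_near_eq cc.
  apply: (filterS (P := U')) => [z' Uz'|]; first exact: trE.
  exact: open_nbhs_nbhs (conj oU' Uz).
have [B1 B10 B1P] := compact_sub_ucs phiKc.
have [B2 B20 B2P] := compact_sub_ucs cK.
have trucs (k : 'rV[R]_n -> R) : (forall y, K y -> {for y, continuous k}) ->
    (forall y, ~ K y -> k y = 0) -> ucs setT B1 (tr k).
  by move=> ck k0; apply: B1P; [exact: trc|exact: tr0].
have kwucs (k : 'rV[R]_n -> R) : (forall y, K y -> {for y, continuous k}) ->
    (forall y, ~ K y -> k y = 0) -> ucs setT B2 (fun y => k y * w y).
  move=> ck k0; apply: B2P.
    by move=> y Ky; apply: continuousM; [exact: ck|apply: cw; exact: KU].
  by move=> y Ky; rewrite k0// mul0r.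
rewrite -[leRHS]/(intn (tr h)).
(* Bernoulli's inequality lets [d] tend to 0. *)
suff step d : 0 < d < 1 -> (1 - d) ^+ n.+1 * intn (fun y => h y * w y) <= intn (tr h).
  have J0 : 0 <= intn (fun y => h y * w y).
    apply: intn_ge0 => y; have [Ky|nKy] := pselect (K y); last by rewrite h0// mul0r.
    by rewrite mulr_ge0// wpos//; exact: KU.
  apply: (@ler_of_small _ _ _ (n.+1%:R * intn (fun y => h y * w y))).
    by rewrite mulr_ge0.
  move=> e e0; set J := intn (fun y => _) in step J0 *.
  pose d : R := Num.min e (1 / 2).
  have d0 : 0 < d by rewrite lt_min e0/= divr_gt0.
  have d1 : d < 1 by rewrite (@le_lt_trans _ _ (1 / 2)) ?ge_min ?lexx ?orbT//; lra.
  have de : d <= e by rewrite ge_min lexx.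
  have bern : 1 - n.+1%:R * d <= (1 - d) ^+ n.+1.
    elim: n.+1 => [|k ihk]; first by rewrite mul0r subr0 expr0.
    rewrite exprS -natr1.
    have : (1 - d) * (1 - k%:R * d) <= (1 - d) * (1 - d) ^+ k by rewrite ler_wpM2l//; lra.
    have : 0 <= k%:R * d * d by rewrite !mulr_ge0// ltW.
    by lra.
  have := step d; rewrite d0 d1 => /(_ isT).
  have : (1 - n.+1%:R * d) * J <= (1 - d) ^+ n.+1 * J by rewrite ler_wpM2r.
  have : n.+1%:R * J * d <= n.+1%:R * J * e by rewrite ler_wpM2l// mulr_ge0.
  by lra.
move=> d01; have [dgt0 dlt1] := andP d01.
have loc y0 : K y0 -> exists2 r : R, 0 < r & forall k : 'rV[R]_n -> R,
    (forall y, K y -> {for y, continuous k}) -> (forall y, ~ K y -> k y = 0) ->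
    (forall y, 0 <= k y) -> (forall y, r <= `|y0 - y| -> k y = 0) ->
    (1 - d) ^+ n.+1 * intn (fun y => k y * w y) <= intn (tr k).
  move=> Ky0; have Uy0 := KU _ Ky0.
  have [G [G' [pG pG' wG wG' mG]]] := metric y0 Uy0.
  have [r r0 rP] := mG d d01.
  have wp : 0 < w y0 by rewrite wG sqrtr_gt0 posdef_det.
  have w'p : 0 < w' (phi y0) by rewrite wG' sqrtr_gt0 posdef_det.
  pose a := (1 - d) ; have a0 : 0 < a by rewrite /a; lra.
  (* A relative error [d / 4] on each density costs one factor [1 - d], because
     [(1 - d) * (1 + d / 4) <= 1 - d / 4]. Both densities can then be frozen at [y0]. *)
  pose b := d / 4.
  have b0 : 0 < b by rewrite /b; lra.
  have bb : a * (1 + b) <= 1 - b by rewrite /a /b; nra.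
  have /(@cvgrPdist_lt _ _ _ (nbhs y0) (nbhs_filter y0))/(_ (b * w y0) (mulr_gt0 b0 wp)) := cw y0 Uy0.
  move=> /nbhs_ballP[r1 r10 r1P].
  have cw'p : {for y0, continuous (w' \o phi)}.
    by apply: continuous_comp; [exact: cphi|apply: cw'; exact: UU'].
  have /(@cvgrPdist_lt _ _ _ (nbhs y0) (nbhs_filter y0))/(_ (b * w' (phi y0)) (mulr_gt0 b0 w'p)) := cw'p.
  move=> /nbhs_ballP[r2 r20 r2P].
  have /nbhs_ballP[r3 r30 r3P] : nbhs y0 U by exact: open_nbhs_nbhs (conj oU Uy0).
  pose s := Num.min (Num.min r r1) (Num.min r2 r3).
  have s0 : 0 < s by rewrite !lt_min r0 r10 r20 r30.
  exists (s / 2); first by lra.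
  move=> k ck k0 kpos kr.
  pose K1 := K `&` [set y | `|y0 - y| <= s / 2].
  have cK1 : compact K1.
    apply: compact_closedI => //.
    rewrite (_ : mkset _ = (fun x : 'rV[R]_n => `|y0 - x|) @^-1` [set t | t <= s / 2])//.
    apply: preimage_closed; last exact: closed_le.
    move=> x _; apply: continuous_comp; last exact: norm_continuous.
    by apply: (@continuousB _ _ _ (cst y0) id); [exact: cst_continuous|].
  have K1K : K1 `<=` K by move=> y [].
  (* [O] consists of the [z] with [psi z] within [s] of [y0]; the radius [eta] chosen below keeps
     every [z] that is [eta]-close to the image of [K1] inside [O]. *)
  pose N := [set y : 'rV[R]_n | `|y0 - y| < s].
  pose O := U' `&` psi @^-1` N.
  have oN : open N.
    rewrite (_ : N = (fun x : 'rV[R]_n => `|y0 - x|) @^-1` [set t | t < s])//.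
    apply: open_comp; last exact: open_lt.
    move=> x _; apply: continuous_comp; last exact: norm_continuous.
    by apply: (@continuousB _ _ _ (cst y0) id); [exact: cst_continuous|].
  have oO : open O.
    rewrite openE => z [Uz Nz]; apply: filterI.
      exact: open_nbhs_nbhs (conj oU' Uz).
    by apply: (cpsi z Uz); exact: open_nbhs_nbhs (conj oN Nz).
  have cphiK1 : compact (phi @` K1).
    apply: continuous_compact => //; apply: continuous_in_subspaceT => y /set_mem [Ky _].
    by apply: cphi; exact: KU.
  have phiK1O : phi @` K1 `<=` O.
    move=> _ [y [Ky /= yr] <-]; split; first by apply: UU'; exact: KU.
    by rewrite /N /= psiK; [lra|exact: KU].
  have [eta eta0 etaP] := compact_open_dist cphiK1 oO phiK1O.
  have uphi : ucont K1 phi.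
    apply: (compact_ucont cK1) => //.
    move=> y [Ky _] _ e e0.
    have /(@cvgrPdist_lt _ _ _ (nbhs y) (nbhs_filter y))/(_ e e0) := cphi y (KU _ Ky).
    move=> /nbhs_ballP[t t0 tP]; exists t => // y' _ yy'.
    by apply: tP; rewrite -ball_normE.
  have [Bp Bp0 BpP] := @compact_bound R _ (phi @` K1) (fun x : 'rV[R]_n => `|x|)
    cphiK1 (fun x _ => @norm_continuous _ _ x).
  have trk0 z : 0 <= tr k z.
    have [Uz|/(trN k) ->//] := pselect (U' z).
    by rewrite trE// mulr_ge0// w'pos.
  have kw0 y : 0 <= k y * w y.
    have [Ky|nKy] := pselect (K y); last by rewrite k0// mul0r.
    by rewrite mulr_ge0// wpos//; exact: KU.
  apply: (@kernel_bound _ _ phi psi K1 _ _ B2 B1 Bp G G' d eta) => //.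
  - exact: kwucs.
  - exact: trucs.
  - move=> y nK1; have [Ky|nKy] := pselect (K y); last by rewrite k0// mul0r.
    rewrite kr ?mul0r// leNgt; apply/negP => h'; apply: nK1; split => //=.
    exact: ltW.
  - move=> y K1y; have := BpP (phi y); rewrite normr_id; apply.
    by exists y.
  move=> y z K1y yz; have [Uz Nz] : O z by apply: (etaP (phi y)) => //; exists y.
  rewrite /N/= in Nz.
  have zr : `|y0 - psi z| < r by rewrite (lt_le_trans Nz)// !ge_min lexx.
  have zr1 : `|y0 - psi z| < r1 by rewrite (lt_le_trans Nz)// !ge_min lexx !orbT.
  have zr2 : `|y0 - psi z| < r2 by rewrite (lt_le_trans Nz)// !ge_min lexx !orbT.
  have [Ky yr] := K1y.
  split; last first.
    rewrite -{2}(phiK z Uz); apply: rP => //; [|exact: KU|exact: U'U].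
    rewrite (le_lt_trans yr)// (@lt_le_trans _ _ s)//; first by lra.
    by rewrite !ge_min lexx.
  have : ball y0 r1 (psi z) by rewrite -ball_normE.
  move=> /r1P /=; rewrite ltr_norml => /andP[h1 _].
  have : ball y0 r2 (psi z) by rewrite -ball_normE.
  move=> /r2P /=; rewrite phiK// ltr_norml => /andP[_ h2].
  rewrite trE// -wG -wG'.
  have k0' := kpos (psi z).
  have e1 : (1 - d) * w' (phi y0) * w (psi z) <= w y0 * w' z.
    have : (1 - d) * w (psi z) <= (1 - b) * w y0.
      apply: (@le_trans _ _ (a * ((1 + b) * w y0))).
        by rewrite /a ler_pM2l//; lra.
      by rewrite mulrA ler_wpM2r// ltW.
    have : (1 - b) * w' (phi y0) <= w' z by lra.
    have := wp; have := w'p; nra.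
  have := ler_wpM2r k0' e1; lra.
have /choice[rr rrP] : forall y0, exists r : R, K y0 -> 0 < r /\ forall k : 'rV[R]_n -> R,
    (forall y, K y -> {for y, continuous k}) -> (forall y, ~ K y -> k y = 0) ->
    (forall y, 0 <= k y) -> (forall y, r <= `|y0 - y| -> k y = 0) ->
    (1 - d) ^+ n.+1 * intn (fun y => k y * w y) <= intn (tr k).
  move=> y0; have [Ky0|nKy0] := pselect (K y0); last by exists 0.
  by have [r r0 rP] := loc y0 Ky0; exists r.
pose f (i : 'rV[R]_n) := [set y : 'rV[R]_n | `|i - y| < rr i].
have fo i : K i -> open (f i).
  move=> _; rewrite (_ : f i = (fun x : 'rV[R]_n => `|i - x|) @^-1` [set t | t < rr i])//.
  apply: open_comp; last exact: open_lt.
  move=> x _; apply: continuous_comp; last exact: norm_continuous.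
  by apply: (@continuousB _ _ _ (cst i) id); [exact: cst_continuous|].
have Kcov : K `<=` cover K f.
  move=> y Ky; exists y => //; rewrite /f/= subrr normr0.
  by have [] := rrP y Ky.
have [D DK KD] := compact_seq_cover cK fo Kcov.
(* Tents on the finite subcover, divided by their sum, split [h] into pieces small enough for the
   local estimate. *)
pose b i y := Num.max 0 (rr i - `|i - y|).
pose S y := \sum_(i <- D) b i y.
pose ki i y := h y * (b i y / S y).
have b0 i y : 0 <= b i y by rewrite /b le_max lexx.
have S0 y : 0 <= S y by apply: sumr_ge0.
have SK y : K y -> 0 < S y.
  move=> Ky; have [i Di fi] := KD y Ky.
  rewrite /S (big_rem i)//=; apply: ltr_pwDl; last by apply: sumr_ge0.
  by rewrite /b lt_max subr_gt0 fi orbT.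
have cb i y : {for y, continuous (b i)}.
  rewrite (_ : b i = (cst 0 : 'rV[R]_n -> R) \max (fun y => rr i - `|i - y|))//.
  apply: continuous_max.
    exact: (@cst_continuous _ _ (0 : R) y).
  exact: continuous_distB.
have cS y : {for y, continuous S}.
  by apply: (@cvg_sumr R _ (nbhs y)) => i _; exact: cb.
have cki i y : K y -> {for y, continuous (ki i)}.
  move=> Ky; apply: continuousM; first exact: ch.
  apply: continuousM; first exact: cb.
  by apply: continuousV; [rewrite gt_eqF// SK|exact: cS].
have ki0 i y : ~ K y -> ki i y = 0 by move=> nK; rewrite /ki h0// mul0r.
have kipos i y : 0 <= ki i y by rewrite /ki mulr_ge0// divr_ge0.
have sumki y : h y = \sum_(i <- D) ki i y.
  have [Ky|nKy] := pselect (K y); last by rewrite h0// big1// => i _; exact: ki0.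
  rewrite /ki -mulr_sumr -mulr_suml -/(S y) divff ?mulr1// gt_eqF//.
  exact: SK.
have -> : (fun y => h y * w y) = fun y => \sum_(i <- D) ki i y * w y.
  by apply/funext => y; rewrite sumki mulr_suml.
have -> : tr h = fun z => \sum_(i <- D) tr (ki i) z.
  apply/funext => z; rewrite /tr sumki mulr_suml mulr_sumr.
  by [].
rewrite (intn_sum _ B20); last by move=> i; apply: kwucs; [exact: cki|exact: ki0].
rewrite (intn_sum _ B10); last by move=> i; apply: trucs; [exact: cki|exact: ki0].
rewrite mulr_sumr big_seq [leRHS]big_seq; apply: ler_sum => i iD.
have Ki := DK i iD.
apply: (rrP i Ki).2; [exact: cki|exact: ki0|exact: kipos|].
by move=> y yr; rewrite /ki /b max_l ?mul0r ?mulr0// subr_le0.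
Qed.

End ChartChange.

(** * Differential calculus *)

Section Paths.
Context {R : realType}.

Definition ed n (i : 'I_n) : 'rV[R]_n := delta_mx 0 i.

Lemma edE n (i j : 'I_n) : ed i 0 j = (j == i)%:R :> R.
Proof. by rewrite /ed mxE eqxx. Qed.

Lemma norm_ed n (i : 'I_n) (t : R) : `|t *: ed i| = `|t|.
Proof.
rewrite normrZ (_ : `|ed i| = 1) ?mulr1//; apply/eqP; rewrite eq_le; apply/andP; split.
  by apply/normrv_le => // j; rewrite edE; case: eqP; rewrite ?normr1 ?normr0.
by have := coord_le_norm (ed i) i; rewrite edE eqxx normr1.
Qed.

Lemma line_is_derive n (F : 'rV[R]_n -> R) (a v : 'rV[R]_n) (t : R) :
  derivable F (a + t *: v) v ->
  is_derive t (1 : R) (fun s : R => F (a + s *: v)) ('D_v F (a + t *: v)).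
Proof.
have E : (fun h : R => h^-1 *: (((fun s : R => F (a + s *: v)) \o shift t) (h *: (1 : R))
      - F (a + t *: v))) =
   (fun h : R => h^-1 *: ((F \o shift (a + t *: v)) (h *: v) - F (a + t *: v))).
  apply/funext => h /=; congr (_ *: (F _ - _)).
  have -> : h *: (1 : R) = h by exact: mulr1.
  by rewrite scalerDl addrCA.
by move=> dF; apply: DeriveDef; [rewrite /derivable E|rewrite /derive E].
Qed.

(** The condition [0 <= t * h] keeps [t] on the side of [h]: one statement serves both signs, and
    derivability is required on the segment only. *)
Lemma mvt_line n (F : 'rV[R]_n -> R) (a v : 'rV[R]_n) (h : R) :
  (forall t : R, `|t| <= `|h| -> 0 <= t * h -> derivable F (a + t *: v) v) ->
  exists t : R, [/\ `|t| <= `|h|, 0 <= t * h &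
    F (a + h *: v) - F a = h * 'D_v F (a + t *: v)].
Proof.
move=> dF; pose g (s : R) := F (a + s *: v).
have dg (t : R) : `|t| <= `|h| -> 0 <= t * h ->
    is_derive t (1 : R) g ('D_v F (a + t *: v)).
  by move=> t1 t2; apply: line_is_derive; exact: dF.
have cg (t : R) : `|t| <= `|h| -> 0 <= t * h -> {for t, continuous g}.
  move=> t1 t2; apply: differentiable_continuous; apply/derivable1_diffP.
  exact: (@ex_derive _ _ _ _ _ _ _ (dg t t1 t2)).
have g0 : g 0 = F a by rewrite /g scale0r addr0.
have [h0|h0] := leP 0 h.
  have inb (t : R) : 0 <= t <= h -> `|t| <= `|h| /\ 0 <= t * h.
    by move=> /andP[t0 th]; rewrite !ger0_norm// mulr_ge0.
  have D (t : R) : t \in `]0, h[%R -> is_derive t (1 : R) g ('D_v F (a + t *: v)).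
    by rewrite in_itv/= => /andP[/ltW t0 /ltW th]; apply: dg; apply inb; rewrite t0.
  have C : {within `[0, h], continuous g}.
    apply: continuous_in_subspaceT => t; rewrite inE/= in_itv/= => tt.
    by apply: cg; apply inb.
  have [t] := MVT_segment h0 D C; rewrite in_itv/= => tt; rewrite g0 subr0 => E; exists t.
  have [t1 t2] := inb t tt; split => //.
  by rewrite -/(g h) E mulrC.
have inb (t : R) : h <= t <= 0 -> `|t| <= `|h| /\ 0 <= t * h.
  move=> /andP[ht t0]; rewrite !ler0_norm// ?(ltW h0)//; split; first by lra.
  by rewrite -mulrNN mulr_ge0//; lra.
have D (t : R) : t \in `]h, 0[%R -> is_derive t (1 : R) g ('D_v F (a + t *: v)).
  by rewrite in_itv/= => /andP[/ltW t0 /ltW th]; apply: dg; apply inb; rewrite t0.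
have C : {within `[h, 0], continuous g}.
  apply: continuous_in_subspaceT => t; rewrite inE/= in_itv/= => tt.
  by apply: cg; apply inb.
have [t] := MVT_segment (ltW h0) D C; rewrite in_itv/= => tt; rewrite g0 sub0r => E; exists t.
have [t1 t2] := inb t tt; split => //.
by rewrite -/(g h) -opprB E; ring.
Qed.

(** The box with opposite corners [x] and [y], not the segment: [t] depends on the coordinate. Paths
    parallel to the axes stay in it. *)
Definition between n (x y z : 'rV[R]_n) : Prop :=
  forall i, exists2 t : R, 0 <= t <= 1 & z 0 i = x 0 i + t * (y 0 i - x 0 i).

Lemma between_ball n (x0 x y z : 'rV[R]_n) (r : R) : between x y z ->
  `|x0 - x| < r -> `|x0 - y| < r -> `|x0 - z| < r.
Proof.
move=> b xr yr; have r0 : 0 < r by apply: le_lt_trans xr.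
move: xr yr => /normrv_lt xr /normrv_lt yr; apply/normrv_lt => // i.
have [t /andP[t0 t1] E] := b i.
have := xr r0 i; have := yr r0 i; rewrite !rvD !rvN E !ltr_norml.
set u := x0 0 i - y 0 i; set w := x0 0 i - x 0 i.
have -> : x0 0 i - (x 0 i + t * (y 0 i - x 0 i)) = (1 - t) * w + t * u.
  by rewrite /u /w; ring.
move=> /andP[h1 h2] /andP[h3 h4]; have [tt|tt] := leP t (1 / 2).
  have : 0 <= (1 / 2 - t) * (w + r) by apply: mulr_ge0; lra.
  have : 0 <= (1 / 2 - t) * (r - w) by apply: mulr_ge0; lra.
  have : 0 <= t * (u + r) by apply: mulr_ge0; lra.
  have : 0 <= t * (r - u) by apply: mulr_ge0; lra.
  by move=> a1 a2 a3 a4; apply/andP; split; lra.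
have : 0 <= (t - 1 / 2) * (u + r) by apply: mulr_ge0; lra.
have : 0 <= (t - 1 / 2) * (r - u) by apply: mulr_ge0; lra.
have : 0 <= (1 - t) * (w + r) by apply: mulr_ge0; lra.
have : 0 <= (1 - t) * (r - w) by apply: mulr_ge0; lra.
by move=> a1 a2 a3 a4; apply/andP; split; lra.
Qed.

Lemma mvt_path n (F : 'rV[R]_n -> R) (x y : 'rV[R]_n) :
  (forall z, between x y z -> forall i, derivable F z (ed i)) ->
  exists2 xi : 'I_n -> 'rV[R]_n, forall j, between x y (xi j) &
    F y - F x = \sum_j (y 0 j - x 0 j) * 'D_(ed j) F (xi j).
Proof.
move=> dF.
(* The coordinates of [x] are replaced by those of [y] one at a time, so that each step only
   involves one partial derivative. *)
pose z (k : nat) : 'rV[R]_n := \row_i (if (i < k)%N then y 0 i else x 0 i).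
have z0 : z 0%N = x by apply/rowP => i; rewrite mxE ltn0.
have zn : z n = y by apply/rowP => i; rewrite mxE ltn_ord.
have zb (k : 'I_n) (t : R) : `|t| <= `|y 0 k - x 0 k| -> 0 <= t * (y 0 k - x 0 k) ->
    between x y (z k + t *: ed k).
  move=> t1 t2 i; rewrite rvD rvZ edE mxE.
  have [->|ik] := eqVneq i k.
    rewrite ltnn mulr1; have [e|ne] := eqVneq (y 0 k - x 0 k) 0.
      exists 0; first by rewrite lexx ler01.
      by move: t1; rewrite e normr0 mulr0 normr_le0 => /eqP ->.
    exists (t / (y 0 k - x 0 k)); last by rewrite divfK.
    apply/andP; split.
      rewrite -(pmulr_lge0 _ (x := (y 0 k - x 0 k) ^+ 2)) ?exprn_even_gt0//.
      by rewrite expr2 mulrA divfK.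
    rewrite (le_trans (ler_norm _))// normrM normfV ler_pdivrMr ?mul1r//.
    by rewrite normr_gt0.
  rewrite mulr0 addr0; case: ifP => _.
    by exists 1; [rewrite ler01 lexx|ring].
  by exists 0; [rewrite ler01 lexx|ring].
have step (k : 'I_n) : exists w : 'rV[R]_n, between x y w /\
    F (z k.+1) - F (z k) = (y 0 k - x 0 k) * 'D_(ed k) F w.
  have [t [t1 t2 E]] := @mvt_line n F (z k) (ed k) (y 0 k - x 0 k)
    (fun t t1 t2 => dF _ (zb k t t1 t2) k).
  exists (z k + t *: ed k); split; first exact: zb.
  rewrite -E; congr (F _ - _); apply/rowP => i; rewrite rvD rvZ edE !mxE ltnS.
  have [->|ik] := eqVneq i k; first by rewrite leqnn ltnn mulr1 addrC subrK.
  by rewrite leq_eqVlt (inj_eq val_inj) (negbTE ik) mulr0 addr0.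
have /choice[xi xiP] := step.
exists xi; first by move=> j; have [] := xiP j.
rewrite -{1}zn -{1}z0 -(telescope_sumr (fun k => F (z k)))// big_mkord.
by apply: eq_bigr => k _; have [] := xiP k.
Qed.

End Paths.

(** * Functions of class C^k on open sets *)

Section Ck.
Context {R : realType} {n : nat}.
Implicit Types (U V : set 'rV[R]_n) (F G : 'rV[R]_n -> R).

(** A form of smoothness suited to induction on the order (see [smooth_openP]). Continuity is
    included at every order, because the existence of partial derivatives does not imply it. *)
Fixpoint Ck k U F : Prop :=
  (forall x, U x -> {for x, continuous F}) /\
  match k with
  | 0 => True
  | k'.+1 => forall i, (forall x, U x -> derivable F x (ed i)) /\
      Ck k' U (fun x => 'D_(ed i) F x)
  end.

Lemma Ck_cont k U F x : Ck k U F -> U x -> {for x, continuous F}.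
Proof. by case: k => [|k] [cF _]; exact: cF. Qed.

Lemma CkS k U F : Ck k.+1 U F -> Ck k U F.
Proof.
elim: k F => [|k ih] F [cF dF]; first by split.
by split => // i; have [d1 d2] := dF i; split => //; exact: ih.
Qed.

Lemma CkW j k U F : (j <= k)%N -> Ck k U F -> Ck j U F.
Proof.
move=> /subnK <-; elim: (k - j)%N => [//|i ih] h.
by apply: ih; apply: CkS; rewrite addSn in h.
Qed.

Lemma Ck_sub k U V F : U `<=` V -> Ck k V F -> Ck k U F.
Proof.
move=> UV; elim: k F => [|k ih] F [cF dF]; split => //; try by move=> x /UV; exact: cF.
move=> i; have [d1 d2] := dF i; split; last exact: ih.
by move=> x /UV; exact: d1.
Qed.

Lemma open_nbhs1 U x : open U -> U x -> nbhs x U.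
Proof. by move=> oU Ux; exact: open_nbhs_nbhs (conj oU Ux). Qed.

Lemma near_eqS U F G x : open U -> U x -> (forall y, U y -> F y = G y) ->
  nbhs x [set y | F y = G y].
Proof. by move=> oU Ux FG; apply: filterS (open_nbhs1 oU Ux). Qed.

Lemma derive_ext U F G x v : open U -> U x -> (forall y, U y -> F y = G y) ->
  'D_v F x = 'D_v G x.
Proof. by move=> oU Ux FG; apply: near_eq_derive; exact: near_eqS FG. Qed.

Lemma derivable_ext U F G x v : open U -> U x -> (forall y, U y -> F y = G y) ->
  derivable F x v -> derivable G x v.
Proof. by move=> oU Ux FG; apply: near_eq_derivable; exact: near_eqS FG. Qed.

Lemma Ck_ext k U F G : open U -> (forall y, U y -> F y = G y) -> Ck k U F -> Ck k U G.
Proof.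
move=> oU; elim: k F G => [|k ih] F G FG [cF dF].
  split=> // x Ux; apply: continuous_near_eq (cF x Ux).
  by apply: near_eqS Ux _ => // y /FG.
split.
  move=> x Ux; apply: continuous_near_eq (cF x Ux).
  by apply: near_eqS Ux _ => // y /FG.
move=> i; have [d1 d2] := dF i; split.
  by move=> x Ux; apply: (derivable_ext oU Ux FG); exact: d1.
by apply: ih d2 => y Uy; exact: (derive_ext _ oU Uy FG).
Qed.

Lemma smooth_openP U F : smooth_open U F <-> forall k, Ck k U F.
Proof.
split.
  move=> sF k; rewrite -[F]/(iter_partial [::] F).
  elim: k [::] => [|k ih] s; first by split=> // x Ux; have [] := sF s x Ux.
  split; first by move=> x Ux; have [] := sF s x Ux.
  move=> i; split; first by move=> x Ux; have [_] := sF s x Ux; exact.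
  exact: (ih (i :: s)).
move=> CF s; have {}CF : forall k, Ck k U (iter_partial s F).
  elim: s => [//|i s ih] k /=; have [_ /(_ i)[_ ?]] := ih k.+1; by [].
move=> x Ux; split; first exact: Ck_cont (CF 0%N) Ux.
by move=> i; have [_ /(_ i)[h _]] := CF 1%N; exact: h.
Qed.

Lemma Ck_cst k U (c : R) : Ck k U (fun=> c).
Proof.
elim: k c => [|k ih] c; first by split=> // x _; exact: cst_continuous.
split; first by move=> x _; exact: cst_continuous.
move=> i; split; first by move=> x _; exact: derivable_cst.
have -> : (fun x => 'D_(ed i) (fun=> c) x) = (fun=> 0 : R) :> ('rV[R]_n -> R).
  by apply/funext => x; exact: derive_cst.
exact: ih.
Qed.

Lemma CkD k U F G : open U -> Ck k U F -> Ck k U G -> Ck k U (fun x => F x + G x).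
Proof.
move=> oU; elim: k F G => [|k ih] F G [cF dF] [cG dG].
  by split=> // x Ux; apply: continuousD; [exact: cF|exact: cG].
split; first by move=> x Ux; apply: continuousD; [exact: cF|exact: cG].
move=> i; have [d1 d2] := dF i; have [e1 e2] := dG i; split.
  by move=> x Ux; apply: (@derivableD _ _ _ F G); [exact: d1|exact: e1].
apply: Ck_ext (ih _ _ d2 e2) => // y Uy.
by rewrite -(@deriveD _ _ _ F G)//; [exact: d1|exact: e1].
Qed.

Lemma CkM k U F G : open U -> Ck k U F -> Ck k U G -> Ck k U (fun x => F x * G x).
Proof.
move=> oU; elim: k F G => [|k ih] F G CF CG.
  have [cF _] := CF; have [cG _] := CG.
  by split=> // x Ux; apply: continuousM; [exact: cF|exact: cG].
have [cF dF] := CF; have [cG dG] := CG.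
split; first by move=> x Ux; apply: continuousM; [exact: cF|exact: cG].
move=> i; have [d1 d2] := dF i; have [e1 e2] := dG i; split.
  by move=> x Ux; apply: (@derivableM _ _ F G); [exact: d1|exact: e1].
apply: Ck_ext (CkD oU (ih _ _ (CkS CF) e2) (ih _ _ (CkS CG) d2)) => // y Uy.
by rewrite (@deriveM _ _ F G)//; [exact: d1|exact: e1].
Qed.

Lemma CkV k U F : open U -> (forall x, U x -> F x != 0) -> Ck k U F ->
  Ck k U (fun x => (F x)^-1).
Proof.
move=> oU F0; elim: k => [|k ih] CF.
  by have [cF _] := CF; split=> // x Ux; apply: continuousV; [exact: F0|exact: cF].
have [cF dF] := CF.
split; first by move=> x Ux; apply: continuousV; [exact: F0|exact: cF].
move=> i; have [d1 d2] := dF i; split.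
  by move=> x Ux; apply: derivableV; [exact: F0|exact: d1].
have iV := ih (CkS CF).
apply: Ck_ext (CkM oU (Ck_cst k U (-1)) (CkM oU d2 (CkM oU iV iV))) => // y Uy.
rewrite deriveV; [|exact: F0|exact: d1].
rewrite -[RHS]/(- (F y ^+ 2)^-1 * 'D_(ed i) F y) expr2 invfM; ring.
Qed.

(** The whole sequence of derivatives of [psi 0] is given at once, so that the induction can move
    from [psi j] to [psi j.+1]. *)
Lemma Ck_comp1 k U F (psi : nat -> R -> R) : open U ->
  (forall j t, is_derive t (1 : R) (psi j) (psi j.+1 t)) -> Ck k U F ->
  Ck k U (fun x => psi 0%N (F x)).
Proof.
move=> oU dpsi; suff: forall j, Ck k U F -> Ck k U (fun x => psi j (F x)) by apply.
elim: k F => [|k ih] F j CF.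
  have [cF _] := CF; split=> // x Ux; apply: continuous_comp; first exact: cF.
  apply: differentiable_continuous; apply/derivable1_diffP.
  exact: (@ex_derive _ _ _ _ _ _ _ (dpsi j (F x))).
have [cF dF] := CF; split.
  move=> x Ux; apply: continuous_comp; first exact: cF.
  apply: differentiable_continuous; apply/derivable1_diffP.
  exact: (@ex_derive _ _ _ _ _ _ _ (dpsi j (F x))).
move=> i; have [d1 d2] := dF i.
have key x : U x -> is_derive x (ed i) (fun x => psi j (F x))
    (psi j.+1 (F x) * 'D_(ed i) F x).
  move=> Ux; have h0 : is_derive (0 : R) (1 : R) (fun s : R => F (x + s *: ed i))
      ('D_(ed i) F x).
    have := @line_is_derive R n F x (ed i) 0; rewrite scale0r addr0; apply.
    exact: d1.
  have h1 := dpsi j (F (x + 0 *: ed i)).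
  have h2 := @is_derive1_comp R (psi j) (fun s : R => F (x + s *: ed i)) 0 _ _ h1 h0.
  have E : (fun h : R => h^-1 *: (((fun x => psi j (F x)) \o shift x) (h *: ed i)
      - psi j (F x))) =
    (fun h : R => h^-1 *: (((psi j \o (fun s : R => F (x + s *: ed i))) \o shift 0)
      (h *: (1 : R)) - (psi j \o (fun s : R => F (x + s *: ed i))) 0)).
    apply/funext => h /=; have -> : h *: (1 : R) = h by exact: mulr1.
    by rewrite addr0 scale0r addr0 [x + _]addrC.
  rewrite scale0r addr0 in h2.
  have [h3 h4] := h2.
  by apply: DeriveDef; [rewrite /derivable E|rewrite /derive E].
split; first by move=> x Ux; exact: (@ex_derive _ _ _ _ _ _ _ (key x Ux)).
apply: Ck_ext (CkM oU (ih F j.+1 (CkS CF)) d2) => // y Uy.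
by have := key y Uy => -[_ ->].
Qed.

End Ck.

(** * Chain rule, strict differentiability and symmetry of second derivatives *)

Section Chain.
Context {R : realType}.

Lemma Ck_deriv n k (U : set 'rV[R]_n) F i : Ck k.+1 U F ->
  Ck k U (fun y => 'D_(ed i) F y).
Proof. by move=> [_ /(_ i)[]]. Qed.

Lemma Ck_derivable n k (U : set 'rV[R]_n) F i x : Ck k.+1 U F -> U x ->
  derivable F x (ed i).
Proof. by move=> [_ /(_ i)[h _]]; exact: h. Qed.

Lemma cont_near (S : topologicalType) (f : S -> R) x (e : R) :
  {for x, continuous f} -> 0 < e -> nbhs x (fun y => `|f x - f y| < e).
Proof. by move=> cf e0; have /cvgrPdist_lt/(_ e e0) := cf. Qed.

Lemma near_forall (S : topologicalType) (I : finType) (x : S) (P : I -> S -> Prop) :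
  (forall i, nbhs x (P i)) -> nbhs x (fun y => forall i, P i y).
Proof. exact: filter_forall. Qed.

Lemma derive_cvg n (F : 'rV[R]_n -> R) x v : derivable F x v ->
  t^-1 * (F (x + t *: v) - F x) @[t --> (0 : R)^'] --> 'D_v F x.
Proof.
move=> dF; have E : (fun t : R => t^-1 * (F (x + t *: v) - F x)) =
  (fun h : R => h^-1 *: ((F \o shift x) (h *: v) - F x)).
  by apply/funext => t /=; rewrite addrC [x + _]addrC addrC.
by rewrite E; exact: dF.
Qed.

Lemma cvg_derive n (F : 'rV[R]_n -> R) x v l :
  t^-1 * (F (x + t *: v) - F x) @[t --> (0 : R)^'] --> l -> is_derive x v F l.
Proof.
have E : (fun t : R => t^-1 * (F (x + t *: v) - F x)) =
  (fun h : R => h^-1 *: ((F \o shift x) (h *: v) - F x)).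
  by apply/funext => t /=; rewrite addrC [x + _]addrC addrC.
rewrite E => h; apply: DeriveDef; first by apply/cvg_ex; exists l.
exact: cvg_lim.
Qed.

Lemma derive_comp1 n (psi : R -> R) d (F : 'rV[R]_n -> R) x v :
  is_derive (F x) (1 : R) psi d -> derivable F x v ->
  is_derive x v (fun y => psi (F y)) (d * 'D_v F x).
Proof.
move=> dpsi dF.
have h0 : is_derive (0 : R) (1 : R) (fun s : R => F (x + s *: v)) ('D_v F x).
  have e : x + 0 *: v = x by rewrite scale0r addr0.
  have dF0 : derivable F (x + 0 *: v) v by rewrite e.
  by have h := line_is_derive dF0; rewrite [in X in 'D_v F X]e in h.
have h1 : is_derive (F (x + 0 *: v)) (1 : R) psi d by rewrite scale0r addr0.
have [h3 h4] := @is_derive1_comp R psi (fun s : R => F (x + s *: v)) 0 _ _ h1 h0.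
have E : (fun h : R => h^-1 *: (((fun x => psi (F x)) \o shift x) (h *: v)
    - psi (F x))) =
  (fun h : R => h^-1 *: (((psi \o (fun s : R => F (x + s *: v))) \o shift 0)
    (h *: (1 : R)) - (psi \o (fun s : R => F (x + s *: v))) 0)).
  apply/funext => h /=; have -> : h *: (1 : R) = h by exact: mulr1.
  by rewrite addr0 scale0r addr0 [x + _]addrC.
by apply: DeriveDef; [rewrite /derivable E|rewrite /derive E].
Qed.

Lemma Ck_sqrt n k (U : set 'rV[R]_n) F : open U -> (forall x, U x -> 0 < F x) ->
  Ck k U F -> Ck k U (fun x => Num.sqrt (F x)).
Proof.
move=> oU F0; elim: k => [|k ih] CF.
  have [cF _] := CF; split=> // x Ux; apply: continuous_comp; first exact: cF.
  exact: sqrt_continuous.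
have [cF dF] := CF; split.
  move=> x Ux; apply: continuous_comp; first exact: cF.
  exact: sqrt_continuous.
move=> i; have [d1 d2] := dF i.
have key x (Ux : U x) := derive_comp1 (is_derive1_sqrt (F0 x Ux)) (d1 x Ux).
split; first by move=> x Ux; exact: (@ex_derive _ _ _ _ _ _ _ (key x Ux)).
have s0 x : U x -> 2 * Num.sqrt (F x) != 0.
  by move=> Ux; rewrite mulf_neq0// gt_eqF// sqrtr_gt0 F0.
apply: Ck_ext (CkM oU (CkV oU s0 (CkM oU (Ck_cst k U 2) (ih (CkS CF)))) d2) => //.
by move=> y Uy; have [_ ->] := key y Uy.
Qed.

Lemma Ck_sum n k (U : set 'rV[R]_n) (I : Type) (r : seq I) (P : pred I)
    (F : I -> 'rV[R]_n -> R) : open U ->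
  (forall i, Ck k U (F i)) -> Ck k U (fun x => \sum_(i <- r | P i) F i x).
Proof.
move=> oU CF; elim: r => [|i r ih].
  rewrite (_ : (fun x => _) = fun=> 0); first exact: Ck_cst.
  by apply/funext => x; rewrite big_nil.
rewrite (_ : (fun x => _) =
    fun x => (if P i then F i x else 0) + \sum_(j <- r | P j) F j x).
  by apply: CkD => //; case: (P i) => //; exact: Ck_cst.
by apply/funext => x; rewrite big_cons; case: ifP => // _; rewrite add0r.
Qed.

Lemma cvg_rv (T : Type) (G : set_system T) {FG : Filter G} n
    (phi : T -> 'rV[R]_n) (y : 'rV[R]_n) :
  (forall j, phi t 0 j @[t --> G] --> y 0 j) -> phi t @[t --> G] --> y.
Proof.
move=> h A /nbhs_ballP[e e0 eA].
have : \forall t \near G, forall j, `|y 0 j - phi t 0 j| < e.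
  apply: filter_forall => j; have /cvgrPdist_lt/(_ e e0) := h j; exact.
apply: filterS => t ht; apply: eA; rewrite -ball_normE/=.
by apply/normrv_lt => // j; rewrite rvD rvN.
Qed.

(** The [A j] are partial derivatives at the intermediate points of [mvt_path]. Their convergence at
    [y0] is all that the chain rule needs, and it stands in for total differentiability. *)
Lemma hadamard n (V : set 'rV[R]_n) F y0 : open V -> V y0 -> Ck 1 V F ->
  exists A : 'I_n -> 'rV[R]_n -> R,
    (forall j, A j y @[y --> y0] --> 'D_(ed j) F y0) /\
    nbhs y0 [set y | F y - F y0 = \sum_j (y 0 j - y0 0 j) * A j y].
Proof.
move=> oV Vy0 CF.
have /nbhs_ballP[r r0 rV] := open_nbhs1 oV Vy0.
have inV z : `|y0 - z| < r -> V z by move=> h; apply: rV; rewrite -ball_normE.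
have y0r : `|y0 - y0| < r by rewrite subrr normr0.
have /choice[xi xiP] : forall y, exists xi : 'I_n -> 'rV[R]_n, `|y0 - y| < r ->
    (forall j, between y0 y (xi j)) /\
    F y - F y0 = \sum_j (y 0 j - y0 0 j) * 'D_(ed j) F (xi j).
  move=> y; have [yr|yr] := ltP `|y0 - y| r; last by exists (fun=> 0) => h.
  have [|xi xib E] := @mvt_path R n F y0 y; last by exists xi.
  move=> z b i; apply: (Ck_derivable CF); apply: inV; exact: between_ball b y0r yr.
exists (fun j y => 'D_(ed j) F (xi y j)); split; last first.
  apply/nbhs_ballP; exists r => // y; rewrite -ball_normE => /= yr.
  by have [_ ->] := xiP y yr.
move=> j A hA; have cD := Ck_cont (Ck_deriv j CF) Vy0.
have /nbhs_ballP[s s0 sA] := cD A hA.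
apply/nbhs_ballP; exists (Num.min r s); first by rewrite /= lt_min r0 s0.
move=> y; rewrite -ball_normE /= lt_min => /andP[yr ys]; apply: sA.
rewrite -ball_normE/=; have [b _] := xiP y yr.
apply: between_ball (b j) _ ys; by rewrite subrr normr0.
Qed.

(** Both [x] and [y] move while the linear part stays fixed at [y0]; [metric_compare] needs this
    strict form. *)
Lemma strict_diff n (V : set 'rV[R]_n) F y0 (e : R) : open V -> V y0 -> Ck 1 V F ->
  0 < e -> exists2 r : R, 0 < r & forall x y, `|y0 - x| < r -> `|y0 - y| < r ->
    `|F y - F x - \sum_j (y 0 j - x 0 j) * 'D_(ed j) F y0| <= e * `|y - x|.
Proof.
move=> oV Vy0 CF e0.
have /nbhs_ballP[r r0 rV] := open_nbhs1 oV Vy0.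
have inV z : `|y0 - z| < r -> V z by move=> h; apply: rV; rewrite -ball_normE.
have n0 : 0 < (n.+1%:R : R) by rewrite ltr0Sn.
have : \forall z \near y0, forall j, `|'D_(ed j) F y0 - 'D_(ed j) F z| < e / n.+1%:R.
  apply: near_forall => j; have cD := Ck_cont (Ck_deriv j CF) Vy0.
  by apply: (cont_near cD); exact: divr_gt0.
move=> /nbhs_ballP[s s0 sP].
exists (Num.min r s); first by rewrite lt_min r0 s0.
move=> x y; rewrite !lt_min => /andP[xr xs] /andP[yr ys].
have [|xi xib ->] := @mvt_path R n F x y.
  move=> z b i; apply: (Ck_derivable CF); apply: inV; exact: between_ball b xr yr.
rewrite -sumrB (le_trans (ler_norm_sum _ _ _))//.
apply: (@le_trans _ _ (\sum_(j < n) (e / n.+1%:R) * `|y - x|)).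
  apply: ler_sum => j _; rewrite -mulrBr normrM mulrC; apply: ler_pM => //.
    rewrite distrC; apply: ltW; apply: (sP (xi j)); rewrite -ball_normE/=.
    exact: between_ball (xib j) xs ys.
  by have := coord_le_norm (y - x) j; rewrite rvD rvN.
rewrite sumr_const card_ord -[_ *+ n]mulr_natl mulrA; apply: ler_wpM2r => //.
rewrite mulrA ler_pdivrMr// mulrC ler_pM2l// ler_nat//.
Qed.

Lemma chain_cvg n (V : set 'rV[R]_n) F (G : set_system R) {FG : Filter G}
    (phi : R -> 'rV[R]_n) y0 (d : 'I_n -> R) : open V -> V y0 -> Ck 1 V F ->
  (forall j, phi t 0 j @[t --> G] --> y0 0 j) ->
  (forall j, t^-1 * (phi t 0 j - y0 0 j) @[t --> G] --> d j) ->
  t^-1 * (F (phi t) - F y0) @[t --> G] --> \sum_j d j * 'D_(ed j) F y0.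
Proof.
move=> oV Vy0 CF c1 c2; have [A [cA nA]] := hadamard oV Vy0 CF.
have cphi : phi t @[t --> G] --> y0 by exact: cvg_rv.
have h : \sum_j (t^-1 * (phi t 0 j - y0 0 j)) * A j (phi t) @[t --> G] -->
    \sum_j d j * 'D_(ed j) F y0.
  apply: cvg_sumr => j _; apply: cvgM; first exact: c2.
  exact: (cvg_comp _ _ cphi (cA j)).
apply: cvg_trans h; apply: near_eq_cvg.
have h' : G (phi @^-1` [set y | F y - F y0 = \sum_j (y 0 j - y0 0 j) * A j y]).
  exact: cphi _ nA.
apply: filterS h' => t /= ->.
by rewrite mulr_sumr; apply: eq_bigr => j _; rewrite mulrA.
Qed.

Lemma line_cvg n (x v : 'rV[R]_n) : x + t *: v @[t --> (0 : R)^'] --> x.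
Proof.
apply: cvg_rv => j; rewrite (_ : (fun t => _) = fun t : R => x 0 j + t * v 0 j).
  rewrite -[X in _ --> X]addr0 -[X in _ + X](mul0r (v 0 j)).
  apply: cvgD; first exact: cvg_cst.
  apply: cvgM; last exact: cvg_cst.
  exact: nbhs_dnbhs.
by apply/funext => t; rewrite rvD rvZ.
Qed.

Lemma derive_chain n p (V : set 'rV[R]_p) F (phi : 'rV[R]_n -> 'rV[R]_p) x v :
  open V -> V (phi x) -> Ck 1 V F -> {for x, continuous phi} ->
  (forall j, derivable (fun y => phi y 0 j) x v) ->
  is_derive x v (fun y => F (phi y))
    (\sum_j 'D_v (fun y => phi y 0 j) x * 'D_(ed j) F (phi x)).
Proof.
move=> oV Vx CF cphi dphi; apply: cvg_derive.
apply: (@chain_cvg p V F _ _ (fun t => phi (x + t *: v))) => //.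
  move=> j; have := cvg_comp _ _ (@line_cvg n x v) cphi.
  by move=> h; exact: (cvg_comp _ _ h (@coord_continuous _ _ _ 0 j (phi x))).
by move=> j; exact: (derive_cvg (dphi j)).
Qed.

Lemma continuous_rv n p (phi : 'rV[R]_n -> 'rV[R]_p) x :
  (forall j, {for x, continuous (fun y => phi y 0 j)}) -> {for x, continuous phi}.
Proof. by move=> h; exact: (@cvg_rv _ (nbhs x) (nbhs_filter x) _ phi (phi x) h). Qed.

Lemma Ck_comp n p k (U : set 'rV[R]_n) (V : set 'rV[R]_p) F
    (phi : 'rV[R]_n -> 'rV[R]_p) : open U -> open V ->
  (forall x, U x -> V (phi x)) -> (forall j, Ck k U (fun y => phi y 0 j)) ->
  Ck k V F -> Ck k U (fun y => F (phi y)).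
Proof.
move=> oU oV UV; elim: k F => [|k ih] F Cphi CF.
  split=> // x Ux; apply: continuous_comp; last exact: Ck_cont CF (UV _ Ux).
  by apply: continuous_rv => j; exact: Ck_cont (Cphi j) Ux.
have cphi x : U x -> {for x, continuous phi}.
  by move=> Ux; apply: continuous_rv => j; exact: Ck_cont (Cphi j) Ux.
split.
  move=> x Ux; apply: continuous_comp; first exact: cphi.
  exact: Ck_cont CF (UV _ Ux).
move=> i.
have key x (Ux : U x) : is_derive x (ed i) (fun y => F (phi y))
    (\sum_j 'D_(ed i) (fun y => phi y 0 j) x * 'D_(ed j) F (phi x)).
  apply: (derive_chain oV (UV x Ux)); [exact: CkW CF|exact: cphi|].
  by move=> j; have [_ /(_ i)[h _]] := Cphi j; exact: h.
split; first by move=> x Ux; exact: (@ex_derive _ _ _ _ _ _ _ (key x Ux)).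
have C : Ck k U (fun x =>
    \sum_j 'D_(ed i) (fun y => phi y 0 j) x * 'D_(ed j) F (phi x)).
  apply: Ck_sum => // j; apply: CkM => //.
    by have [_ /(_ i)[_ h]] := Cphi j.
  apply: (ih (fun y => 'D_(ed j) F y)); first by move=> l; exact: CkS.
  exact: Ck_deriv.
by apply: Ck_ext C => // y Uy; have [_ ->] := key y Uy.
Qed.

Lemma derivable_shift n (F : 'rV[R]_n -> R) (a z v : 'rV[R]_n) :
  derivable F (z + a) v -> is_derive z v (fun y => F (y + a)) ('D_v F (z + a)).
Proof.
move=> /derive_cvg h; apply: cvg_derive.
by under eq_fun do rewrite addrAC.
Qed.

Lemma dist_le2 (a b p e : R) : `|a - p| < e -> `|b - p| < e -> `|a - b| <= 2 * e.
Proof.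
move=> ha hb; have -> : a - b = (a - p) - (b - p) by ring.
apply: le_trans (ler_normB _ _) _; lra.
Qed.

Lemma schwarz n (V : set 'rV[R]_n) F x i j : open V -> V x -> Ck 2 V F ->
  'D_(ed i) (fun y => 'D_(ed j) F y) x = 'D_(ed j) (fun y => 'D_(ed i) F y) x.
Proof.
move=> oV Vx CF.
have /nbhs_ballP[r r0 rV] := open_nbhs1 oV Vx.
have inV z : `|z - x| < r -> V z.
  by move=> h; apply: rV; rewrite -ball_normE/= distrC.
(* the second difference is h^2 times a mixed derivative near x *)
have mixed a b (h : R) : 0 < h -> 2 * h < r -> exists2 z, `|z - x| <= 2 * h &
    F (x + h *: ed a + h *: ed b) - F (x + h *: ed a) - (F (x + h *: ed b) - F x)
    = h * (h * 'D_(ed b) (fun y => 'D_(ed a) F y) z).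
  move=> h0 hr; pose G z := F (z + h *: ed b) - F z.
  have hn : `|h| = h by rewrite gtr0_norm.
  have near1 (t : R) : `|t| <= `|h| -> `|x + t *: ed a - x| <= h.
    by rewrite addrAC subrr add0r norm_ed hn.
  have near2 (t s : R) : `|t| <= `|h| -> `|s| <= `|h| ->
      `|x + t *: ed a + s *: ed b - x| <= 2 * h.
    move=> tt ss; have -> : x + t *: ed a + s *: ed b - x = t *: ed a + s *: ed b.
      by apply/rowP => l; rewrite !mxE; ring.
    by rewrite (le_trans (ler_normD _ _))// !norm_ed; lra.
  have V1 (t : R) : `|t| <= `|h| -> V (x + t *: ed a).
    by move=> tt; apply: inV; rewrite (le_lt_trans (near1 t tt))//; lra.
  have V2 (t s : R) : `|t| <= `|h| -> `|s| <= `|h| -> V (x + t *: ed a + s *: ed b).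
    by move=> tt ss; apply: inV; rewrite (le_lt_trans (near2 t s tt ss)).
  have dG (t : R) : `|t| <= `|h| -> is_derive (x + t *: ed a) (ed a) G
      ('D_(ed a) F (x + t *: ed a + h *: ed b) - 'D_(ed a) F (x + t *: ed a)).
    move=> tt; apply: (@is_deriveB _ _ _ (fun y => F (y + h *: ed b)) F).
      by apply: derivable_shift; apply: (Ck_derivable CF); apply: V2.
    by apply: derivableP; apply: (Ck_derivable CF); exact: V1.
  have [t [t1 _ E1]] := @mvt_line R n G x (ed a) h
    (fun t t1 _ => @ex_derive _ _ _ _ _ _ _ (dG t t1)).
  have [s [s1 _ E2]] := @mvt_line R n (fun y => 'D_(ed a) F y) (x + t *: ed a) (ed b) h
    (fun s s1 _ => Ck_derivable (i := b) (Ck_deriv a CF) (V2 t s t1 s1)).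
  exists (x + t *: ed a + s *: ed b); first exact: near2.
  have [_ E3] := dG t t1.
  by rewrite -E2 -E3 -E1 /G.
apply/eqP; rewrite -subr_eq0; apply/eqP.
apply: (@eq0_of_small _ _ 2); first by [].
move=> e e0.
have c1 := Ck_cont (Ck_deriv i (Ck_deriv j CF)) Vx; have c2 := Ck_cont (Ck_deriv j (Ck_deriv i CF)) Vx.
have /nbhs_ballP[d1 d10 d1P] : \forall z \near x,
   `|'D_(ed i) (fun y => 'D_(ed j) F y) x - 'D_(ed i) (fun y => 'D_(ed j) F y) z| < e.
  exact: (cont_near c1).
have /nbhs_ballP[d2 d20 d2P] : \forall z \near x,
   `|'D_(ed j) (fun y => 'D_(ed i) F y) x - 'D_(ed j) (fun y => 'D_(ed i) F y) z| < e.
  exact: (cont_near c2).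
pose h := Num.min r (Num.min d1 d2) / 3.
have m0 : 0 < Num.min r (Num.min d1 d2) by rewrite !lt_min r0 d10 d20.
have h0 : 0 < h by rewrite /h; lra.
have hm : 2 * h < Num.min r (Num.min d1 d2) by rewrite /h; lra.
move: (hm); rewrite !lt_min => /and3P[hr h1 h2].
have [z zx Ez] := mixed j i h h0 hr; have [w wx Ew] := mixed i j h h0 hr.
have E : 'D_(ed i) (fun y => 'D_(ed j) F y) z = 'D_(ed j) (fun y => 'D_(ed i) F y) w.
  apply: (mulfI (lt0r_neq0 h0)); apply: (mulfI (lt0r_neq0 h0)).
  apply: etrans (esym Ez) _; apply: etrans _ Ew.
  have -> : x + h *: ed i + h *: ed j = x + h *: ed j + h *: ed i by exact: addrAC.
  move: (F _) (F _) (F _) (F _) => p q s t; ring.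
have b1 := d1P z; have b2 := d2P w.
rewrite -!ball_normE/= in b1 b2.
have := b1 _; rewrite distrC => /(_ (le_lt_trans zx h1)).
have := b2 _; rewrite [`|x - w|]distrC => /(_ (le_lt_trans wx h2)).
rewrite -E => hb ha; move: ha hb; exact: dist_le2.
Qed.

End Chain.

(** * Calculus on relatively open subsets of the half-space *)

Section Relative.
Context {R : realType} {m : nat}.
Notation H := (@half_space R m).
Implicit Types (D : set 'rV[R]_m.+1) (h : 'rV[R]_m.+1 -> R) (x : 'rV[R]_m.+1).

Definition relopen D : Prop := exists2 U, open U & D = U `&` H.

Lemma relopen_half D x : relopen D -> D x -> 0 <= x 0 ord0.
Proof. by move=> [U _ ->] []. Qed.

Lemma relopen_nbhs D x : relopen D -> D x ->
  exists2 r : R, 0 < r & forall y, `|x - y| < r -> 0 <= y 0 ord0 -> D y.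
Proof.
move=> [U oU ->] [Ux _]; have /nbhs_ballP[r r0 rU] := open_nbhs1 oU Ux.
by exists r => // y xy y0; split => //; apply: rU; rewrite -ball_normE.
Qed.

Lemma relopen_interior D x : relopen D -> D x -> 0 < x 0 ord0 -> nbhs x D.
Proof.
move=> oD Dx x0; have [r r0 rD] := relopen_nbhs oD Dx.
apply/nbhs_ballP; exists (Num.min r (x 0 ord0)); first by rewrite /= lt_min r0.
move=> y; rewrite -ball_normE/= lt_min => /andP[xy xy0]; apply: rD => //.
have := coord_le_norm (x - y) ord0; rewrite rvD rvN => h.
have := ler_norm (x 0 ord0 - y 0 ord0); lra.
Qed.

(** A small positive step along any axis stays in the half-space, even from a boundary point.
    Properness of the filter makes the limit in [partial] unique. *)
Lemma line_within D x i : relopen D -> D x ->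
  ProperFilter (within [set t : R | D (x + t *: ed i)] (0 : R)^').
Proof.
move=> oD Dx; have [r r0 rD] := relopen_nbhs oD Dx.
apply: Build_ProperFilter_ex => P; rewrite /within/= => /nbhs_ballP[e e0 eP].
pose t := Num.min r e / 2.
have re0 : 0 < Num.min r e by rewrite lt_min r0.
have t0 : 0 < t by rewrite /t divr_gt0.
have tr : t < Num.min r e by rewrite /t; lra.
move: tr; rewrite lt_min => /andP[tr te].
exists t; apply: eP => /=.
- by rewrite -ball_normE/= sub0r normrN gtr0_norm.
- by rewrite gt_eqF.
- apply: rD; first by rewrite opprD addrA subrr sub0r normrN norm_ed gtr0_norm.
  rewrite rvD rvZ edE addr_ge0 ?(relopen_half oD Dx)// mulr_ge0 ?(ltW t0)//.
Qed.

(** The bridge to ordinary calculus: any local extension computes the relative derivative, so every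
    rule for [partial] is inherited from the corresponding rule on open sets. *)
Lemma partial_ext D (W : set 'rV[R]_m.+1) h F x i : relopen D -> D x ->
  open W -> W x -> (forall y, W y -> D y -> F y = h y) -> derivable F x (ed i) ->
  t^-1 * (h (x + t *: ed i) - h x) @[t --> within [set t : R | D (x + t *: ed i)] 0^']
    --> 'D_(ed i) F x /\
  partial D i h x = 'D_(ed i) F x.
Proof.
move=> oD Dx oW Wx Fh dF; have PF := line_within i oD Dx.
have c : t^-1 * (h (x + t *: ed i) - h x) @[t --> within [set t : R | D (x + t *: ed i)] 0^']
    --> 'D_(ed i) F x.
  have c1 : t^-1 * (F (x + t *: ed i) - F x)
      @[t --> within [set t : R | D (x + t *: ed i)] 0^'] --> 'D_(ed i) F x.
    exact: cvg_within_filter (derive_cvg dF).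
  have nW : (0 : R)^' [set t | W (x + t *: ed i)].
    by apply: (@line_cvg R _ x (ed i) W); exact: open_nbhs1.
  move=> P /c1; rewrite /within/= => nP.
  apply: filterS (filterI nW nP) => t [/= Wt Pt] Dt.
  by rewrite -(Fh _ Wt Dt) -(Fh x Wx Dx); exact: Pt.
by split => //; exact: cvg_lim.
Qed.

Definition smooth_ext D h x (U : set 'rV[R]_m.+1) (F : 'rV[R]_m.+1 -> R) : Prop :=
  [/\ open U, U x, forall k, Ck k U F & forall y, U y -> D y -> F y = h y].

Lemma smooth_onP D h x : smooth_on D h -> D x -> exists U F, smooth_ext D h x U F.
Proof.
by move=> sh Dx; have [U [F [oU Ux /smooth_openP sF Fh]]] := sh x Dx; exists U, F.
Qed.

Lemma smooth_onI D h : (forall x, D x -> exists U F, smooth_ext D h x U F) ->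
  smooth_on D h.
Proof.
move=> sh x Dx; have [U [F [oU Ux sF Fh]]] := sh x Dx; exists U, F; split => //.
exact/smooth_openP.
Qed.

Lemma smooth_ext_partial D h x U F i y : relopen D -> smooth_ext D h x U F ->
  U y -> D y -> partial D i h y = 'D_(ed i) F y.
Proof.
move=> oD [oU Ux CF Fh] Uy Dy.
by apply: (partial_ext oD Dy oU Uy Fh _).2; exact: Ck_derivable (CF 1%N) Uy.
Qed.

Lemma partial_cvg D h x i : relopen D -> smooth_on D h -> D x ->
  t^-1 * (h (x + t *: ed i) - h x) @[t --> within [set t : R | D (x + t *: ed i)] 0^']
    --> partial D i h x.
Proof.
move=> oD sh Dx; have [U [F [oU Ux CF Fh]]] := smooth_onP sh Dx.
have dF := Ck_derivable (i := i) (CF 1%N) Ux.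
by have [c ->] := partial_ext oD Dx oU Ux Fh dF.
Qed.

Lemma smooth_on_partial D h i : relopen D -> smooth_on D h ->
  smooth_on D (partial D i h).
Proof.
move=> oD sh; apply: smooth_onI => x Dx; have [U [F e]] := smooth_onP sh Dx.
have [oU Ux CF Fh] := e; exists U, (fun y => 'D_(ed i) F y); split => //.
  by move=> k; exact: Ck_deriv (CF k.+1).
by move=> y Uy Dy; rewrite (smooth_ext_partial i oD e Uy Dy).
Qed.

Lemma smooth_on_congr D h k : (forall x, D x -> h x = k x) -> smooth_on D h ->
  smooth_on D k.
Proof.
move=> hk sh; apply: smooth_onI => x Dx; have [U [F [oU Ux CF Fh]]] := smooth_onP sh Dx.
by exists U, F; split => // y Uy Dy; rewrite Fh// hk.
Qed.

Lemma smooth_on_sub D D' h : D' `<=` D -> smooth_on D h -> smooth_on D' h.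
Proof.
move=> DD sh; apply: smooth_onI => x /DD Dx.
have [U [F [oU Ux CF Fh]]] := smooth_onP sh Dx.
by exists U, F; split => // y Uy /DD; exact: Fh.
Qed.

Lemma smooth_on_cst D c : smooth_on D (fun=> c).
Proof.
apply: smooth_onI => x Dx; exists setT, (fun=> c); split => //; first exact: openT.
by move=> k; exact: Ck_cst.
Qed.

Lemma smooth_onD D h k : smooth_on D h -> smooth_on D k ->
  smooth_on D (fun x => h x + k x).
Proof.
move=> sh sk; apply: smooth_onI => x Dx.
have [U [F [oU Ux CF Fh]]] := smooth_onP sh Dx.
have [V [G [oV Vx CG Gk]]] := smooth_onP sk Dx.
have oUV := openI oU oV.
exists (U `&` V), (fun x => F x + G x); split => //.
  move=> j; apply: CkD => //; [exact: Ck_sub (CF j)|exact: Ck_sub (CG j)].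
by move=> y [Uy Vy] Dy; rewrite Fh// Gk.
Qed.

Lemma smooth_onM D h k : smooth_on D h -> smooth_on D k ->
  smooth_on D (fun x => h x * k x).
Proof.
move=> sh sk; apply: smooth_onI => x Dx.
have [U [F [oU Ux CF Fh]]] := smooth_onP sh Dx.
have [V [G [oV Vx CG Gk]]] := smooth_onP sk Dx.
have oUV := openI oU oV.
exists (U `&` V), (fun x => F x * G x); split => //.
  move=> j; apply: CkM => //; [exact: Ck_sub (CF j)|exact: Ck_sub (CG j)].
by move=> y [Uy Vy] Dy; rewrite Fh// Gk.
Qed.

Lemma smooth_onZ D c h : smooth_on D h -> smooth_on D (fun x => c * h x).
Proof. by move=> sh; apply: smooth_onM => //; exact: smooth_on_cst. Qed.

Lemma smooth_onN D h : smooth_on D h -> smooth_on D (fun x => - h x).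
Proof.
by move=> sh; apply: smooth_on_congr (smooth_onZ (-1) sh) => x _; rewrite mulN1r.
Qed.

Lemma smooth_onB D h k : smooth_on D h -> smooth_on D k ->
  smooth_on D (fun x => h x - k x).
Proof. by move=> sh /smooth_onN; exact: smooth_onD. Qed.

Lemma smooth_on_sum D (I : Type) (r : seq I) (P : pred I) (F : I -> 'rV[R]_m.+1 -> R) :
  (forall i, smooth_on D (F i)) -> smooth_on D (fun x => \sum_(i <- r | P i) F i x).
Proof.
move=> sF; elim: r => [|i r ih].
  have -> : (fun x => \sum_(i <- [::] | P i) F i x) = (fun=> 0 : R) :> ('rV[R]_m.+1 -> R).
    by apply/funext => x; rewrite big_nil.
  exact: smooth_on_cst.
apply: (@smooth_on_congr _ (fun x => (if P i then F i x else 0) +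
    \sum_(j <- r | P j) F j x)).
  by move=> x _; rewrite big_cons; case: ifP => // _; rewrite add0r.
by apply: smooth_onD => //; case: (P i) => //; exact: smooth_on_cst.
Qed.

Lemma smooth_on_prod D (I : Type) (r : seq I) (P : pred I) (F : I -> 'rV[R]_m.+1 -> R) :
  (forall i, smooth_on D (F i)) -> smooth_on D (fun x => \prod_(i <- r | P i) F i x).
Proof.
move=> sF; elim: r => [|i r ih].
  have -> : (fun x => \prod_(i <- [::] | P i) F i x) = (fun=> 1 : R) :> ('rV[R]_m.+1 -> R).
    by apply/funext => x; rewrite big_nil.
  exact: smooth_on_cst.
apply: (@smooth_on_congr _ (fun x => (if P i then F i x else 1) *
    \prod_(j <- r | P j) F j x)).
  by move=> x _; rewrite big_cons; case: ifP => // _; rewrite mul1r.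
by apply: smooth_onM => //; case: (P i) => //; exact: smooth_on_cst.
Qed.

Lemma open_near n (U : set 'rV[R]_n) (P : set R) (F : 'rV[R]_n -> R) : open U ->
  (forall x : 'rV[R]_n, U x -> {for x, continuous F}) -> open P -> open (U `&` F @^-1` P).
Proof.
move=> oU cF oP; rewrite openE => x [Ux Px]; apply: filterI; first exact: open_nbhs1.
by apply: (cF x Ux); exact: open_nbhs_nbhs (conj oP Px).
Qed.

Lemma smooth_onV D h : (forall x, D x -> h x != 0) -> smooth_on D h ->
  smooth_on D (fun x => (h x)^-1).
Proof.
move=> h0 sh; apply: smooth_onI => x Dx.
have [U [F [oU Ux CF Fh]]] := smooth_onP sh Dx.
have cF y : U y -> {for y, continuous F} by exact: Ck_cont (CF 0%N).
have oN : open [set t : R | t != 0] by exact: open_neq.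
have oW := open_near oU cF oN.
exists (U `&` F @^-1` [set t : R | t != 0]), (fun x => (F x)^-1); split => //.
- by split => //=; rewrite Fh// h0.
- move=> k; apply: CkV => //; first by move=> y [].
  by apply: Ck_sub (CF k) => y [].
- by move=> y [Uy _] Dy; rewrite Fh.
Qed.

Lemma smooth_on_sqrt D h : (forall x, D x -> 0 < h x) -> smooth_on D h ->
  smooth_on D (fun x => Num.sqrt (h x)).
Proof.
move=> h0 sh; apply: smooth_onI => x Dx.
have [U [F [oU Ux CF Fh]]] := smooth_onP sh Dx.
have cF y : U y -> {for y, continuous F} by exact: Ck_cont (CF 0%N).
have oW := open_near oU cF (@open_gt R 0).
exists (U `&` F @^-1` [set t : R | 0 < t]), (fun x => Num.sqrt (F x)); split => //.
- by split => //=; rewrite Fh// h0.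
- move=> k; apply: Ck_sqrt => //; first by move=> y [].
  by apply: Ck_sub (CF k) => y [].
- by move=> y [Uy _] Dy; rewrite Fh.
Qed.

Lemma partialD D h k x i : relopen D -> smooth_on D h -> smooth_on D k -> D x ->
  partial D i (fun y => h y + k y) x = partial D i h x + partial D i k x.
Proof.
move=> oD sh sk Dx.
have [U [F e]] := smooth_onP sh Dx; have [oU Ux CF Fh] := e.
have [V [G e']] := smooth_onP sk Dx; have [oV Vx CG Gk] := e'.
rewrite (smooth_ext_partial i oD e)// (smooth_ext_partial i oD e')//.
have dF := Ck_derivable (i := i) (CF 1%N) Ux.
have dG := Ck_derivable (i := i) (CG 1%N) Vx.
rewrite -(deriveD dF dG).
apply: (partial_ext oD Dx (openI oU oV) (conj Ux Vx) _ _).2.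
  by move=> y [Uy Vy] Dy; rewrite -Fh// -Gk.
exact: derivableD.
Qed.

Lemma partialM D h k x i : relopen D -> smooth_on D h -> smooth_on D k -> D x ->
  partial D i (fun y => h y * k y) x = h x * partial D i k x + k x * partial D i h x.
Proof.
move=> oD sh sk Dx.
have [U [F e]] := smooth_onP sh Dx; have [oU Ux CF Fh] := e.
have [V [G e']] := smooth_onP sk Dx; have [oV Vx CG Gk] := e'.
rewrite (smooth_ext_partial i oD e)// (smooth_ext_partial i oD e')//.
have dF := Ck_derivable (i := i) (CF 1%N) Ux.
have dG := Ck_derivable (i := i) (CG 1%N) Vx.
rewrite -(Fh x)// -(Gk x)//.
rewrite -[RHS]/(F x *: 'D_(ed i) G x + G x *: 'D_(ed i) F x) -(deriveM dF dG).
apply: (partial_ext oD Dx (openI oU oV) (conj Ux Vx) _ _).2.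
  by move=> y [Uy Vy] Dy; rewrite -Fh// -Gk.
exact: (derivableM dF dG).
Qed.

Lemma partial_cst D c x i : relopen D -> D x -> partial D i (fun=> c) x = 0.
Proof.
move=> oD Dx; have [_ ->] := @partial_ext D setT (fun=> c) (cst c) x i oD Dx openT
  I (fun y _ _ => erefl) (derivable_cst _ _ _).
exact: derive_cst.
Qed.

Lemma partialZ D c h x i : relopen D -> smooth_on D h -> D x ->
  partial D i (fun y => c * h y) x = c * partial D i h x.
Proof.
move=> oD sh Dx; rewrite partialM//; last exact: smooth_on_cst.
by rewrite partial_cst// mulr0 addr0.
Qed.

Lemma partial_congr D h k x i : relopen D -> smooth_on D h -> D x ->
  (forall y, D y -> h y = k y) -> partial D i h x = partial D i k x.
Proof.
move=> oD sh Dx hk; have [U [F [oU Ux CF Fh]]] := smooth_onP sh Dx.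
have dF := Ck_derivable (i := i) (CF 1%N) Ux.
rewrite (partial_ext oD Dx oU Ux Fh dF).2; apply: esym.
by apply: (partial_ext oD Dx oU Ux _ dF).2 => y Uy Dy; rewrite -hk// Fh.
Qed.

Lemma partial_sub D D' h x i : relopen D -> relopen D' -> D' `<=` D ->
  smooth_on D h -> D' x -> partial D' i h x = partial D i h x.
Proof.
move=> oD oD' DD sh Dx; have [U [F [oU Ux CF Fh]]] := smooth_onP sh (DD _ Dx).
have dF := Ck_derivable (i := i) (CF 1%N) Ux.
rewrite (partial_ext oD (DD _ Dx) oU Ux Fh dF).2.
by apply: (partial_ext oD' Dx oU Ux _ dF).2 => y Uy /DD Dy; rewrite Fh.
Qed.

Lemma partial_sum D (I : Type) (r : seq I) (P : pred I) (F : I -> 'rV[R]_m.+1 -> R) x i :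
  relopen D -> (forall j, smooth_on D (F j)) -> D x ->
  partial D i (fun y => \sum_(j <- r | P j) F j y) x =
  \sum_(j <- r | P j) partial D i (F j) x.
Proof.
move=> oD sF Dx; elim: r => [|j r ih].
  have -> : (fun y => \sum_(j <- [::] | P j) F j y) = (fun=> 0 : R) :> ('rV[R]_m.+1 -> R).
    by apply/funext => y; rewrite big_nil.
  by rewrite big_nil partial_cst.
rewrite big_cons; case: ifPn => Pj; last first.
  rewrite -ih; apply: partial_congr => //; first exact: smooth_on_sum.
  by move=> y _; rewrite big_cons (negbTE Pj).
rewrite -ih -partialD//; last exact: smooth_on_sum.
apply: partial_congr => //; first exact: smooth_on_sum.
by move=> y _; rewrite big_cons Pj.
Qed.

Lemma partial_comm D h x i j : relopen D -> smooth_on D h -> D x ->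
  partial D i (partial D j h) x = partial D j (partial D i h) x.
Proof.
move=> oD sh Dx; have [U [F e]] := smooth_onP sh Dx; have [oU Ux CF Fh] := e.
have E a b : partial D a (partial D b h) x = 'D_(ed a) (fun y => 'D_(ed b) F y) x.
  apply: (partial_ext oD Dx oU Ux _ _).2.
    by move=> y Uy Dy; rewrite (smooth_ext_partial b oD e).
  exact: Ck_derivable (Ck_deriv b (CF 2)) Ux.
by rewrite !E; exact: schwarz (CF 2).
Qed.

(** Extending [phi] coordinate by coordinate may lead out of [V]; continuity at [x] gives a ball on
    which it does not. *)
Lemma smooth_on_comp_ext n D (V : set 'rV[R]_n) F (phi : 'rV[R]_m.+1 -> 'rV[R]_n) x :
  open V -> (forall k, Ck k V F) -> D x -> V (phi x) ->
  (forall j, smooth_on D (fun y => phi y 0 j)) ->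
  exists U (Phi : 'rV[R]_m.+1 -> 'rV[R]_n),
   [/\ open U, U x, forall j k, Ck k U (fun y => Phi y 0 j),
       forall y, U y -> D y -> Phi y = phi y &
       (forall y, U y -> V (Phi y)) /\ forall k, Ck k U (fun y => F (Phi y))].
Proof.
move=> oV CF Dx Vx sphi.
have /choice[UF UFP] : forall j, exists UF : set 'rV[R]_m.+1 * ('rV[R]_m.+1 -> R),
    smooth_ext D (fun y => phi y 0 j) x UF.1 UF.2.
  by move=> j; have [U [F' e]] := smooth_onP (sphi j) Dx; exists (U, F').
pose Phi y : 'rV[R]_n := \row_j (UF j).2 y.
have nU : nbhs x (fun y => forall j, (UF j).1 y).
  by apply: near_forall => j; have [oU Ux _ _] := UFP j; exact: open_nbhs1.
have cPhi : {for x, continuous Phi}.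
  apply: continuous_rv => j; have [oU Ux CU _] := UFP j.
  by rewrite (_ : (fun y => _) = (UF j).2); [exact: Ck_cont (CU 0%N) Ux|
    apply/funext => y; rewrite mxE].
have Phix : Phi x = phi x.
  by apply/rowP => j; rewrite mxE; have [_ Ux _ ->] := UFP j.
have nV : nbhs x (Phi @^-1` V).
  by apply: cPhi; rewrite Phix; exact: open_nbhs1.
have nUV : nbhs x ((fun y => forall j, (UF j).1 y) `&` Phi @^-1` V) by exact: filterI.
have /nbhs_ballP[r r0 rP] := nUV.
have oB : open (ball x r) by exact: ball_open.
have CPhi j k : Ck k (ball x r) (fun y => Phi y 0 j).
  rewrite (_ : (fun y => _) = (UF j).2); last by apply/funext => y; rewrite mxE.
  by have [_ _ CU _] := UFP j; apply: Ck_sub (CU k) => y /rP[].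
exists (ball x r), Phi; split => //.
- exact: ballxx.
- move=> y /rP[Uy _] Dy; apply/rowP => j; rewrite mxE.
  by have [_ _ _ ->] := UFP j.
split; first by move=> y /rP[_].
move=> k; apply: (Ck_comp oB oV) => //.
by move=> y /rP[_].
Qed.

End Relative.

(** * Derivatives of determinants, inverses and densities *)

Section MatrixCalculus.
Context {R : realType} {m : nat}.
Notation n := m.+1.
Implicit Types (D : set 'rV[R]_n) (x : 'rV[R]_n).

Lemma smooth_on_comp_global p D (F : 'rV[R]_p -> R) (phi : 'rV[R]_n -> 'rV[R]_p) :
  (forall k, Ck k setT F) ->
  (forall j, smooth_on D (fun y => phi y 0 j)) -> smooth_on D (fun y => F (phi y)).
Proof.
move=> CF sphi; apply: smooth_onI => x Dx.
have [U [Phi [oU Ux CPhi Phiphi [UV CFPhi]]]] :=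
  smooth_on_comp_ext openT CF Dx I sphi.
by exists U, (fun y => F (Phi y)); split => // y Uy Dy; rewrite Phiphi.
Qed.

Lemma partial_chain D D' (h : 'rV[R]_n -> R) (phi : 'rV[R]_n -> 'rV[R]_n) x i :
  relopen D -> relopen D' -> (forall x, D x -> D' (phi x)) ->
  (forall j, smooth_on D (fun y => phi y 0 j)) -> smooth_on D' h -> D x ->
  partial D i (fun y => h (phi y)) x =
  \sum_j partial D i (fun y => phi y 0 j) x * partial D' j h (phi x).
Proof.
move=> oD oD' DD sphi sh Dx.
have [V [F e]] := smooth_onP sh (DD _ Dx); have [oV Vx CF Fh] := e.
have [U [Phi [oU Ux CPhi Phiphi [UV CFPhi]]]] := smooth_on_comp_ext oV CF Dx Vx sphi.
have Phix : Phi x = phi x by exact: Phiphi.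
have cPhi : {for x, continuous Phi}.
  by apply: continuous_rv => j; exact: Ck_cont (CPhi j 0%N) Ux.
have dPhi j : derivable (fun y => Phi y 0 j) x (ed i).
  exact: Ck_derivable (CPhi j 1%N) Ux.
have VPx : V (Phi x) by rewrite Phix.
have [d1 d2] := derive_chain oV VPx (CF 1%N) cPhi dPhi.
rewrite (partial_ext oD Dx oU Ux _ d1).2; last first.
  move=> y Uy Dy; rewrite Fh; [|exact: UV|]; rewrite Phiphi//; exact: DD.
rewrite d2 Phix; apply: eq_bigr => j _.
rewrite (smooth_ext_partial j oD' e Vx (DD _ Dx)); congr (_ * _).
rewrite (partial_ext oD Dx oU Ux _ (dPhi j)).2// => y Uy Dy.
by rewrite Phiphi.
Qed.

Lemma partial_prod D (I : eqType) (r : seq I) (F : I -> 'rV[R]_n -> R) x i :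
  relopen D -> (forall j, smooth_on D (F j)) -> D x -> uniq r ->
  partial D i (fun y => \prod_(j <- r) F j y) x =
  \sum_(a <- r) \prod_(j <- r) (if j == a then partial D i (F j) x else F j x).
Proof.
move=> oD sF Dx; elim: r => [_|a r ih /= /andP[ar ur]].
  have -> : (fun y => \prod_(j <- [::]) F j y) = (fun=> 1 : R) :> ('rV[R]_n -> R).
    by apply/funext => y; rewrite big_nil.
  by rewrite big_nil partial_cst.
have -> : (fun y => \prod_(j <- a :: r) F j y) = (fun y => F a y * \prod_(j <- r) F j y).
  by apply/funext => y; rewrite big_cons.
rewrite partialM//; last exact: smooth_on_prod.
rewrite ih// !big_cons eqxx addrC; congr (_ + _).
  rewrite mulrC; congr (_ * _); apply: eq_big_seq => j jr.
  by case: eqP => // ja; move: ar; rewrite -ja jr.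
rewrite mulr_sumr; apply: eq_big_seq => b br.
rewrite big_cons; case: eqP => // ab; by move: ar; rewrite ab br.
Qed.

Variables (k : nat) (G : 'rV[R]_n -> 'M[R]_k).

Definition smooth_mx D (G : 'rV[R]_n -> 'M[R]_k) : Prop :=
  forall i j, smooth_on D (fun y => G y i j).

Definition dmx D (i : 'I_n) (G : 'rV[R]_n -> 'M[R]_k) x : 'M[R]_k :=
  \matrix_(a, b) partial D i (fun y => G y a b) x.

Lemma smooth_on_det D : smooth_mx D G -> smooth_on D (fun y => \det (G y)).
Proof.
move=> sG; apply: smooth_on_sum => s; apply: smooth_onM; first exact: smooth_on_cst.
exact: smooth_on_prod.
Qed.

Lemma partial_det D i x : relopen D -> smooth_mx D G -> D x ->
  partial D i (fun y => \det (G y)) x = \tr (dmx D i G x *m \adj (G x)).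
Proof.
move=> oD sG Dx.
have sP (s : {perm 'I_k}) : smooth_on D (fun y => \prod_j G y j (s j)) by exact: smooth_on_prod.
transitivity (\sum_(s : {perm 'I_k}) (-1) ^+ s * \sum_a \prod_j
   (if j == a then partial D i (fun y => G y j (s j)) x else G x j (s j))).
  rewrite partial_sum//; last by move=> s; apply: smooth_onZ.
  apply: eq_bigr => s _; rewrite partialZ//; congr (_ * _).
  by rewrite partial_prod// index_enum_uniq.
(* [G] with row [a] differentiated. Leibniz' rule over permutations yields the sum of these
   determinants, and expanding each along row [a] brings in the cofactors of [G]. *)
pose M a : 'M[R]_k := \matrix_(i', j) if i' == a then dmx D i G x i' j else G x i' j.
transitivity (\sum_a \det (M a)).
  under eq_bigr do rewrite mulr_sumr.
  rewrite exchange_big; apply: eq_bigr => a _; apply: eq_bigr => s _.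
  by congr (_ * _); apply: eq_bigr => j _; rewrite !mxE; case: ifP.
rewrite /mxtrace; apply: eq_bigr => a _.
rewrite (expand_det_row _ a) mxE; apply: eq_bigr => j _.
rewrite !mxE eqxx; congr (_ * _).
rewrite /cofactor; congr (_ * \det _); apply/matrixP => p q.
rewrite !mxE; case: eqP => // h; by have := neq_lift a p; rewrite h eqxx.
Qed.

Lemma smooth_on_invmx D : (forall x, D x -> G x \in unitmx) -> smooth_mx D G ->
  smooth_mx D (fun y => invmx (G y)).
Proof.
move=> uG sG i j.
have sD : smooth_on D (fun y => (\det (G y))^-1).
  apply: smooth_onV; last exact: smooth_on_det.
  by move=> x /uG; rewrite unitmxE unitfE.
have sA : smooth_on D (fun y => cofactor (G y) j i).
  rewrite /cofactor; apply: smooth_onM; first exact: smooth_on_cst.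
  apply: smooth_on_sum => s; apply: smooth_onM; first exact: smooth_on_cst.
  apply: smooth_on_prod => p.
  have -> : (fun y => row' j (col' i (G y)) p (s p)) =
      (fun y => G y (lift j p) (lift i (s p))).
    by apply/funext => y; rewrite !mxE.
  exact: sG.
apply: smooth_on_congr (smooth_onM sD sA) => y Dy.
by rewrite /invmx uG// !mxE.
Qed.

Lemma dmxM D i (A B : 'rV[R]_n -> 'M[R]_k) x : relopen D -> smooth_mx D A ->
  smooth_mx D B -> D x ->
  dmx D i (fun y => A y *m B y) x = dmx D i A x *m B x + A x *m dmx D i B x.
Proof.
move=> oD sA sB Dx; apply/matrixP => a b; rewrite !mxE -big_split/=.
transitivity (partial D i (fun y => \sum_j A y a j * B y j b) x).
  congr (partial D i _ x); by apply/funext => y; rewrite mxE.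
rewrite partial_sum//; last by move=> j; exact: smooth_onM.
by apply: eq_bigr => j _; rewrite partialM// addrC [B x j b * _]mulrC /dmx !mxE.
Qed.

(** Obtained by differentiating the constant product of [invmx (G y)] and [G y]. *)
Lemma dmx_invmx D i x : relopen D -> (forall x, D x -> G x \in unitmx) ->
  smooth_mx D G -> D x ->
  dmx D i (fun y => invmx (G y)) x = - (invmx (G x) *m dmx D i G x *m invmx (G x)).
Proof.
move=> oD uG sG Dx; have sP := smooth_on_invmx uG sG.
have E : dmx D i (fun y => invmx (G y) *m G y) x = 0.
  apply/matrixP => a b; rewrite !mxE -(partial_cst ((1%:M : 'M[R]_k) a b) i oD Dx).
  apply: esym; apply: partial_congr => //; first exact: smooth_on_cst.
  by move=> y Dy; rewrite mulVmx// uG.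
have := E; rewrite dmxM// => /eqP; rewrite addr_eq0 => /eqP E2.
by rewrite -(mulmxK (uG x Dx) (dmx D i _ x)) E2 mulNmx.
Qed.

Lemma partial_sqrt D (h : 'rV[R]_n -> R) i x : relopen D ->
  (forall x, D x -> 0 < h x) -> smooth_on D h -> D x ->
  partial D i (fun y => Num.sqrt (h y)) x = partial D i h x / (2 * Num.sqrt (h x)).
Proof.
move=> oD h0 sh Dx; have ss := smooth_on_sqrt h0 sh.
have : partial D i (fun y => Num.sqrt (h y) * Num.sqrt (h y)) x = partial D i h x.
  apply: partial_congr => //; first exact: smooth_onM.
  by move=> y Dy; rewrite -expr2 sqr_sqrtr// ltW// h0.
rewrite partialM// => <-; have s0 : Num.sqrt (h x) != 0 by rewrite gt_eqF// sqrtr_gt0 h0.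
by field.
Qed.

Lemma partial_sqrt_det D i x : relopen D -> (forall x, D x -> 0 < \det (G x)) ->
  smooth_mx D G -> D x ->
  partial D i (fun y => Num.sqrt (\det (G y))) x =
  Num.sqrt (\det (G x)) * (2^-1 * \tr (invmx (G x) *m dmx D i G x)).
Proof.
move=> oD dG sG Dx; rewrite partial_sqrt//; last exact: smooth_on_det.
rewrite partial_det// mxtrace_mulC.
have u : G x \in unitmx by rewrite unitmxE unitfE gt_eqF// dG.
rewrite /invmx u -scalemxAl mxtraceZ.
have s0 : Num.sqrt (\det (G x)) != 0 by rewrite gt_eqF// sqrtr_gt0 dG.
set t := \tr _; have -> : \det (G x) = Num.sqrt (\det (G x)) * Num.sqrt (\det (G x)).
  by rewrite -expr2 sqr_sqrtr// ltW// dG.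
rewrite -expr2 sqrtr_sqr [ `|_|]ger0_norm ?sqrtr_ge0//; by field.
Qed.

End MatrixCalculus.

(** * Riemannian geometry in a chart *)

Section BochnerAlgebra.
Context {R : comNzRingType} {n : nat}.

Lemma sum4_swap (F : 'I_n -> 'I_n -> 'I_n -> 'I_n -> R) :
  \sum_i \sum_j \sum_k \sum_l F i j k l = \sum_k \sum_l \sum_i \sum_j F i j k l.
Proof.
rewrite pair_big/= [RHS]pair_big/=; under eq_bigr do rewrite pair_big/=.
by under [RHS]eq_bigr do rewrite pair_big/=; rewrite exchange_big.
Qed.

Lemma sum3_rev (F : 'I_n -> 'I_n -> 'I_n -> R) :
  \sum_i \sum_j \sum_k F i j k = \sum_k \sum_j \sum_i F i j k.
Proof.
under eq_bigr do rewrite exchange_big/=; rewrite exchange_big/=.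
by apply: eq_bigr => k _; rewrite exchange_big.
Qed.

(* Index form of the Bochner identity
     div (V^i nabla_i V^j) = |nabla V|^2 + V(div V) + Ric(V, V)
   for a torsion-free connection; g, dg, v, dv, ddv stand for the Christoffel
   symbols, the components of V and their partial derivatives at a point. *)
Lemma bochner_alg (v : 'I_n -> R) (dv : 'I_n -> 'I_n -> R)
    (ddv g : 'I_n -> 'I_n -> 'I_n -> R) (dg : 'I_n -> 'I_n -> 'I_n -> 'I_n -> R) :
  (forall i j k, ddv i j k = ddv j i k) ->
  (forall k i j, g k i j = g k j i) ->
  (forall l k i j, dg l k i j = dg l k j i) ->
  let S i j := dv i j + \sum_k g j i k * v k in
  let dS l i j := ddv l i j + \sum_k (g j i k * dv l k + v k * dg l j i k) in
  let ric i j := \sum_k (dg k k i j - dg j k i k) +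
     \sum_k \sum_l (g k k l * g l i j - g k j l * g l i k) in
  \sum_j \sum_i (v i * dS j i j + S i j * dv j i) +
    \sum_j \sum_k g j j k * \sum_i v i * S i k =
  \sum_i \sum_j S j i * S i j + \sum_i v i * \sum_j dS i j j +
    \sum_i \sum_k ric i k * v i * v k.
Proof.
move=> ddvC gC dgC S dS ric.
(* [A1] and [A2] gather the terms with one connection coefficient and one derivative of [v], [B]
   those with derivatives of the coefficients, [C1] and [C2] the two quadratic sums of the Ricci
   tensor. *)
pose A1 := \sum_j \sum_i \sum_k g i j k * v k * dv i j.
pose A2 := \sum_i \sum_j \sum_k v i * g j j k * dv i k.
pose C1 := \sum_i \sum_k \sum_a \sum_b g a a b * g b i k * v i * v k.
pose C2 := \sum_i \sum_k \sum_a \sum_b g a k b * g b i a * v i * v k.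
pose B := \sum_i \sum_j \sum_k v i * v k * (dg j j i k - dg i j j k).
have EX : \sum_j \sum_i (\sum_k g i j k * v k) * S i j = A1 + C2.
  transitivity (A1 + \sum_j \sum_i \sum_k \sum_l (g i j k * v k) * (g j i l * v l)).
    rewrite /A1 -big_split/=; apply: eq_bigr => j _.
    rewrite -big_split/=; apply: eq_bigr => i _.
    rewrite mulrDr mulr_suml; congr (_ + _); rewrite mulr_suml.
    by apply: eq_bigr => k _; rewrite mulr_sumr.
  congr (_ + _); rewrite sum4_swap /C2; apply: eq_bigr => k _; apply: eq_bigr => l _.
  apply: eq_bigr => j _; apply: eq_bigr => i _.
  by rewrite (gC j l i) (gC i k j); ring.
have E1 : \sum_j \sum_i S i j * dv j i = \sum_i \sum_j S j i * S i j - (A1 + C2).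
  rewrite -EX [\sum_i \sum_j S j i * S i j]exchange_big/= -sumrB.
  apply: eq_bigr => j _; rewrite -sumrB; apply: eq_bigr => i _.
  by rewrite {2}/S; ring.
have A13 : A1 = \sum_i \sum_j \sum_k v i * g j i k * dv j k.
  rewrite /A1 sum3_rev; apply: eq_bigr => i _; apply: eq_bigr => j _.
  by apply: eq_bigr => k _; rewrite (gC j k i); ring.
have E2 : \sum_j \sum_i v i * dS j i j = \sum_i v i * \sum_j dS i j j + (A1 - A2 + B).
  rewrite A13 /A2 /B -sumrB -big_split/= exchange_big/= -big_split/=.
  apply: eq_bigr => i _.
  rewrite mulr_sumr -sumrB -big_split/= -big_split/=; apply: eq_bigr => j _.
  rewrite -sumrB -big_split/= /dS (ddvC j i) !mulrDr -addrA; congr (_ + _).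
  rewrite !mulr_sumr -big_split/=; apply: eq_bigr => k _; ring.
have E3 : \sum_j \sum_k g j j k * \sum_i v i * S i k = A2 + C1.
  transitivity (\sum_j \sum_k \sum_i v i * g j j k * dv i k +
     \sum_j \sum_k \sum_i \sum_l g j j k * g k i l * v i * v l).
    rewrite -big_split/=; apply: eq_bigr => j _.
    rewrite -big_split/=; apply: eq_bigr => k _.
    rewrite mulr_sumr -big_split/=; apply: eq_bigr => i _.
    rewrite /S mulrDr mulrDr; congr (_ + _); first by ring.
    rewrite !mulr_sumr; apply: eq_bigr => l _; ring.
  congr (_ + _); last by rewrite sum4_swap.
  by rewrite /A2; under eq_bigr do rewrite exchange_big/=; rewrite exchange_big.
have E4 : \sum_i \sum_k ric i k * v i * v k = B + (C1 - C2).
  rewrite /C1 /C2 -sumrB.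
  transitivity (\sum_i \sum_k \sum_a (dg a a i k - dg k a i a) * v i * v k +
    \sum_i \sum_k \sum_a \sum_b (g a a b * g b i k - g a k b * g b i a) * v i * v k).
    rewrite -big_split/=; apply: eq_bigr => i _.
    rewrite -big_split/=; apply: eq_bigr => k _; rewrite /ric !mulrDl.
    by rewrite !mulr_suml; congr (_ + _); apply: eq_bigr => a _; rewrite !mulr_suml.
  congr (_ + _); last first.
    apply: eq_bigr => i _; rewrite -sumrB; apply: eq_bigr => k _.
    rewrite -sumrB; apply: eq_bigr => a _; rewrite -sumrB; apply: eq_bigr => b _; ring.
  transitivity (\sum_i \sum_k \sum_a v i * v k * dg a a i k -
    \sum_i \sum_k \sum_a v i * v k * dg k a i a).
    rewrite -sumrB; apply: eq_bigr => i _; rewrite -sumrB; apply: eq_bigr => k _.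
    rewrite -sumrB; apply: eq_bigr => a _; ring.
  rewrite [X in _ - X]exchange_big/= -sumrB /B; apply: eq_bigr => i _.
  rewrite [in LHS]exchange_big/= [X in _ - X]exchange_big/= -sumrB.
  apply: eq_bigr => k _; rewrite -sumrB; apply: eq_bigr => a _.
  rewrite (dgC i k a); ring.
transitivity (\sum_j \sum_i v i * dS j i j + \sum_j \sum_i S i j * dv j i
   + \sum_j \sum_k g j j k * \sum_i v i * S i k).
  congr (_ + _); rewrite -big_split/=; apply: eq_bigr => j _; by rewrite big_split.
rewrite E1 E2 E3 E4; ring.
Qed.

End BochnerAlgebra.

Section Chart.
Context {R : realType} {m : nat}.
Notation n := m.+1.
Variables (D : set 'rV[R]_n) (G : 'rV[R]_n -> 'M[R]_n).
Hypothesis oD : relopen D.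
Hypothesis sG : smooth_mx D G.
Hypothesis pG : forall x, D x -> posdef (G x).
Implicit Types (x : 'rV[R]_n) (h : 'rV[R]_n -> R).

Notation P := (fun x => invmx (G x)).
Notation chr := (christoffel D G).
Notation "'d_ i h" := (partial D i h) (at level 10, i at level 2, h at level 8).

Lemma unitG x : D x -> G x \in unitmx.
Proof. by move=> /pG; exact: posdef_unit. Qed.

Lemma symG x i j : D x -> G x i j = G x j i.
Proof. by move=> /pG[s _]; rewrite -{1}s mxE. Qed.

Lemma symP x : D x -> (P x)^T = P x.
Proof. by move=> /pG[s _]; rewrite trmx_inv s. Qed.

Lemma smoothP : smooth_mx D P.
Proof. by apply: smooth_on_invmx => // x; exact: unitG. Qed.

Lemma smooth_chr k i j : smooth_on D (chr k i j).
Proof.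
apply: smooth_onZ; apply: smooth_on_sum => l; apply: smooth_onM; first exact: smoothP.
by apply: smooth_onB; [apply: smooth_onD|]; apply: smooth_on_partial.
Qed.

Lemma dG_sym x i a b : D x -> 'd_i (fun y => G y a b) x = 'd_i (fun y => G y b a) x.
Proof. by move=> Dx; apply: partial_congr => // y Dy; exact: symG. Qed.

Lemma chrC k i j x : D x -> chr k i j x = chr k j i x.
Proof.
move=> Dx; rewrite /christoffel; congr (_ * _); apply: eq_bigr => l _; congr (_ * _).
by rewrite (dG_sym l i j Dx) [X in X - _]addrC.
Qed.

(** Indexed so that [chrmx i x *m G x] consists of the Christoffel symbols of the first kind. *)
Definition chrmx i x : 'M[R]_n := \matrix_(a, k) chr k i a x.

(* the metric is parallel *)
Lemma dmxG i x : D x -> dmx D i G x = chrmx i x *m G x + (chrmx i x *m G x)^T.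
Proof.
move=> Dx.
have low a b : (chrmx i x *m G x) a b = 2^-1 * ('d_i (fun y => G y a b) x
    + 'd_a (fun y => G y i b) x - 'd_b (fun y => G y i a) x).
  pose c : 'rV[R]_n := \row_l (2^-1 * ('d_i (fun y => G y a l) x
    + 'd_a (fun y => G y i l) x - 'd_l (fun y => G y i a) x)).
  have -> : (chrmx i x *m G x) a b = (c *m P x *m G x) 0 b.
    rewrite !mxE; apply: eq_bigr => k _; congr (_ * _); rewrite !mxE /christoffel mulr_sumr.
    apply: eq_bigr => l _; rewrite mxE -[in LHS](symP Dx) mxE; ring.
  by rewrite mulmxKV ?unitG// mxE.
apply/matrixP => a b; rewrite [RHS]mxE [X in _ + X]mxE !low mxE.
rewrite (dG_sym i b a Dx); by field.
Qed.

Lemma dmxP i x : D x -> dmx D i P x = - (P x *m chrmx i x) - ((chrmx i x)^T *m P x).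
Proof.
move=> Dx; rewrite dmx_invmx//; last by move=> y; exact: unitG.
rewrite dmxG// trmx_mul (pG Dx).1 mulmxDr mulmxDl opprD; congr (_ + _).
  by rewrite !mulmxA mulmxK// unitG.
by rewrite !mulmxA mulVmx ?unitG// mul1mx.
Qed.

(** The two summands of [dmxG] have the same trace against the inverse metric. This identifies the
    contracted connection with the logarithmic derivative of the volume density. *)
Lemma chr_trace i x : D x -> \sum_k chr k k i x = 2^-1 * \tr (P x *m dmx D i G x).
Proof.
move=> Dx; rewrite dmxG// mulmxDr linearD/=.
have -> : \tr (P x *m (chrmx i x *m G x)^T) = \tr (P x *m (chrmx i x *m G x)).
  by rewrite -mxtrace_tr trmx_mul trmxK symP// mxtrace_mulC.
rewrite mxtrace_mulC -mulmxA mulmxV ?unitG// mulmx1 /mxtrace.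
rewrite -mulr2n -[X in 2^-1 * X]mulr_natl mulKf ?pnatr_eq0//.
by apply: eq_bigr => k _; rewrite mxE chrC.
Qed.

Definition dens x : R := Num.sqrt (\det (G x)).

Lemma dens_gt0 x : D x -> 0 < dens x.
Proof. by move=> Dx; rewrite sqrtr_gt0 posdef_det//; exact: pG. Qed.

Lemma smooth_dens : smooth_on D dens.
Proof.
apply: smooth_on_sqrt; last exact: smooth_on_det.
by move=> x Dx; rewrite posdef_det//; exact: pG.
Qed.

Lemma partial_dens i x : D x -> 'd_i dens x = dens x * \sum_k chr k k i x.
Proof.
move=> Dx; rewrite chr_trace// partial_sqrt_det// => y Dy.
by rewrite posdef_det//; exact: pG.
Qed.

Definition dvg (X : 'I_n -> 'rV[R]_n -> R) x : R :=
  \sum_j 'd_j (X j) x + \sum_j \sum_k chr j j k x * X k x.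

(** Turns the covariant divergence into a coordinate divergence, the form that can be integrated by
    parts in a chart. *)
Lemma partial_dens_dvg (X : 'I_n -> 'rV[R]_n -> R) x : (forall j, smooth_on D (X j)) ->
  D x -> \sum_j 'd_j (fun y => dens y * X j y) x = dens x * dvg X x.
Proof.
move=> sX Dx; rewrite /dvg mulrDr mulr_sumr.
transitivity (\sum_j (dens x * 'd_j (X j) x + X j x * (dens x * \sum_k chr k k j x))).
  apply: eq_bigr => j _; rewrite partialM//; last exact: smooth_dens.
  by rewrite partial_dens.
rewrite big_split/=; congr (_ + _); rewrite exchange_big/= mulr_sumr.
apply: eq_bigr => j _; rewrite -mulr_suml; ring.
Qed.

Lemma dvgD X Y x : (forall j, smooth_on D (X j)) -> (forall j, smooth_on D (Y j)) ->
  D x -> dvg (fun j y => X j y + Y j y) x = dvg X x + dvg Y x.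
Proof.
move=> sX sY Dx; rewrite /dvg.
transitivity ((\sum_j 'd_j (X j) x + \sum_j 'd_j (Y j) x) +
  (\sum_j \sum_k chr j j k x * X k x + \sum_j \sum_k chr j j k x * Y k x)).
  congr (_ + _); rewrite -big_split/=; apply: eq_bigr => j _; first exact: partialD.
  by rewrite -big_split/=; apply: eq_bigr => k _; rewrite mulrDr.
by rewrite addrACA.
Qed.

Lemma dvgM h X x : smooth_on D h -> (forall j, smooth_on D (X j)) -> D x ->
  dvg (fun j y => h y * X j y) x = h x * dvg X x + \sum_j X j x * 'd_j h x.
Proof.
move=> sh sX Dx; rewrite /dvg.
transitivity (\sum_j (h x * 'd_j (X j) x + X j x * 'd_j h x) +
   h x * \sum_j \sum_k chr j j k x * X k x).
  congr (_ + _); first by apply: eq_bigr => j _; rewrite partialM.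
  rewrite mulr_sumr; apply: eq_bigr => j _; rewrite mulr_sumr; apply: eq_bigr => k _; ring.
by rewrite big_split/= -mulr_sumr mulrDr addrAC.
Qed.

(** The covariant derivative of [V]: [i] is the direction, [j] the component. *)
Definition nabla (V : 'I_n -> 'rV[R]_n -> R) (i j : 'I_n) x : R :=
  'd_i (V j) x + \sum_k chr j i k x * V k x.

Lemma smooth_nabla V i j : (forall j, smooth_on D (V j)) -> smooth_on D (nabla V i j).
Proof.
move=> sV; apply: smooth_onD; first exact: smooth_on_partial.
by apply: smooth_on_sum => k; apply: smooth_onM => //; exact: smooth_chr.
Qed.

Lemma partial_nabla V l i j x : (forall j, smooth_on D (V j)) -> D x ->
  'd_l (nabla V i j) x = 'd_l ('d_i (V j)) x +
    \sum_k (chr j i k x * 'd_l (V k) x + V k x * 'd_l (chr j i k) x).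
Proof.
move=> sV Dx; rewrite partialD//; first last.
- by apply: smooth_on_sum => k; apply: smooth_onM => //; exact: smooth_chr.
- exact: smooth_on_partial.
congr (_ + _); rewrite partial_sum//; last first.
  by move=> k; apply: smooth_onM => //; exact: smooth_chr.
by apply: eq_bigr => k _; rewrite partialM//; exact: smooth_chr.
Qed.

Lemma dvg_nabla V x : (forall j, smooth_on D (V j)) -> D x ->
  dvg V x = \sum_j nabla V j j x.
Proof. by move=> sV Dx; rewrite /dvg /nabla big_split. Qed.

(** When [V] is a gradient, the field on the left is half the gradient of its squared norm
    ([grad_inner]), and this becomes Bochner's formula. *)
Lemma bochner V x : (forall j, smooth_on D (V j)) -> D x ->
  dvg (fun j y => \sum_i V i y * nabla V i j y) x =
  \sum_i \sum_j nabla V j i x * nabla V i j x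
  + \sum_i V i x * 'd_i (fun y => \sum_j nabla V j j y) x
  + \sum_i \sum_k ricci D G x i k * V i x * V k x.
Proof.
move=> sV Dx; have sN i j : smooth_on D (nabla V i j) by exact: smooth_nabla.
have := @bochner_alg R n (fun i => V i x) (fun i j => 'd_i (V j) x)
  (fun l i j => 'd_l ('d_i (V j)) x) (fun k i j => chr k i j x)
  (fun l k i j => 'd_l (chr k i j) x).
rewrite /dvg => E.
transitivity (\sum_j \sum_i (V i x * 'd_j (nabla V i j) x + nabla V i j x * 'd_j (V i) x)
   + \sum_j \sum_k chr j j k x * (\sum_i V i x * nabla V i k x)).
  congr (_ + _); apply: eq_bigr => j _; rewrite partial_sum//; last first.
    by move=> i; exact: smooth_onM.
  by apply: eq_bigr => i _; rewrite partialM.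
transitivity (\sum_j \sum_i (V i x * ('d_j ('d_i (V j)) x +
      \sum_k (chr j i k x * 'd_j (V k) x + V k x * 'd_j (chr j i k) x))
     + nabla V i j x * 'd_j (V i) x)
   + \sum_j \sum_k chr j j k x * (\sum_i V i x * nabla V i k x)).
  congr (_ + _); apply: eq_bigr => j _; apply: eq_bigr => i _; congr (_ + _).
  by congr (_ * _); exact: partial_nabla.
apply: (etrans (E _ _ _)).
- by move=> i j k; exact: partial_comm.
- by move=> k i j; exact: chrC.
- move=> l k i j; apply: partial_congr => //; first exact: smooth_chr.
  by move=> y Dy; exact: chrC.
congr (_ + _ + _).
  apply: eq_bigr => i _; congr (_ * _); rewrite partial_sum//.
  by apply: eq_bigr => j _; apply: esym; exact: partial_nabla.
by apply: eq_bigr => i _; apply: eq_bigr => k _; rewrite mxE.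
Qed.

End Chart.

Lemma mxtrace_sq_shift (R : comNzRingType) (n : nat) (X : 'M[R]_n) (t : R) :
  \tr ((X - t%:M) *m (X - t%:M)) = \tr (X *m X) - t * \tr X *+ 2 + t ^+ 2 * n%:R.
Proof.
have -> : (X - t%:M) *m (X - t%:M) = X *m X - t *: X - t *: X + (t * t)%:M.
  rewrite mulmxBl !mulmxBr mul_mx_scalar mul_scalar_mx -scalar_mxM.
  by rewrite opprB addrA addrAC.
rewrite !raddfD/= !raddfN/= !mxtraceZ mxtrace_scalar -mulr_natr; ring.
Qed.

(** Removing from [H] its trace part leaves a symmetric [T]. With [G = B *m B^T], the matrix
    [T *m invmx G] is conjugate to the symmetric [N], so the trace of its square is a sum of
    squares; expanding gives the bound. *)
Lemma trace_sq_ge (R : realType) (n : nat) (G H : 'M[R]_n.+1) :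
  posdef G -> H^T = H ->
  \tr (H *m invmx G) ^+ 2 / n.+1%:R <= \tr (H *m invmx G *m (H *m invmx G)).
Proof.
move=> pG sH; have uG := posdef_unit pG; set P := invmx G.
have [B GB] := posdef_factor pG.
have uB : B \in unitmx.
  by move: uG; rewrite GB unitmx_mul => /andP[].
set t := \tr (H *m P) / n.+1%:R.
pose T := H - t *: G.
have sT : T^T = T by rewrite /T linearB/= linearZ/= sH pG.1.
have TP : T *m P = H *m P - t%:M.
  by rewrite /T mulmxBl -scalemxAl mulmxV// scalemx1.
have pos : 0 <= \tr (T *m P *m (T *m P)).
  pose N := invmx B *m T *m (invmx B)^T.
  have -> : \tr (T *m P *m (T *m P)) = \tr (N *m N).
    have PE : P = (invmx B)^T *m invmx B.
      have E : G *m ((invmx B)^T *m invmx B) = 1%:M.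
        by rewrite GB mulmxA -[B *m B^T *m _]mulmxA -trmx_mul mulVmx// trmx1 mulmx1 mulmxV.
      by rewrite -[RHS](mulKmx uG) E mulmx1.
    rewrite PE /N !mulmxA mxtrace_mulC !mulmxA.
    by [].
  have -> : \tr (N *m N) = \sum_i \sum_j N i j ^+ 2.
    have sN : N^T = N by rewrite /N !trmx_mul trmxK sT mulmxA.
    rewrite /mxtrace; apply: eq_bigr => i _; rewrite mxE; apply: eq_bigr => j _.
    have -> : N j i = N i j by rewrite -{1}sN mxE.
    by rewrite expr2.
  by apply: sumr_ge0 => i _; apply: sumr_ge0 => j _; exact: sqr_ge0.
rewrite TP in pos.
have E : \tr ((H *m P - t%:M) *m (H *m P - t%:M)) =
    \tr (H *m P *m (H *m P)) - \tr (H *m P) ^+ 2 / n.+1%:R.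
  rewrite mxtrace_sq_shift /t.
  have : n.+1%:R != 0 :> R by rewrite pnatr_eq0.
  by move: (n.+1%:R : R) => N N0; field.
by rewrite E subr_ge0 in pos.
Qed.

Lemma mx_entry_eq (R : comNzRingType) n (X Y Z : 'M[R]_n) (c s t : R) i k :
  c *: (X - s *: Z) = Y - t *: Z -> c * (X i k - s * Z i k) = Y i k - t * Z i k.
Proof. by move=> /matrixP/(_ i k); rewrite !mxE. Qed.

(** * Gradient, Hessian, and the divergence of the field W *)

Section Fluid.
Context {R : realType} {m : nat}.
Notation n := m.+1.
Variables (D : set 'rV[R]_n) (G : 'rV[R]_n -> 'M[R]_n).
Hypothesis oD : relopen D.
Hypothesis sG : smooth_mx D G.
Hypothesis pG : forall x, D x -> posdef (G x).
Implicit Types (x : 'rV[R]_n) (h a b : 'rV[R]_n -> R).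

Notation P := (fun x => invmx (G x)).
Notation chr := (christoffel D G).
Notation "'d_ i h" := (partial D i h) (at level 10, i at level 2, h at level 8).

Definition grad h (j : 'I_n) x : R := \sum_k invmx (G x) j k * partial D k h x.

Definition inner a b x : R := \sum_j grad a j x * partial D j b x.

Lemma smooth_grad h j : smooth_on D h -> smooth_on D (grad h j).
Proof.
move=> sh; apply: smooth_on_sum => k; apply: smooth_onM.
  exact: (smoothP sG pG).
exact: smooth_on_partial.
Qed.

Lemma smooth_inner a b : smooth_on D a -> smooth_on D b -> smooth_on D (inner a b).
Proof.
move=> sa sb; apply: smooth_on_sum => k; apply: smooth_onM; first exact: smooth_grad.
exact: smooth_on_partial.
Qed.

Lemma innerC a b x : D x -> inner a b x = inner b a x.
Proof.
move=> Dx; rewrite /inner /grad; under eq_bigr do rewrite mulr_suml.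
rewrite exchange_big/=; apply: eq_bigr => j _; rewrite mulr_suml; apply: eq_bigr => k _.
have := symP pG Dx => /matrixP/(_ j k); rewrite mxE => ->; ring.
Qed.

Lemma G_grad h x i : D x -> \sum_j G x i j * grad h j x = 'd_i h x.
Proof.
move=> Dx; pose c : 'cV[R]_n := \col_k 'd_k h x.
have -> : \sum_j G x i j * grad h j x = (G x *m (invmx (G x) *m c)) i 0.
  rewrite mxE; apply: eq_bigr => j _; congr (_ * _); rewrite mxE.
  by apply: eq_bigr => k _; rewrite mxE.
by rewrite mulmxA mulmxV ?(unitG pG)// mul1mx mxE.
Qed.

Lemma inner_quad h x : D x -> inner h h x = quad (G x) (\row_j grad h j x).
Proof.
move=> Dx; rewrite quadE /inner; apply: eq_bigr => j _.
rewrite -(G_grad h j Dx) mulr_sumr mulr_suml; apply: eq_bigr => i _.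
by rewrite !mxE (symG pG j i)//; ring.
Qed.

Lemma inner_ge0 h x : D x -> 0 <= inner h h x.
Proof. by move=> Dx; rewrite inner_quad//; apply: quad_ge0; exact: pG. Qed.

Lemma hessian_sym h x : smooth_on D h -> D x ->
  (hessian D G h x)^T = hessian D G h x.
Proof.
move=> sh Dx; apply/matrixP => i j; rewrite !mxE partial_comm//; congr (_ - _).
by apply: eq_bigr => k _; rewrite (chrC oD sG pG).
Qed.

(** Differentiating the inverse metric ([dmxP]) produces two connection terms: one cancels the
    connection term of [nabla], the other completes the Hessian. *)
Lemma nabla_grad h i j x : smooth_on D h -> D x ->
  nabla D G (grad h) i j x = (hessian D G h x *m invmx (G x)) i j.
Proof.
move=> sh Dx; rewrite /nabla.
pose c : 'rV[R]_n := \row_k 'd_k h x.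
pose dc : 'rV[R]_n := \row_k 'd_i ('d_k h) x.
pose C := chrmx D G i x.
have sP := smoothP sG pG.
have gE k : grad h k x = (c *m P x) 0 k.
  rewrite mxE /grad; apply: eq_bigr => l _; rewrite !mxE mulrC; congr (_ * _).
  by have := symP pG Dx => /matrixP/(_ l k); rewrite mxE.
have -> : \sum_k chr j i k x * grad h k x = (c *m P x *m C) 0 j.
  rewrite mxE; apply: eq_bigr => k _; rewrite gE [C k j]mxE mulrC.
  by rewrite (chrC oD sG pG).
have -> : 'd_i (grad h j) x = (dc *m P x + c *m dmx D i P x) 0 j.
  rewrite partial_sum//; last by move=> k; apply: smooth_onM => //; exact: smooth_on_partial.
  rewrite mxE !mxE -big_split/=; apply: eq_bigr => k _.
  rewrite partialM//; last exact: smooth_on_partial.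
  have -> : 'd_i (fun y => P y j k) x = 'd_i (fun y => P y k j) x.
    apply: partial_congr => // y Dy.
    by have := symP pG Dy => /matrixP/(_ k j); rewrite mxE.
  rewrite /dc /c /dmx !mxE; have := symP pG Dx => /matrixP/(_ k j); rewrite mxE => ->.
  ring.
rewrite (dmxP oD sG pG)// -/C.
have -> : (hessian D G h x *m P x) i j = ((dc - c *m C^T) *m P x) 0 j.
  rewrite !mxE; apply: eq_bigr => k _; congr (_ * _); rewrite !mxE; congr (_ - _).
  by apply: eq_bigr => l _; rewrite !mxE mulrC.
have rE (A B : 'rV[R]_n) : A 0 j + B 0 j = (A + B) 0 j by rewrite mxE.
rewrite rE; congr (fun_of_matrix _ 0 j).
rewrite mulmxBr mulmxN mulmxBl !mulmxA.
by rewrite addrA addrAC addrNK.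
Qed.

Lemma laplacian_dvg h x : smooth_on D h -> D x ->
  dvg D G (grad h) x = laplacian D G h x.
Proof.
move=> sh Dx; rewrite (dvg_nabla G)//; last by move=> j; exact: smooth_grad.
rewrite /laplacian /metric_trace mxtrace_mulC; apply: eq_bigr => j _.
exact: nabla_grad.
Qed.

Lemma partial_inner h i x : smooth_on D h -> D x ->
  'd_i (inner h h) x = 2 * \sum_k hessian D G h x i k * grad h k x.
Proof.
move=> sh Dx; rewrite partial_sum//; last first.
  by move=> j; apply: smooth_onM; [exact: smooth_grad|exact: smooth_on_partial].
transitivity (\sum_k (nabla D G (grad h) i k x * 'd_k h x) +
   \sum_k hessian D G h x i k * grad h k x).
  rewrite -big_split/=.
  transitivity (\sum_k (grad h k x * 'd_i ('d_k h) x + 'd_k h x * 'd_i (grad h k) x)).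
    by apply: eq_bigr => k _; rewrite partialM//; [exact: smooth_grad|exact: smooth_on_partial].
  (* The added difference is zero; it supplies the connection terms that turn both partial
     derivatives into covariant ones. *)
  transitivity (\sum_k ('d_k h x * 'd_i (grad h k) x + grad h k x * 'd_i ('d_k h) x) +
     (\sum_k (\sum_l chr k i l x * grad h l x) * 'd_k h x
      - \sum_k (\sum_l chr l i k x * 'd_l h x) * grad h k x)).
    rewrite [X in _ = _ + X](_ : _ = 0).
      by rewrite addr0; apply: eq_bigr => k _; rewrite addrC.
    apply/eqP; rewrite subr_eq0; apply/eqP.
    under eq_bigr do rewrite mulr_suml.
    rewrite exchange_big/=; apply: eq_bigr => k _; rewrite mulr_suml.
    by apply: eq_bigr => l _; ring.
  rewrite -sumrB -big_split/=; apply: eq_bigr => k _; rewrite /nabla mxE; ring.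
have -> : \sum_k nabla D G (grad h) i k x * 'd_k h x =
    \sum_k hessian D G h x i k * grad h k x.
  transitivity (\sum_k (\sum_l hessian D G h x i l * P x l k) * 'd_k h x).
    by apply: eq_bigr => k _; rewrite nabla_grad// mxE.
  under eq_bigr do rewrite mulr_suml.
  rewrite exchange_big/=; apply: eq_bigr => k _; rewrite /grad mulr_sumr.
  by apply: eq_bigr => l _; rewrite mulrA.
by ring.
Qed.

Lemma grad_inner h j x : smooth_on D h -> D x ->
  \sum_i grad h i x * nabla D G (grad h) i j x = 2^-1 * grad (inner h h) j x.
Proof.
move=> sh Dx.
transitivity (\sum_k P x j k * \sum_i hessian D G h x k i * grad h i x).
  under [RHS]eq_bigr do rewrite mulr_sumr.
  rewrite exchange_big/=; apply: eq_bigr => i _; rewrite nabla_grad// mxE mulr_sumr.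
  apply: eq_bigr => k _.
  have := symP pG Dx => /matrixP/(_ j k); rewrite mxE => ->.
  have := hessian_sym sh Dx => /matrixP/(_ i k); rewrite mxE => ->; ring.
rewrite /grad mulr_sumr; apply: eq_bigr => k _; rewrite partial_inner// mulrCA.
by rewrite mulKf ?pnatr_eq0//.
Qed.

Lemma dvg_congr X Y x : (forall j, smooth_on D (X j)) -> D x ->
  (forall j y, D y -> X j y = Y j y) -> dvg D G X x = dvg D G Y x.
Proof.
move=> sX Dx XY; rewrite /dvg; congr (_ + _).
  by apply: eq_bigr => j _; apply: partial_congr => // y; exact: XY.
by apply: eq_bigr => j _; apply: eq_bigr => k _; rewrite XY.
Qed.

Variables (f : 'rV[R]_n -> R) (Lambda : R).
Hypothesis sf : smooth_on D f.
Hypothesis lap : forall x, D x -> laplacian D G f x = - Lambda * f x.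
Hypothesis ric : forall x, D x -> f x *: traceless G x (ricci D G x) =
  traceless G x (hessian D G f x).

Let u := inner f f.
Let V := grad f.

Definition hess_quad x : R :=
  \sum_i \sum_k hessian D G f x i k * grad f i x * grad f k x.

(** The traceless equation contracted twice with the gradient of [f]. The factor [f] stays on the
    left: it vanishes on the boundary and cannot be divided out. *)
Lemma ric_quad x : D x ->
  f x * (\sum_i \sum_k ricci D G x i k * V i x * V k x) =
  hess_quad x + f x * (scalar_curvature D G x + Lambda) / n%:R * u x.
Proof.
move=> Dx; have E := ric Dx.
have uE : u x = \sum_i \sum_k G x i k * V i x * V k x.
  rewrite /u /inner; apply: eq_bigr => i _; rewrite -(G_grad f i Dx) mulr_sumr.
  by apply: eq_bigr => k _; rewrite /V; ring.
rewrite uE /hess_quad !mulr_sumr -big_split/=; apply: eq_bigr => i _.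
rewrite !mulr_sumr -big_split/=; apply: eq_bigr => k _.
have E2 : f x * (ricci D G x i k - scalar_curvature D G x / n%:R * G x i k) =
    hessian D G f x i k - - Lambda * f x / n%:R * G x i k.
  by rewrite -(lap Dx); exact: mx_entry_eq E.
move: E2; set r := ricci D G x i k; set hh := hessian _ _ _ _ _ _; set g := G x i k.
set sc := scalar_curvature D G x.
have n0 : n%:R != 0 :> R by rewrite pnatr_eq0.
move=> E2.
have -> : f x * (r * V i x * V k x) = (f x * (r - sc / n%:R * g)) * V i x * V k x
   + f x * sc / n%:R * g * V i x * V k x by ring.
have -> : f x * (r - sc / n%:R * g) = hh - - Lambda * f x / n%:R * g by rewrite -E2.
rewrite /V; ring.
Qed.

Lemma inner_u_f x : D x -> inner u f x = 2 * hess_quad x.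
Proof.
move=> Dx; rewrite innerC// /inner /hess_quad mulr_sumr; apply: eq_bigr => i _.
rewrite /u partial_inner// mulrCA; congr (_ * _); rewrite mulr_sumr.
by apply: eq_bigr => k _; ring.
Qed.

(** The field W of the overview, with [K] standing for k^2. *)
Definition fluid_field (beta K : R) (j : 'I_n) x : R :=
  2^-1 * f x * grad u j x - (u x + beta / 2 * f x ^+ 2 - 3 * K) * grad f j x.

Lemma smooth_fluid_field beta K j : smooth_on D (fluid_field beta K j).
Proof.
have su : smooth_on D u by exact: smooth_inner.
apply: smooth_onB; apply: smooth_onM; try exact: smooth_grad.
  exact: smooth_onZ.
apply: smooth_onB; last exact: smooth_on_cst.
apply: smooth_onD => //; apply: smooth_onZ.
by apply: smooth_on_congr (smooth_onM sf sf) => y _; rewrite expr2.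
Qed.

(** The terms [hess_quad] cancel: one comes from Ricci, one from the derivative of [f], and minus
    two from the derivative of [u] in the second coefficient. The terms in [Lambda * f * u] cancel
    as well, between the gradient of the Laplacian and the coefficient of [grad f]. *)
Lemma dvg_fluid_field beta K x : D x ->
  dvg D G (fluid_field beta K) x =
  f x * \sum_i \sum_j nabla D G V j i x * nabla D G V i j x
  + f x * u x * ((scalar_curvature D G x + Lambda) / n%:R - beta)
  + Lambda * beta / 2 * f x ^+ 3 - 3 * K * Lambda * f x.
Proof.
move=> Dx; have su : smooth_on D u by exact: smooth_inner.
have sV j : smooth_on D (V j) by exact: smooth_grad.
pose X j y := 2^-1 * grad u j y.
have sX j : smooth_on D (X j) by apply: smooth_onZ; exact: smooth_grad.
pose c y := 3 * K - u y - beta / 2 * (f y * f y).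
have sff : smooth_on D (fun y => f y * f y) by exact: smooth_onM.
have sc : smooth_on D c.
  by apply: smooth_onB; [apply: smooth_onB => //; exact: smooth_on_cst|exact: smooth_onZ].
have -> : dvg D G (fluid_field beta K) x =
    dvg D G (fun j y => f y * X j y + c y * V j y) x.
  apply: dvg_congr => //; first by move=> j; exact: smooth_fluid_field.
  by move=> j y Dy; rewrite /fluid_field /X /c /V expr2; ring.
rewrite (dvgD G oD)//; [|by move=> j; exact: smooth_onM|by move=> j; exact: smooth_onM].
rewrite (dvgM G oD (X := X))// (dvgM G oD (X := V))//.
have -> : dvg D G X x = dvg D G (fun j y => \sum_i V i y * nabla D G V i j y) x.
  by apply: dvg_congr => // j y Dy; rewrite /X -grad_inner.
rewrite (bochner oD sG pG)//.
have lapV : dvg D G V x = - Lambda * f x by rewrite laplacian_dvg// lap.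
have -> : \sum_i V i x * 'd_i (fun y => \sum_j nabla D G V j j y) x = - Lambda * u x.
  transitivity (\sum_i V i x * (- Lambda * 'd_i f x)).
    apply: eq_bigr => i _; congr (_ * _); rewrite -partialZ//.
    apply: partial_congr => //.
      by apply: smooth_on_sum => j; exact: (smooth_nabla oD sG pG).
    by move=> y Dy; rewrite -(dvg_nabla G)// laplacian_dvg// lap.
  by rewrite /u /inner mulr_sumr; apply: eq_bigr => i _; rewrite /V; ring.
have Xf : \sum_j X j x * 'd_j f x = hess_quad x.
  have := inner_u_f Dx; rewrite /inner => E.
  transitivity (2^-1 * \sum_j grad u j x * 'd_j f x).
    by rewrite mulr_sumr; apply: eq_bigr => j _; rewrite mulrA.
  by rewrite E mulKf ?pnatr_eq0.
have Vc : \sum_j V j x * 'd_j c x = - (2 * hess_quad x) - beta * f x * u x.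
  have <- : inner f u x = 2 * hess_quad x by rewrite innerC// inner_u_f.
  rewrite /inner -sumrN /u /inner mulr_sumr -sumrB; apply: eq_bigr => j _.
  have -> : 'd_j c x = - 'd_j u x - beta * f x * 'd_j f x.
    have -> : 'd_j c x = 'd_j (fun y => (3 * K + (-1) * u y) + (- (beta / 2)) * (f y * f y)) x.
      by apply: partial_congr => // y _; rewrite /c; ring.
    rewrite partialD//; [|by apply: smooth_onD; [exact: smooth_on_cst|exact: smooth_onZ]
      |exact: smooth_onZ].
    rewrite partialD//; [|exact: smooth_on_cst|exact: smooth_onZ].
    rewrite partial_cst// !partialZ// partialM//; by field.
  rewrite /V; ring.
rewrite Xf Vc lapV.
have RQ := ric_quad Dx.
rewrite !mulrDr RQ /c.
have : n%:R != 0 :> R by rewrite pnatr_eq0.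
move: (\sum_i \sum_j _) (scalar_curvature D G x) (hess_quad x) (n%:R : R) => A sc' hq N N0.
by field.
Qed.

Lemma dvg_fluid_field_ge Rmin K x : D x -> 0 <= f x -> 0 < Lambda ->
  Rmin <= scalar_curvature D G x ->
  Lambda * ((Rmin + 3 * Lambda) / (2 * n%:R)) * f x ^+ 3 - 3 * K * Lambda * f x <=
  dvg D G (fluid_field ((Rmin + Lambda) / n%:R) K) x.
Proof.
move=> Dx f0 L0 Rm; rewrite dvg_fluid_field//.
have n0 : 0 < (n%:R : R) by rewrite ltr0n.
have S2 : (Lambda * f x) ^+ 2 / n%:R <=
    \sum_i \sum_j nabla D G V j i x * nabla D G V i j x.
  have := trace_sq_ge (pG Dx) (hessian_sym sf Dx).
  rewrite mxtrace_mulC -/(metric_trace G x _) -/(laplacian D G f x) lap//.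
  rewrite mulNr sqrrN => /le_trans; apply; rewrite le_eqVlt; apply/orP; left; apply/eqP.
  rewrite /mxtrace; apply: eq_bigr => i _; rewrite mxE; apply: eq_bigr => j _.
  by rewrite mulrC /V !nabla_grad.
have u0 : 0 <= u x by exact: inner_ge0.
have h1 := ler_wpM2l f0 S2.
have h2 : 0 <= f x * u x * ((scalar_curvature D G x + Lambda) / n%:R - (Rmin + Lambda) / n%:R).
  rewrite mulr_ge0 ?mulr_ge0// -mulrBl divr_ge0 ?(ltW n0)//; lra.
set A := \sum_i _ in h1 *; set sc := scalar_curvature D G x in h2 *.
(* Origin of the constant: [Lambda ^+ 2 / n] from the Hessian and
   [Lambda * (Rmin + Lambda) / (2 * n)] from [beta] add up to it. *)
have -> : Lambda * ((Rmin + 3 * Lambda) / (2 * n%:R)) * f x ^+ 3 =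
   f x * ((Lambda * f x) ^+ 2 / n%:R) + Lambda * ((Rmin + Lambda) / n%:R) / 2 * f x ^+ 3.
  by field; rewrite gt_eqF.
have cmp (a b c d e : R) : a <= b -> 0 <= c -> a + d - e <= b + c + d - e by lra.
exact: cmp.
Qed.

End Fluid.

(** * Integration over the half-space *)

Section HalfLine.
Context {R : realType}.
Notation mu := (@lebesgue_measure R).
Notation pos := [set t : R | 0 <= t].
Implicit Types (B e t : R) (f : R -> R).

(** A restriction [f \_ pos] takes the default value [point] off [pos]. *)
Lemma pointR : (point : R) = 0.
Proof. by []. Qed.

Lemma ible_fin f : ible f -> (\int[mu]_x (f x)%:E = (int1 f)%:E)%E.
Proof. by move=> fi; rewrite /int1 /Rintegral fineK//; exact: integrable_fin_num. Qed.

Lemma even_int1_ge0 B f : ucs setT B f -> (forall t, f (- t) = f t) ->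
  (forall t, 0 <= f t) -> int1 f = 2 * int1 (f \_ pos).
Proof.
move=> fB ef f0; have fi := ucs_ible fB.
have h := ge0_symfun_integralT f0 (ucont_continuous fB.1) (fun t => esym (ef t)).
apply: EFin_inj; rewrite -ible_fin// h EFinM; congr (_ * _)%E.
rewrite -(ible_fin (ible_half fi)).
by rewrite integral_mkcond restrict_EFin.
Qed.

Lemma even_int1 B f : ucs setT B f -> (forall t, f (- t) = f t) ->
  int1 f = 2 * int1 (f \_ pos).
Proof.
move=> fB ef.
have z : ucs setT B (fun _ : R => 0 : R).
  by split => [e e0|//]; exists 1 => // x y _ _ _; rewrite subrr normr0.
pose p t := Num.max 0 (f t); pose q t := Num.max 0 (- f t).
have pB : ucs setT B p by exact: ucs_max.
have qB : ucs setT B q by apply: ucs_max => //; exact: ucsN.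
have fE : f = fun t => p t + (-1) * q t.
  apply/funext => t; rewrite /p /q mulN1r; case: (leP 0 (f t)) => h; case: (leP 0 (- f t)) => h'; lra.
have pE : int1 p = 2 * int1 (p \_ pos).
  apply: (@even_int1_ge0 B) => // t; first by rewrite /p ef.
  by rewrite /p le_max lexx.
have qE : int1 q = 2 * int1 (q \_ pos).
  apply: (@even_int1_ge0 B) => // t; first by rewrite /q ef.
  by rewrite /q le_max lexx.
have pi := ucs_ible pB; have qi := ucs_ible qB.
have fE2 : f \_ pos = fun t => (p \_ pos) t + (-1) * (q \_ pos) t.
  apply/funext => t; rewrite !patchE {1}fE; case: ifP => _ //.
  by rewrite pointR mulr0 addr0.
rewrite fE2 {1}fE !int1D//; [|exact: ible_half|by apply: ibleZ; exact: ible_half|exact: ibleZ].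
rewrite !int1Z//; last exact: ible_half.
rewrite pE qE; ring.
Qed.

(** Differentiability is available for [t > 0] only. Composition with the absolute value gives
    functions that are uniformly continuous on the whole line, and both halves contribute equally,
    whence the factor 2. *)
Lemma half_parts B (F F' : R -> R) : 0 <= B ->
  ucs pos B F -> ucs pos B F' ->
  (forall t, 0 < t -> is_derive t (1 : R) F (F' t)) ->
  int1 (fun t => F' `|t|) = - 2 * F 0.
Proof.
move=> B0 FB FB' dF.
have abs (G : R -> R) : ucs pos B G -> ucs setT B (fun t => G `|t|).
  move=> [uG sG]; split=> [e e0|t _ Bt]; last by apply: sG => /=; rewrite ?normr_id.
  have [d d0 h] := uG _ e0; exists d => // x y _ _ xy; apply: h => //=.
  exact: le_lt_trans (ler_dist_dist _ _) xy.
have aF := abs _ FB; have aF' := abs _ FB'.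
rewrite (even_int1 aF'); last by move=> t; rewrite normrN.
rewrite mulNr -mulrN; congr (_ * _).
(* The support condition is strict, so [F] is known to vanish at [B + 1] but not directly at [B]. *)
have B1 : 0 < B + 1 by lra.
have -> : int1 ((fun t => F' `|t|) \_ pos) = \int[mu]_(x in `[0, B + 1]) F' `|x|.
  rewrite /int1 [RHS]Rintegral_mkcond; congr Rintegral; apply/funext => t.
  rewrite !patchE pointR; case: ifPn => [|/negP] tp; case: ifPn => [|/negP] tq //.
    have t0 : 0 <= t by exact: set_mem tp.
    have [tB|tB] := leP t (B + 1).
      by exfalso; apply: tq; apply: mem_set; rewrite /= in_itv/= t0.
    by apply: FB'.2; rewrite /= ?normr_id ger0_norm//; lra.
  exfalso; apply: tp; apply: mem_set => /=.
  by move: (set_mem tq); rewrite /= in_itv/= => /andP[].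
have dabs t : 0 < t -> is_derive t (1 : R) (fun t => F `|t|) (F' `|t|).
  move=> t0; rewrite gtr0_norm//; apply: near_eq_is_derive (dF t t0).
  near=> s; rewrite gtr0_norm//; near: s; exact: lt_nbhsr.
rewrite /Rintegral (@continuous_FTC2 _ _ (fun t => F `|t|))//.
- rewrite normr0 ger0_norm ?(ltW B1)// -EFinB/= FB.2 ?sub0r//=; first exact: ltW.
  by rewrite ger0_norm ?(ltW B1)//; lra.
- by apply: continuous_subspaceT; exact: (ucont_continuous aF'.1).
- have cF := ucont_continuous aF.1.
  split; [|by apply: cvg_at_right_filter; exact: cF|by apply: cvg_at_left_filter; exact: cF].
  move=> t; rewrite in_itv/= => /andP[t0 _].
  by have [] := dabs t t0.
- move=> t; rewrite in_itv/= => /andP[t0 _]; rewrite derive1E.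
  by have [_ ->] := dabs t t0.
Unshelve. all: by end_near. Qed.

End HalfLine.

Section HalfSpaceIntegral.
Context {R : realType} {m : nat}.
Notation H := (@half_space R m).
Notation pos := [set t : R | 0 <= t].
Implicit Types (F : 'rV[R]_m.+1 -> R) (x : 'rV[R]_m.+1) (B e t : R).

(* The half-space integral is half the integral of the even extension. *)
Definition habs x : 'rV[R]_m.+1 := vcons `|x 0 ord0| (\row_i x 0 (lift ord0 i)).

Definition hint F : R := 2^-1 * intn (fun x => F (habs x)).

Lemma habs_vcons t (y : 'rV[R]_m) : habs (vcons t y) = vcons `|t| y.
Proof.
rewrite /habs vcons0; congr vcons.
by apply/rowP => i; rewrite mxE vconsS.
Qed.

Lemma half_habs x : H (habs x).
Proof. by apply/vcons_half. Qed.

Lemma habs_half x : H x -> habs x = x.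
Proof. by rewrite /half_space/= => x0; rewrite /habs ger0_norm// -vconsP. Qed.

Lemma habs_coord x i : habs x 0 i = if i == ord0 then `|x 0 ord0| else x 0 i.
Proof.
have [->|] := eqVneq i ord0; first by rewrite vcons0.
case: (unliftP ord0 i) => [j ->|->]; last by rewrite eqxx.
by rewrite vconsS mxE.
Qed.

Lemma norm_habs x : `|habs x| = `|x|.
Proof.
apply/eqP; rewrite eq_le; apply/andP; split; apply/normrv_le => // i.
  by rewrite habs_coord; case: ifP => _; rewrite ?normr_id coord_le_norm.
have := coord_le_norm (habs x) i; rewrite habs_coord; case: eqP => [->|_] //.
by rewrite normr_id.
Qed.

Lemma dist_habs x y : `|habs x - habs y| <= `|x - y|.
Proof.
apply/normrv_le => // i; rewrite rvD rvN !habs_coord.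
have := coord_le_norm (x - y) i; rewrite rvD rvN; case: eqP => [->|_] //.
exact/le_trans/ler_dist_dist.
Qed.

(** Extension by zero would jump at the hyperplane, whereas the reflection does not increase
    distances and keeps the integrand in the class. *)
Lemma ucs_habs B F : ucs H B F -> ucs setT B (fun x => F (habs x)).
Proof.
move=> [uF sF]; split=> [e e0|x _ Bx]; last first.
  by apply: sF; [exact: half_habs|rewrite norm_habs].
have [d d0 h] := uF _ e0; exists d => // x y _ _ xy; apply: h; try exact: half_habs.
exact: le_lt_trans (dist_habs _ _) xy.
Qed.

Lemma hintD B F G : 0 <= B -> ucs H B F -> ucs H B G ->
  hint (fun x => F x + G x) = hint F + hint G.
Proof. by move=> B0 fB gB; rewrite /hint (intnD B0 (ucs_habs fB) (ucs_habs gB)) mulrDr. Qed.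

Lemma hintZ B k F : 0 <= B -> ucs H B F -> hint (fun x => k * F x) = k * hint F.
Proof. by move=> B0 fB; rewrite /hint (intnZ k B0 (ucs_habs fB)) mulrCA. Qed.

Lemma hint_sum B (I : Type) (r : seq I) (F : I -> 'rV[R]_m.+1 -> R) : 0 <= B ->
  (forall i, ucs H B (F i)) ->
  hint (fun x => \sum_(i <- r) F i x) = \sum_(i <- r) hint (F i).
Proof.
move=> B0 fB; rewrite /hint -mulr_sumr; congr (_ * _).
by rewrite (intn_sum r B0 (fun i => ucs_habs (fB i))).
Qed.

Lemma hint_le B F G : 0 <= B -> ucs H B F -> ucs H B G ->
  (forall x, H x -> F x <= G x) -> hint F <= hint G.
Proof.
move=> B0 fB gB FG; apply: ler_wpM2l; first by rewrite invr_ge0 ler0n.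
apply: (intn_le B0 (ucs_habs fB) (ucs_habs gB)) => x; apply: FG; exact: half_habs.
Qed.

Lemma hint_ge0 F : (forall x, H x -> 0 <= F x) -> 0 <= hint F.
Proof.
move=> F0; apply: mulr_ge0; first by rewrite invr_ge0 ler0n.
by apply: intn_ge0 => x; apply: F0; exact: half_habs.
Qed.

Lemma hint_gt0 B F x0 : 0 <= B -> ucs H B F -> (forall x, H x -> 0 <= F x) ->
  H x0 -> 0 < F x0 -> 0 < hint F.
Proof.
move=> B0 fB F0 Hx0 Fx0; apply: mulr_gt0; first by rewrite invr_gt0 ltr0n.
apply: (intn_gt0 B0 (ucs_habs fB) (x0 := x0)) => [x|]; last by rewrite habs_half.
by apply: F0; exact: half_habs.
Qed.

Lemma eq_hint F G : (forall x, H x -> F x = G x) -> hint F = hint G.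
Proof.
move=> FG; congr (_ * intn _); apply/funext => x; apply: FG; exact: half_habs.
Qed.

Lemma hint_int1 B F : 0 <= B -> ucs H B F ->
  hint F = int1 ((fun t => intn (fun y => F (vcons t y))) \_ pos) /\
  ible ((fun t => intn (fun y => F (vcons t y))) \_ pos).
Proof.
move=> B0 fB; pose p t := intn (fun y => F (vcons t y)); rewrite -/p /hint (intnS B0 (ucs_habs fB)).
have -> : (fun t => intn (fun y => F (habs (vcons t y)))) = (fun t => p `|t|).
  by apply/funext => t; congr intn; apply/funext => y; rewrite habs_vcons.
have pB : ucs setT B (fun t => p `|t|).
  have := intn_slice_ucs B0 (ucs_habs fB); congr ucs; apply/funext => t.
  by congr intn; apply/funext => y; rewrite habs_vcons.
have pE : (fun t => p `|t|) \_ pos = p \_ pos.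
  apply/funext => t; rewrite !patchE; case: ifPn => // /set_mem/= t0.
  by rewrite ger0_norm.
split; last by rewrite -pE; apply: ible_half; exact: ucs_ible pB.
rewrite (even_int1 pB); last by move=> t; rewrite normrN.
by rewrite pE; move: (int1 _) => v; field.
Qed.

Lemma integral_rV_hint B F : 0 <= B -> ucs H B F -> (forall x, ~ H x -> F x = 0) ->
  (integral_rV (fun x => (F x)%:E) = (hint F)%:E)%E.
Proof.
move=> B0 fB F0; have [-> hi] := hint_int1 B0 fB.
rewrite -(ible_fin hi)/=; apply: eq_integral => t _; rewrite patchE.
case: ifPn => [/set_mem/= t0|/negP tn].
  apply: (integral_rVE B0); apply: (ucs_slice fB) => y; exact/vcons_half.
have tn' : ~ (0 <= t) by move=> t0; apply: tn; exact: mem_set.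
rewrite -[RHS](@integral_rV0 R m); congr integral_rV; apply/funext => y.
by congr EFin; apply: F0 => /vcons_half.
Qed.

Lemma hint_intn B F : 0 <= B -> ucs setT B F -> (forall x, ~ H x -> F x = 0) ->
  hint F = intn F.
Proof.
move=> B0 fB F0; have fB' : ucs H B F by exact: ucsW fB.
have [-> _] := hint_int1 B0 fB'; rewrite (intnS B0 fB); congr int1.
apply/funext => t; rewrite patchE; case: ifPn => // /negP tn.
have tn' : ~ (0 <= t) by move=> t0; apply: tn; exact: mem_set.
rewrite pointR -[LHS](@intn0 R m); congr intn; apply/funext => y.
by rewrite F0// => /vcons_half.
Qed.

(** Bounds the contribution of a layer of width [d] along the hyperplane, as needed when a cut-off
    removes that layer. *)
Lemma hint_small B F (d e : R) : 0 <= B -> 0 <= d -> 0 <= e -> ucs H B F ->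
  (forall x, H x -> `|F x| <= e) -> (forall x, H x -> d < x 0 ord0 -> F x = 0) ->
  `|hint F| <= d * ((2 * B) ^+ m * e).
Proof.
move=> B0 d0 e0 fB Fe Fd; have aB := ucs_habs fB.
rewrite /hint (intnS B0 aB) normrM ger0_norm ?invr_ge0 ?ler0n//.
have sB := intn_slice_ucs B0 aB.
have -> : d * ((2 * B) ^+ m * e) = 2^-1 * (2 * d * ((2 * B) ^+ m * e)).
  by rewrite -mulrA mulKf// pnatr_eq0.
apply: ler_wpM2l; first by rewrite invr_ge0 ler0n.
apply: (@int1_norm_le _ _ d) => //.
- exact: ucs_ible sB.
- move=> t _ dt; rewrite -[RHS](@intn0 R m); congr intn; apply/funext => y.
  by apply: Fd; [exact: half_habs|rewrite habs_vcons vcons0].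
- move=> t; rewrite -[X in `|X|]subr0 -(@intn0 R m).
  have H1 : ucs setT B (fun y => F (habs (vcons t y))) by exact: ucs_slice aB _.
  apply: (intn_dist B0 H1).
    split=> [e' e'0|//]; exists 1 => // x y _ _ _; by rewrite subrr normr0.
  by move=> y; rewrite subr0; apply: Fe; exact: half_habs.
Qed.

End HalfSpaceIntegral.

(** * Integration by parts in the half-space *)

Section Parts.
Context {R : realType}.

(** Difference quotients of [E] have integral zero by translation invariance, and by the mean value
    theorem they are uniformly close to [E']. *)
Lemma intn_derive0 n B (E E' : 'rV[R]_n -> R) i : 0 <= B ->
  ucs setT B E -> ucs setT B E' ->
  (forall x, is_derive x (ed i) E (E' x)) -> intn E' = 0.
Proof.
move=> B0 EB EB' dE; apply: (@eq0_of_small _ _ ((2 * (B + 1)) ^+ n)).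
  by apply: exprn_ge0; lra.
move=> e e0; have [d d0 hd] := EB'.1 _ e0.
(* The bound 1 keeps the translate supported in radius [B + 1]; the other puts the mean value point
   within the reach of [hd]. *)
pose h : R := Num.min 1 (d / 2).
have h0 : 0 < h by rewrite lt_min ltr01 divr_gt0.
have h1 : h <= 1 by rewrite ge_min lexx.
have hd2 : h < d.
  have : h <= d / 2 by rewrite ge_min lexx orbT.
  lra.
have nh : `|h *: ed i| = h by rewrite norm_ed ger0_norm// ltW.
have B1 : 0 <= B + 1 by lra.
have sB : ucs setT (B + 1) (fun x => E (x + h *: ed i)).
  by apply: ucsW (ucs_shift (h *: ed i) EB) => //; rewrite nh; lra.
have EB1 : ucs setT (B + 1) E by apply: ucsW EB => //; lra.
have EB1' : ucs setT (B + 1) E' by apply: ucsW EB' => //; lra.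
pose Q x := h^-1 * (E (x + h *: ed i) - E x).
have QB : ucs setT (B + 1) Q by apply: ucsZ; exact: ucsB.
have Q0 : intn Q = 0.
  rewrite /Q (intnZ h^-1 B1); last exact: ucsB.
  have -> : (fun x => E (x + h *: ed i) - E x) = (fun x => E (x + h *: ed i) + (-1) * E x).
    by apply/funext => x; rewrite mulN1r.
  rewrite (intnD B1 sB); last exact: ucsZ.
  by rewrite (intnZ (-1) B1 EB1) (intn_shift (h *: ed i) B0 EB) mulN1r subrr mulr0.
rewrite -[intn E']subr0 -Q0; apply: (intn_dist B1 EB1' QB) => x.
have [t [th _ tE]] : exists t : R, [/\ `|t| <= `|h|, 0 <= t * h &
    E (x + h *: ed i) - E x = h * 'D_(ed i) E (x + t *: ed i)].
  by apply: mvt_line => t _ _; case: (dE (x + t *: ed i)).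
have QE : Q x = E' (x + t *: ed i).
  rewrite /Q tE mulKf ?gt_eqF//.
  by case: (dE (x + t *: ed i)) => _ ->.
rewrite QE; apply/ltW/hd => //.
rewrite opprD addNKr normrN norm_ed; apply: le_lt_trans th _.
by rewrite ger0_norm// ltW.
Qed.

Lemma vcons_ucs2 n B (E : 'rV[R]_n.+1 -> R) : ucs setT B E ->
  ucs2 B (fun t y => E (vcons t y)).
Proof.
move=> [uE sE]; split=> [e e0|t y ty]; last first.
  apply: sE => //; case: ty => h; apply: lt_le_trans h _; [exact: vcons_norml|exact: vcons_normr].
have [d d0 h] := uE _ e0; exists d => // t t' y y' tt yy; apply: h => //.
by rewrite vconsB vcons_norm_lt.
Qed.

Context {m : nat}.
Notation H := (@half_space R m).
Notation pos := [set t : R | 0 <= t].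
Implicit Types (F : 'rV[R]_m.+1 -> R) (x : 'rV[R]_m.+1).

Lemma closed_half : closed H.
Proof.
rewrite (_ : H = (fun x : 'rV[R]_m.+1 => x 0 ord0) @^-1` pos)//.
apply: preimage_closed; last exact: closed_ge.
by move=> x _; exact: coord_continuous.
Qed.

Lemma smooth_cont_half F x e : smooth_on H F -> H x -> 0 < e ->
  exists2 d : R, 0 < d & forall y, H y -> `|x - y| < d -> `|F x - F y| < e.
Proof.
move=> sF Hx e0; have [U [G [oU Ux kG FG]]] := smooth_onP sF Hx.
have cG : {for x, continuous G} by exact: (Ck_cont (kG 0%N)).
have : nbhs x (U `&` [set y | `|G x - G y| < e]).
  by apply: filterI; [exact: open_nbhs1|exact: cont_near].
move=> /nbhs_ballP[d d0 h]; exists d => // y Hy xy.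
have [Uy] : (U `&` [set y | `|G x - G y| < e]) y by apply: h; rewrite -ball_normE.
by rewrite /= !FG.
Qed.

Lemma smooth_ucs B F : 0 <= B -> smooth_on H F -> supp H B F -> ucs H B F.
Proof.
move=> B0 sF suF; split=> //.
apply: (@compact_ucont _ _ _ H ([set x | `|x| <= B] `&` H)).
- apply: compact_closedI; [exact: compact_ball|exact: closed_half].
- by move=> x _ Hx e e0; exact: smooth_cont_half.
- by move=> x [].
- move=> x Hx Cx; apply: suF => //; rewrite ltNge; apply/negP => xB.
  by apply: Cx.
Qed.

Lemma relopen_H : relopen H.
Proof. by exists setT; [exact: openT|rewrite setTI]. Qed.

Lemma is_derive_interior F x i : smooth_on H F -> 0 < x 0 ord0 ->
  is_derive x (ed i) F (partial H i F x).
Proof.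
move=> sF x0; have Hx : H x by exact: ltW.
have [U [G [oU Ux kG FG]]] := smooth_onP sF Hx.
have sx : smooth_ext H F x U G by split.
rewrite (smooth_ext_partial i relopen_H sx Ux Hx).
have dG : derivable G x (ed i) by exact: (Ck_derivable (i := i) (kG 1%N) Ux).
apply: (@near_eq_is_derive _ _ _ G); last exact: derivableP.
have nH := relopen_interior relopen_H Hx x0.
have nU := open_nbhs1 oU Ux.
have : nbhs x (U `&` H) by apply: filterI.
by apply: filterS => y [Uy Hy]; rewrite FG.
Qed.

Lemma habsD x t (a : 'I_m) :
  habs (x + t *: ed (lift ord0 a)) = habs x + t *: ed (lift ord0 a).
Proof.
apply/rowP => i; rewrite habs_coord [RHS]rvD habs_coord !rvD rvZ edE.
have [->|//] := eqVneq i ord0.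
by rewrite !rvZ !edE (negbTE (neq_lift ord0 a)) mulr0 !addr0.
Qed.

(** Tangential shifts commute with the reflection, so the tangential derivatives of the even
    extension are two-sided even on the hyperplane. *)
Lemma is_derive_habs F x (a : 'I_m) : smooth_on H F ->
  is_derive x (ed (lift ord0 a)) (fun y => F (habs y))
    (partial H (lift ord0 a) F (habs x)).
Proof.
move=> sF; apply: cvg_derive.
have := partial_cvg (i := lift ord0 a) relopen_H sF (half_habs x).
have -> : [set t : R | H (habs x + t *: ed (lift ord0 a))] = setT.
  by apply/seteqP; split => // t _; rewrite /= -habsD; exact: half_habs.
move=> h.
have -> : (fun t : R => t^-1 * (F (habs (x + t *: ed (lift ord0 a))) - F (habs x))) =
   (fun t => t^-1 * (F (habs x + t *: ed (lift ord0 a)) - F (habs x))).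
  by apply/funext => t; rewrite habsD.
by move: h; rewrite withinET.
Qed.

Lemma partial_supp B F i : smooth_on H F -> supp H B F -> supp H B (partial H i F).
Proof.
move=> sF suF x Hx Bx; pose O := [set y : 'rV[R]_m.+1 | B < `|y|].
have oO : open O.
  rewrite (_ : O = (fun y => `|y|) @^-1` [set t | B < t])//.
  apply: open_comp; last exact: open_gt.
  by move=> y _; exact: norm_continuous.
have h := @partial_ext _ _ H O F (fun=> 0) x i relopen_H Hx oO Bx.
rewrite (h _ _).2 ?derive_cst//.
by move=> y Oy Hy; rewrite suF.
Qed.

Lemma hint_partial_lift B F (a : 'I_m) : 0 <= B -> smooth_on H F -> supp H B F ->
  hint (partial H (lift ord0 a) F) = 0.
Proof.
move=> B0 sF suF; rewrite /hint.
have -> : intn (fun x => partial H (lift ord0 a) F (habs x)) = 0; last by rewrite mulr0.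
apply: (@intn_derive0 _ B (fun x => F (habs x)) _ (lift ord0 a)) => //.
- by apply: ucs_habs; exact: smooth_ucs.
- apply: (@ucs_habs _ _ _ (partial H (lift ord0 a) F)); apply: smooth_ucs => //.
    by apply: smooth_on_partial => //; exact: relopen_H.
  exact: partial_supp.
- by move=> x; exact: is_derive_habs.
Qed.

Lemma vcons_line t (y : 'rV[R]_m) : vcons t y = vcons 0 y + t *: ed ord0.
Proof.
apply/rowP => i; rewrite rvD rvZ edE.
case: (unliftP ord0 i) => [j ->|->]; first by rewrite !vconsS mulr0 addr0.
by rewrite !vcons0 mulr1 add0r.
Qed.

(** Exchanging the integrals puts the normal variable innermost, where [half_parts] leaves the
    boundary value. *)
Lemma hint_partial0 B F : 0 <= B -> smooth_on H F -> supp H B F ->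
  hint (partial H ord0 F) = - intn (fun y => F (vcons 0 y)).
Proof.
move=> B0 sF suF; have FB := smooth_ucs B0 sF suF.
have sP : smooth_on H (partial H ord0 F).
  by apply: smooth_on_partial => //; exact: relopen_H.
have PB := smooth_ucs B0 sP (partial_supp ord0 sF suF).
rewrite /hint (intnS B0 (ucs_habs PB)) (swap1 B0 (vcons_ucs2 (ucs_habs PB))).
have sl G : ucs H B G -> forall y, ucs pos B (fun t => G (vcons t y)).
  move=> [uG sG] y; split=> [e e0|t t0 Bt].
    have [d d0 h] := uG _ e0; exists d => // s t s0 t0 st; apply: h; try exact/vcons_half.
    by rewrite vconsB subrr vcons_norm_lt// normr0.
  by apply: sG; [exact/vcons_half|apply: lt_le_trans Bt (vcons_norml _ _)].
have -> : (fun y : 'rV[R]_m => int1 (fun t => partial H ord0 F (habs (vcons t y)))) =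
    (fun y => (- 2) * F (vcons 0 y)).
  apply/funext => y; under [X in int1 X]eq_fun do rewrite habs_vcons.
  apply: (@half_parts _ B (fun t => F (vcons t y)) (fun t => partial H ord0 F (vcons t y))) => //.
  - exact: sl.
  - exact: sl.
  - move=> t t0.
    have := @is_derive_interior F (vcons t y) ord0 sF; rewrite vcons0 => /(_ t0)[d1 d2].
    have := @line_is_derive _ _ F (vcons 0 y) (ed ord0) t; rewrite -vcons_line d2 => /(_ d1).
    by under [X in is_derive _ _ X _]eq_fun do rewrite -vcons_line.
have F0 : ucs setT B (fun y : 'rV[R]_m => F (vcons 0 y)).
  apply: (ucs_slice FB) => y; exact/vcons_half.
by rewrite (intnZ _ B0 F0) mulrA mulrN mulVf ?pnatr_eq0// mulN1r.
Qed.

End Parts.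

(** * Charts *)

Section ExtensionByZero.
Context {R : realType} {m : nat}.
Notation H := (@half_space R m).
Implicit Types (D K : set 'rV[R]_m.+1) (F : 'rV[R]_m.+1 -> R) (x : 'rV[R]_m.+1).

Definition ext0 D F x : R := \1_D x * F x.

Lemma ext0_in D F x : D x -> ext0 D F x = F x.
Proof. by move=> Dx; rewrite /ext0 indicE mem_set// mul1r. Qed.

Lemma ext0_out D F x : ~ D x -> ext0 D F x = 0.
Proof. by move=> Dx; rewrite /ext0 indicE memNset// mul0r. Qed.

Lemma ext0_off D K F x : (forall y, D y -> ~ K y -> F y = 0) -> ~ K x -> ext0 D F x = 0.
Proof.
move=> FK Kx; have [Dx|Dx] := pselect (D x); last exact: ext0_out.
by rewrite ext0_in// FK.
Qed.

Lemma relopenP D : (forall x, D x -> H x) ->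
  (forall x, D x -> exists2 r : R, 0 < r & forall y, `|x - y| < r -> H y -> D y) ->
  relopen D.
Proof.
move=> DH Dr; exists ([set x | H x -> D x]°); first exact: open_interior.
apply/seteqP; split=> x.
  move=> Dx; split; last exact: DH.
  have [r r0 h] := Dr x Dx; apply/nbhs_ballP; exists r => // y.
  by rewrite -ball_normE => xy; exact: h.
by move=> [/interior_subset h Hx]; exact: h.
Qed.

Lemma openC_compact K : compact K -> open (~` K).
Proof. by move=> cK; apply: closed_openC; apply: compact_closed => //; exact: norm_hausdorff. Qed.

(** Compactness of [K] settles the frontier of [D]: its complement is open, and there the extension
    is zero. *)
Lemma smooth_ext0 D K F : relopen D -> compact K -> K `<=` D -> smooth_on D F ->
  (forall x, D x -> ~ K x -> F x = 0) -> smooth_on H (ext0 D F).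
Proof.
move=> [V oV DE] cK KD sF FK; apply: smooth_onI => x Hx.
have [Dx|Dx] := pselect (D x); last first.
  exists (~` K), (fun=> 0); split; [exact: openC_compact| |by move=> k; exact: Ck_cst|].
    by move=> Kx; apply: Dx; exact: KD.
  by move=> y Ky _; rewrite (ext0_off FK).
have [U [G [oU Ux kG FG]]] := smooth_onP sF Dx.
exists (U `&` V), G; split.
- exact: openI.
- by split=> //; move: Dx; rewrite DE => -[].
- by move=> k; apply: Ck_sub (kG k) => y [].
- move=> y [Uy Vy] Hy; have Dy : D y by rewrite DE.
  by rewrite ext0_in// FG.
Qed.

Lemma partial_off D K F i x : relopen D -> compact K -> D x -> ~ K x ->
  (forall x, D x -> ~ K x -> F x = 0) -> partial D i F x = 0.
Proof.
move=> oD cK Dx Kx FK.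
have h := @partial_ext _ _ D (~` K) F (fun=> 0) x i oD Dx (openC_compact cK) Kx.
rewrite (h _ _).2 ?derive_cst//.
by move=> y Ky Dy; rewrite FK.
Qed.

Lemma partial_ext0 D K F i x : relopen D -> compact K -> K `<=` D -> smooth_on D F ->
  (forall x, D x -> ~ K x -> F x = 0) -> H x ->
  partial H i (ext0 D F) x = ext0 D (partial D i F) x.
Proof.
move=> oD cK KD sF FK Hx; have sE := smooth_ext0 oD cK KD sF FK.
have [Dx|Dx] := pselect (D x); last first.
  rewrite ext0_out//; apply: (partial_off _ relopen_H cK) => //.
    by move=> Kx; apply: Dx; exact: KD.
  by move=> y _ Ky; rewrite (ext0_off FK).
rewrite ext0_in// -(@partial_sub _ _ H D)//; [|exact: relopen_H|by move=> y; exact: relopen_half].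
apply/esym/partial_congr => // y Dy.
by rewrite ext0_in.
Qed.

Lemma compact_norm_bound n (K : set 'rV[R]_n) : compact K ->
  exists2 B : R, 0 <= B & forall x : 'rV[R]_n, K x -> `|x| <= B.
Proof.
move=> cK.
have [B B0 h] := @compact_bound R _ K (fun x : 'rV[R]_n => `|x|) cK (fun (x : 'rV[R]_n) _ => @norm_continuous _ _ x).
by exists B => // z Kz; have := h _ Kz; rewrite normr_id.
Qed.

Lemma compact_ext0_ucs K : compact K -> exists2 B : R, 0 <= B &
  forall D F, relopen D -> K `<=` D ->
  (forall x, D x -> forall e, 0 < e -> exists2 d : R, 0 < d &
     forall y, D y -> `|x - y| < d -> `|F x - F y| < e) ->
  (forall x, D x -> ~ K x -> F x = 0) -> ucs H B (ext0 D F).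
Proof.
move=> cK; have [B B0 KB] := compact_norm_bound cK.
exists B => // D F oD KD cF FK; split; last first.
  move=> x _ Bx; apply: (ext0_off FK) => Kx.
  by have := KB _ Kx; rewrite leNgt Bx.
apply: (@compact_ucont _ _ _ H K) => //.
- move=> x Kx Hx e e0; have Dx := KD _ Kx.
  have [d d0 h] := cF _ Dx _ e0.
  have [r r0 hr] := relopen_nbhs oD Dx.
  exists (Num.min d r); first by rewrite lt_min d0.
  move=> y Hy; rewrite lt_min => /andP[xd xr].
  have Dy : D y by exact: hr.
  by rewrite !ext0_in//; exact: h.
- by move=> x Kx; apply: (relopen_half oD); exact: KD.
- by move=> x _ Kx; exact: (ext0_off FK).
Qed.

End ExtensionByZero.

Section Charts.
Context {R : realType} {m : nat} {M : topologicalType}.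
Notation H := (@half_space R m).
Notation chart := (chart R m M).
Implicit Types (c : chart) (p q : M) (x y : 'rV[R]_m.+1).

Lemma cinvK c p : is_chart c -> cdom c p -> cinv c (cmap c p) = p.
Proof. by move=> [_ _ h _ _]; exact: h. Qed.

Lemma cimg_cmap c p : cdom c p -> cimg c (cmap c p).
Proof. by move=> cp; exists p. Qed.

Lemma cdom_cinv c x : is_chart c -> cimg c x -> cdom c (cinv c x).
Proof. by move=> cc [p cp <-]; rewrite cinvK. Qed.

Lemma cmapK c x : is_chart c -> cimg c x -> cmap c (cinv c x) = x.
Proof. by move=> cc [p cp <-]; rewrite cinvK. Qed.

Lemma relopen_cimg c : is_chart c -> relopen (cimg c).
Proof. by move=> [_ [U oU UE] _ _ _]; exists U. Qed.

Lemma cimg_half c x : is_chart c -> cimg c x -> H x.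
Proof. by move=> cc; exact: relopen_half (relopen_cimg cc). Qed.

Lemma cmap_continuous c p : is_chart c -> cdom c p -> {for p, continuous (cmap c)}.
Proof.
move=> [oc _ _ cm _] cp.
have ci : {in cdom c, continuous (cmap c)} by rewrite -continuous_open_subspace.
by apply: ci; exact: mem_set.
Qed.

Lemma cinv_open c (Q : set M) x : is_chart c -> open Q -> cimg c x -> Q (cinv c x) ->
  exists2 r : R, 0 < r & forall y, `|x - y| < r -> H y -> cimg c y /\ Q (cinv c y).
Proof.
move=> cc oQ cx Qx; have [_ _ _ _ ci] := cc.
have /(_ x cx) h := (iffLR (subspace_continuousP _ _)) ci.
have /nbhs_ballP[r r0 hr] : nbhs x [set y | cimg c y -> Q (cinv c y)].
  exact: (h Q (open_nbhs_nbhs (conj oQ Qx))).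
have [r' r'0 hr'] := relopen_nbhs (relopen_cimg cc) cx.
exists (Num.min r r'); first by rewrite lt_min r0.
move=> y; rewrite lt_min => /andP[xy xy'] Hy; have cy := hr' y xy' Hy.
by split=> //; apply: (hr y) => //; rewrite -ball_normE.
Qed.

Lemma cmap_open c (U : set 'rV[R]_m.+1) p : is_chart c -> open U -> cdom c p ->
  U (cmap c p) -> exists2 Q : set M, open Q & Q p /\ forall q, Q q -> cdom c q /\ U (cmap c q).
Proof.
move=> cc oU cp Up; have [oc _ _ _ _] := cc.
have nU : nbhs p (cmap c @^-1` U) by apply: (cmap_continuous cc cp); exact: open_nbhs1.
have nc : nbhs p (cdom c) by exact: open_nbhs_nbhs.
exists (cdom c `&` cmap c @^-1` U)°; first exact: open_interior.
split; first exact: filterI.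
by move=> q /interior_subset[].
Qed.

Lemma relopen_pre c (Q : set M) : is_chart c -> open Q ->
  relopen [set x | cimg c x /\ Q (cinv c x)].
Proof.
move=> cc oQ; apply: relopenP => [x [cx _]|x [cx Qx]]; first exact: cimg_half cx.
by have [r r0 h] := cinv_open cc oQ cx Qx; exists r.
Qed.

Lemma overlapE c c' : is_chart c ->
  overlap c c' = [set x | cimg c x /\ cdom c' (cinv c x)].
Proof.
move=> cc; apply/seteqP; split=> x.
  by move=> [p [cp c'p] <-]; split; [exists p|rewrite cinvK].
move=> [cx c'x]; exists (cinv c x); last exact: cmapK.
by split=> //; exact: cdom_cinv.
Qed.

Lemma relopen_overlap c c' : is_chart c -> is_chart c' -> relopen (overlap c c').
Proof.
move=> cc [oc' _ _ _ _]; rewrite overlapE//.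
exact: relopen_pre.
Qed.

Definition trans c c' x : 'rV[R]_m.+1 := cmap c' (cinv c x).

Lemma trans_overlap c c' x : is_chart c -> is_chart c' -> overlap c c' x ->
  overlap c' c (trans c c' x).
Proof. by move=> cc cc' [p [cp c'p] <-]; exists p => //; rewrite /trans cinvK. Qed.

Lemma transK c c' x : is_chart c -> is_chart c' -> overlap c c' x ->
  trans c' c (trans c c' x) = x.
Proof. by move=> cc cc' [p [cp c'p] <-]; rewrite /trans !cinvK. Qed.

Lemma cinv_trans c c' x : is_chart c -> is_chart c' -> overlap c c' x ->
  cinv c' (trans c c' x) = cinv c x.
Proof. by move=> cc cc' [p [cp c'p] <-]; rewrite /trans !cinvK. Qed.

Lemma overlap_cimg c c' x : overlap c c' x -> cimg c x.
Proof. by move=> [p [cp _] <-]; exists p. Qed.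

Lemma overlap_cimgr c c' x : is_chart c -> overlap c c' x -> cimg c' (trans c c' x).
Proof. by move=> cc [p [cp c'p] <-]; exists p => //; rewrite /trans cinvK. Qed.

Lemma smooth_continuous (D : set 'rV[R]_m.+1) F x : relopen D -> smooth_on D F ->
  D x -> 0 < x 0 ord0 -> {for x, continuous F}.
Proof.
move=> oD sF Dx x0; have [U [G [oU Ux kG FG]]] := smooth_onP sF Dx.
have n1 : nbhs x (U `&` D).
  by apply: filterI; [exact: open_nbhs1|exact: relopen_interior].
apply: (@continuous_near_eq _ _ _ G); last exact: (Ck_cont (kG 0%N)).
by apply: filterS n1 => y [Uy Dy]; rewrite /= FG.
Qed.

Lemma smooth_rel_cont (D : set 'rV[R]_m.+1) F x e : smooth_on D F -> D x -> 0 < e ->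
  exists2 d : R, 0 < d & forall y, D y -> `|x - y| < d -> `|F x - F y| < e.
Proof.
move=> sF Dx e0; have [U [G [oU Ux kG FG]]] := smooth_onP sF Dx.
have cG : {for x, continuous G} by exact: (Ck_cont (kG 0%N)).
have : nbhs x (U `&` [set y | `|G x - G y| < e]).
  by apply: filterI; [exact: open_nbhs1|exact: cont_near].
move=> /nbhs_ballP[d d0 h]; exists d => // y Dy xy.
have [Uy] : (U `&` [set y | `|G x - G y| < e]) y by apply: h; rewrite -ball_normE.
by rewrite /= !FG.
Qed.

Lemma cinv_rel_cont c (h : M -> R) x e : is_chart c -> continuous h -> cimg c x -> 0 < e ->
  exists2 d : R, 0 < d &
    forall y, cimg c y -> `|x - y| < d -> `|h (cinv c x) - h (cinv c y)| < e.
Proof.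
move=> cc ch cx e0.
have n1 : nbhs (cinv c x) [set q | `|h (cinv c x) - h q| < e] by exact: (cont_near (ch (cinv c x)) e0).
have [r r0 hr] := cinv_open cc (@open_interior _ _) cx n1.
exists r => // y cy xy; have [_ h1] := hr y xy (cimg_half cc cy).
exact: (interior_subset h1).
Qed.

End Charts.

Section RelativeContinuity.
Context {R : realType} {n : nat}.

Lemma rel_contM (D : set 'rV[R]_n) (F G : 'rV[R]_n -> R) x :
  (forall e, 0 < e -> exists2 d : R, 0 < d & forall y, D y -> `|x - y| < d -> `|F x - F y| < e) ->
  (forall e, 0 < e -> exists2 d : R, 0 < d & forall y, D y -> `|x - y| < d -> `|G x - G y| < e) ->
  forall e, 0 < e -> exists2 d : R, 0 < d &
    forall y, D y -> `|x - y| < d -> `|F x * G x - F y * G y| < e.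
Proof.
move=> cF cG e e0.
pose k := `|F x| + `|G x| + 1.
have k1 : 1 <= k by rewrite /k lerDr addr_ge0.
have k0 : 0 < k by lra.
pose e1 := Num.min 1 (e / (2 * k)).
have e10 : 0 < e1 by rewrite lt_min ltr01 divr_gt0// mulr_gt0.
have [d1 d10 h1] := cF _ e10; have [d2 d20 h2] := cG _ e10.
exists (Num.min d1 d2); first by rewrite lt_min d10.
move=> y Dy; rewrite lt_min => /andP[xy1 xy2].
have A := h1 y Dy xy1; have B := h2 y Dy xy2.
have -> : F x * G x - F y * G y = (F x - F y) * G x + (G x - G y) * F x
   - (F x - F y) * (G x - G y) by ring.
have e11 : e1 <= 1 by rewrite ge_min lexx.
have e1k : e1 * (2 * k) <= e.
  by rewrite -ler_pdivlMr ?mulr_gt0// ge_min lexx orbT.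
apply: (@le_lt_trans _ _ (e1 * k)).
  apply: le_trans (ler_normB _ _) _; rewrite normrM.
  have A' := ltW A; have B' := ltW B.
  have : `|(F x - F y) * G x + (G x - G y) * F x| <= e1 * `|G x| + e1 * `|F x|.
    by apply: le_trans (ler_normD _ _) _; rewrite !normrM lerD// ler_wpM2r.
  have : `|F x - F y| * `|G x - G y| <= e1 * 1.
    by apply: ler_pM => //; exact: le_trans e11.
  rewrite /k; lra.
have : 0 < e1 * k by rewrite mulr_gt0.
lra.
Qed.

End RelativeContinuity.

(** * Estimates for quadratic forms *)

Section MetricComparison.
Context {R : realType}.

Lemma quadD n (G : 'M[R]_n) (a b : 'rV[R]_n) : G^T = G ->
  quad G (a + b) = quad G a + 2 * (a *m G *m b^T) 0 0 + quad G b.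
Proof.
move=> sG; rewrite /quad linearD/= !mulmxDl !mulmxDr !mx00D.
have -> : (b *m G *m a^T) 0 0 = (a *m G *m b^T) 0 0.
  by rewrite -[in LHS](trmxK (b *m G *m a^T)) mxE !trmx_mul trmxK sG mulmxA.
ring.
Qed.

(** Young's inequality: positivity of the form at [d *: a + b] bounds the cross term from below. *)
Lemma quad_perturb n (G : 'M[R]_n) (a b : 'rV[R]_n) (d : R) : posdef G -> 0 < d < 1 ->
  (1 - d) * quad G a - (d^-1 - 1) * quad G b <= quad G (a + b).
Proof.
move=> pG /andP[d0 d1]; have := quad_ge0 (d *: a + b) pG.
rewrite !quadD ?pG.1//; set ab := (a *m G *m b^T) 0 0.
have -> : ((d *: a) *m G *m b^T) 0 0 = d * ab by rewrite -!scalemxAl mx00Z.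
have -> : quad G (d *: a) = d ^+ 2 * quad G a.
  by rewrite /quad linearZ/= -!scalemxAl -scalemxAr !mx00Z expr2 mulrA.
move=> h; rewrite -(ler_pM2l d0).
have -> : d * ((1 - d) * quad G a - (d^-1 - 1) * quad G b) =
  d * (1 - d) * quad G a - (1 - d) * quad G b.
  by field; rewrite gt_eqF.
lra.
Qed.

Lemma quad_upper n (G : 'M[R]_n) : exists2 L, 0 < L & forall v, quad G v <= L * `|v| ^+ 2.
Proof.
pose L := 1 + \sum_j \sum_i `|G i j|.
exists L; first by rewrite ltr_pwDl// sumr_ge0// => j _; rewrite sumr_ge0.
move=> v; apply: (@le_trans _ _ ((\sum_j \sum_i `|G i j|) * `|v| ^+ 2)); last first.
  by rewrite ler_wpM2r ?sqr_ge0// /L lerDr.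
rewrite quadE mulr_suml; apply: ler_sum => j _; rewrite !mulr_suml; apply: ler_sum => i _.
apply: le_trans (ler_norm _) _; rewrite !normrM expr2 [`|v 0 i| * _]mulrC -mulrA.
by apply: ler_wpM2l => //; apply: ler_pM => //; exact: coord_le_norm.
Qed.

End MetricComparison.

(** * Bump functions *)

Section Bump.
Context {R : realType}.
Implicit Types (p : {poly R}) (s t : R).

Lemma is_derive_horner p t : is_derive t (1 : R) (fun x : R => p.[x]) (deriv p).[t].
Proof.
elim/poly_ind: p => [|p c ih].
  rewrite deriv0 horner0 (_ : (fun x => _) = cst 0); first exact: is_derive_cst.
  by apply/funext => x; rewrite horner0.
rewrite (_ : (fun x => _) = (fun x => p.[x]) * id + cst c); last first.
  by apply/funext => x; rewrite hornerMXaddC.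
have h := is_deriveD (is_deriveM ih (is_derive_id t (1 : R))) (is_derive_cst c t (1 : R)).
apply: is_derive_eq h _.
rewrite derivMXaddC hornerD hornerM hornerX addr0.
by rewrite /GRing.scale/=; ring.
Qed.

(** Polynomials in 1/t times exp(-1/t) form a family closed under differentiation, so all
    derivatives of the standard flat function are treated at once. *)
Definition flat p t : R := if 0 < t then p.[t^-1] * expR (- t^-1) else 0.

(** From exp(s/k) >= s/k, raised to the power k. *)
Lemma pow_exp_bound k s : 0 < s -> s ^+ k * expR (- s) <= (k%:R) ^+ k.
Proof.
case: k => [|k] s0; first by rewrite !expr0 mul1r -[leRHS]expR0 ler_expR; lra.
set N := k.+1; have N0 : 0 < (N%:R : R) by rewrite ltr0n.
have -> : expR (- s) = (expR (s / N%:R) ^+ N)^-1.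
  by rewrite -expRM_natl expRN; congr (expR _)^-1; field; rewrite gt_eqF.
rewrite ler_pdivrMr ?exprn_gt0 ?expR_gt0// -exprMn.
apply: lerXn2r; rewrite ?nnegrE ?mulr_ge0 ?expR_ge0 ?ler0n// ?(ltW s0)//.
rewrite mulrC -ler_pdivrMr//; apply: le_trans (expR_ge1Dx _).
by rewrite lerDr.
Qed.

(** A quadratic bound gives the derivative 0 at the origin, for every [p]. *)
Lemma flat_bound p : exists2 C, 0 <= C & forall t, `|flat p t| <= C * t ^+ 2.
Proof.
pose C := \sum_(i < size p) `|p`_i| * (i.+2%:R) ^+ i.+2.
have C0 : 0 <= C by apply: sumr_ge0 => i _; rewrite mulr_ge0// exprn_ge0.
exists C => // t; rewrite /flat; case: ifPn => [t0|_]; last first.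
  by rewrite normr0 mulr_ge0// sqr_ge0.
have s0 : 0 < t^-1 by rewrite invr_gt0.
rewrite normrM (ger0_norm (expR_ge0 _)).
have : `|p.[t^-1]| * expR (- t^-1) * (t^-1) ^+ 2 <= C.
  rewrite horner_coef.
  apply: (@le_trans _ _ ((\sum_(i < size p) `|p`_i * t^-1 ^+ i|) * expR (- t^-1) * (t^-1) ^+ 2)).
    apply: ler_wpM2r; first by rewrite exprn_ge0// ltW.
    by apply: ler_wpM2r; [exact: expR_ge0|exact: ler_norm_sum].
  rewrite !mulr_suml; apply: ler_sum => i _.
  rewrite normrM -!mulrA; apply: ler_wpM2l => //.
  rewrite (ger0_norm (exprn_ge0 _ (ltW s0))) mulrCA mulrC -exprD addn2.
  exact: pow_exp_bound.
by rewrite exprVn ler_pdivrMr// exprn_gt0.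
Qed.

Lemma flat_is_derive p t : is_derive t (1 : R) (flat p) (flat ('X^2 * (p - deriv p)) t).
Proof.
have [t0|t0|->] := ltgtP t 0.
- rewrite {2}/flat ltNge (ltW t0)/=.
  apply: near_eq_is_derive (is_derive_cst (0 : R) t (1 : R)).
  near=> s; rewrite /flat ifF//; apply/negbTE; rewrite -leNgt ltW//.
  by near: s; exact: lt_nbhsl.
- rewrite {2}/flat t0.
  apply: (@near_eq_is_derive _ _ _ (fun s => p.[s^-1] * expR (- s^-1))).
    by near=> s; rewrite /flat ifT//; near: s; exact: lt_nbhsr.
  have dV : is_derive t (1 : R) (fun s : R => s^-1) (- t ^- 2).
    have tn : t != 0 by rewrite gt_eqF.
    have h := @is_deriveV R (@id R) t 1 1 tn (is_derive_id t (1 : R)).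
    by apply: is_derive_eq h _; rewrite /GRing.scale/= mulr1.
  have d1 : is_derive t (1 : R) (fun s : R => p.[s^-1]) ((deriv p).[t^-1] * (- t ^- 2)).
    apply: is_derive1_comp; exact: is_derive_horner.
  have dN : is_derive t (1 : R) (fun s : R => - s^-1) (t ^- 2).
    by have h := is_deriveN dV; apply: is_derive_eq h _; rewrite opprK.
  have d2 : is_derive t (1 : R) (fun s : R => expR (- s^-1)) (expR (- t^-1) * t ^- 2).
    by apply: (@is_derive1_comp _ expR (fun s : R => - s^-1)).
  have := is_deriveM d1 d2 => h; apply: is_derive_eq h _.
  rewrite /GRing.scale/= hornerM hornerXn hornerD hornerN exprVn; ring.
rewrite {2}/flat ltxx.
have [C C0 hC] := flat_bound p.
have f00 : flat p 0 = 0 by rewrite /flat ltxx.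
have q0 : h^-1 *: ((flat p \o shift 0) (h *: (1 : R)) - flat p 0) @[h --> (0 : R)^'] --> (0 : R).
  apply/cvgrPdist_lt => e e0; apply/nbhs_ballP.
  exists (e / (C + 1)) => [|h]; first by rewrite /= divr_gt0//; lra.
  rewrite /ball/= sub0r normrN => he h0.
  rewrite sub0r normrN f00 subr0 addr0 /GRing.scale/= mulr1 normrM normfV.
  have hp : 0 < `|h| by rewrite normr_gt0.
  rewrite mulrC ltr_pdivrMr//; apply: le_lt_trans (hC h) _.
  rewrite -[h ^+ 2]ger0_norm ?sqr_ge0// normrX expr2 mulrA ltr_pM2r//.
  have : `|h| * (C + 1) < e by rewrite -ltr_pdivlMr//; lra.
  by apply: le_lt_trans; rewrite mulrDr mulr1 mulrC lerDl.
by apply: DeriveDef; [apply/cvg_ex; exists 0|exact: cvg_lim].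
Unshelve. all: by end_near. Qed.

Definition flatP j : {poly R} := iter j (fun p => 'X^2 * (p - deriv p)) 1.

Lemma flat1_gt0 t : (0 < flat 1 t) = (0 < t).
Proof.
by rewrite /flat hornerC mul1r; case: ifPn => // _; rewrite ?expR_gt0// ltxx.
Qed.

Lemma flat1_ge0 t : 0 <= flat 1 t.
Proof. by rewrite /flat hornerC mul1r; case: ifPn => // _; rewrite expR_ge0. Qed.

Context {n : nat}.
Implicit Types (U : set 'rV[R]_n) (x a : 'rV[R]_n).

Lemma Ck_coord k U i : open U -> Ck k U (fun x => x 0 i).
Proof.
move=> oU; case: k => [|k]; first by split=> // x _; exact: coord_continuous.
split=> [x _|j]; first exact: coord_continuous.
have d x : is_derive x (ed j) (fun y : 'rV[R]_n => y 0 i) (i == j)%:R.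
  apply: cvg_derive; apply: cvg_near_cst; apply/nbhs_ballP; exists 1 => //= t _ t0.
  by rewrite rvD rvZ edE addrAC subrr add0r mulKf.
split=> [x _|]; first by case: (d x).
apply: (@Ck_ext _ _ _ _ (fun=> (i == j)%:R)) => //; last exact: Ck_cst.
by move=> y _; case: (d y) => _ ->.
Qed.

(** A product over the coordinates, because the balls of the sup norm are cubes. *)
Definition bump a (r : R) x : R := \prod_i flat 1 (r ^+ 2 - (x 0 i - a 0 i) ^+ 2).

Lemma Ck_bump k a r : Ck k setT (bump a r).
Proof.
have oT : open [set: 'rV[R]_n] by exact: openT.
have fac i : Ck k setT (fun x : 'rV[R]_n => flat 1 (r ^+ 2 - (x 0 i - a 0 i) ^+ 2)).
  apply: (@Ck_comp1 _ _ k setT (fun x : 'rV[R]_n => r ^+ 2 - (x 0 i - a 0 i) ^+ 2)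
    (fun j => flat (flatP j))) => //.
    by move=> j t; exact: flat_is_derive.
  have c1 : Ck k setT (fun x : 'rV[R]_n => x 0 i + - a 0 i).
    by apply: CkD => //; [exact: Ck_coord|exact: Ck_cst].
  have c2 : Ck k setT (fun x : 'rV[R]_n => (-1) * ((x 0 i + - a 0 i) * (x 0 i + - a 0 i))).
    by apply: CkM => //; [exact: Ck_cst|exact: CkM].
  apply: (@Ck_ext _ _ _ _ (fun x : 'rV[R]_n => r ^+ 2 + (-1) * ((x 0 i + - a 0 i) * (x 0 i + - a 0 i)))) => //.
    by move=> x _; ring.
  by apply: CkD => //; exact: Ck_cst.
rewrite /bump; elim: (index_enum _) => [|i s ih].
  by apply: (@Ck_ext _ _ _ _ (fun=> 1)) => // [x _|]; [rewrite big_nil|exact: Ck_cst].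
apply: (@Ck_ext _ _ _ _ _ _ oT _ (CkM oT (fac i) ih)) => x _.
by rewrite big_cons.
Qed.

Lemma bump_ge0 a r x : 0 <= bump a r x.
Proof. by apply: prodr_ge0 => i _; exact: flat1_ge0. Qed.

Lemma bump_gt0 a r : 0 < r -> 0 < bump a r a.
Proof.
by move=> r0; apply: prodr_gt0 => i _; rewrite flat1_gt0 subrr expr0n subr0 exprn_gt0.
Qed.

Lemma bump_supp a r x : 0 < r -> bump a r x != 0 -> `|a - x| < r.
Proof.
move=> r0; rewrite /bump prodf_seq_neq0 => /allP h; apply/normrv_lt => // i.
have := h i (mem_index_enum i); rewrite /= => hi.
have : 0 < flat 1 (r ^+ 2 - (x 0 i - a 0 i) ^+ 2) by rewrite lt_neqAle eq_sym hi flat1_ge0.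
rewrite flat1_gt0 subr_gt0 rvD rvN distrC -[_ ^+ 2]ger0_norm ?sqr_ge0// normrX.
by rewrite ltr_pXn2r// nnegrE// ltW.
Qed.

End Bump.

(** * Integration on the manifold *)

Lemma nbhs_mono (T : topologicalType) (x : T) (P Q : set T) :
  nbhs x P -> (forall y, P y -> Q y) -> nbhs x Q.
Proof. by move=> h PQ; apply: filterS h. Qed.

Lemma within_cvg (R : realType) (S : set R) (q : R -> R) (L : R) : nbhs (0 : R) S ->
  q t @[t --> within S (0 : R)^'] --> L -> q t @[t --> (0 : R)^'] --> L.
Proof.
move=> nS qL W /qL h; have h' : nbhs (0 : R) [set t | t != 0 -> S t -> W (q t)] by exact: h.
suff : nbhs (0 : R) [set t | t != 0 -> W (q t)] by [].
by apply: (nbhs_mono (filterI nS h')) => t [St h1] t0; exact: h1.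
Qed.

Lemma cvg_sign0 (R : realType) (q : R -> R) (L r : R) : 0 < r ->
  q t @[t --> (0 : R)^'] --> L ->
  (forall t, 0 < t -> t < r -> 0 <= q t) -> (forall t, - r < t -> t < 0 -> q t <= 0) ->
  L = 0.
Proof.
move=> r0 qL qp qn; apply/eqP; apply: contraT => L0.
have L0' : 0 < `|L| by rewrite normr_gt0.
have /cvgrPdist_lt/(_ _ L0') := qL; move=> /nbhs_ballP[d d0 h].
pose s := Num.min r d / 2.
have md : 0 < Num.min r d by rewrite lt_min r0.
have s0 : 0 < s by rewrite divr_gt0.
have sr : s < r by apply: (@lt_le_trans _ _ (Num.min r d)); [rewrite /s; lra|rewrite ge_min lexx].
have sd : s < d by apply: (@lt_le_trans _ _ (Num.min r d)); [rewrite /s; lra|rewrite ge_min lexx orbT].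
have h1 : `|L - q s| < `|L|.
  by apply: h; rewrite /= ?gt_eqF// /ball/= sub0r normrN gtr0_norm.
have h2 : `|L - q (- s)| < `|L|.
  by apply: h; rewrite /= ?oppr_eq0 ?gt_eqF// /ball/= sub0r opprK gtr0_norm.
have q1 := qp s s0 sr; have q2 : q (- s) <= 0 by apply: qn; lra.
have [Lp|Ln] := ltP 0 L.
  rewrite (gtr0_norm Lp) in h2; move: h2; rewrite ltr_norml => /andP[_]; lra.
rewrite (ler0_norm Ln) in h1; move: h1; rewrite ltr_norml => /andP[]; lra.
Qed.

Lemma relopen_pos (R : realType) m (D : set 'rV[R]_m.+1) : relopen D ->
  open [set x | D x /\ 0 < x 0 ord0].
Proof.
move=> [U oU ->].
have -> : [set x : 'rV[R]_m.+1 | (U `&` half_space) x /\ 0 < x 0 ord0] =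
    U `&` (fun y : 'rV[R]_m.+1 => y 0 ord0) @^-1` [set t | 0 < t].
  by apply/seteqP; split=> x [] => [[]|Ux x0]//; do !split=> //; exact: ltW.
apply: openI => //.
by apply: open_comp; [move=> y _; exact: coord_continuous|exact: open_gt].
Qed.

Lemma posdef_minor (R : realType) m (G : 'M[R]_m.+1) : posdef G ->
  posdef (\matrix_(a < m, b < m) G (lift ord0 a) (lift ord0 b)).
Proof.
move=> [sG pG]; split.
  by apply/matrixP => a b; rewrite !mxE -{1}sG mxE.
move=> w w0; have v0 : vcons 0 w != 0.
  apply: contra w0 => /eqP e; apply/eqP/rowP => a.
  by rewrite -(vconsS 0 w) e !mxE.
have := pG _ v0; rewrite !quadE big_ord_recl vcons0 mulr0 add0r.
congr (_ < _); apply: eq_bigr => b _; rewrite vconsS; congr (_ * _).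
rewrite big_ord_recl vcons0 mul0r add0r; apply: eq_bigr => a _.
by rewrite vconsS mxE.
Qed.

Lemma quad_conj (R : realType) n (J G : 'M[R]_n) v : quad (J *m G *m J^T) v = quad G (v *m J).
Proof. by rewrite /quad trmx_mul !mulmxA. Qed.

Lemma fin_radius (R : realType) (I : finType) (r : I -> R) : (forall i, 0 < r i) ->
  exists2 d : R, 0 < d & forall i, d <= r i.
Proof.
move=> r0; exists (\big[Num.min/1]_i r i).
  by apply: (big_ind (fun x : R => 0 < x)) => // x y x0 y0; rewrite lt_min x0.
by move=> i; rewrite (bigD1 i)//= ge_min lexx.
Qed.

Section Manifold.
Context {R : realType} {m : nat} {M : topologicalType}.
Notation H := (@half_space R m).
Notation chart := (chart R m M).
Variables (A : set chart) (g : chart -> 'rV[R]_m.+1 -> 'M[R]_m.+1).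
Hypothesis sm : smooth_manifold A.
Hypothesis rm : riemannian_metric A g.
Hypothesis hcompact : compact [set: M].
Implicit Types (c : chart) (p q : M) (x y : 'rV[R]_m.+1) (h k : M -> R).

Lemma chartP c : A c -> is_chart c.
Proof. exact: manifold_chart. Qed.

Lemma posdef_g c x : A c -> cimg c x -> posdef (g c x).
Proof.
move=> Ac cx; split; first exact: (Defs.metric_sym rm Ac cx).
by move=> v v0; exact: (metric_pos rm Ac cx v0).
Qed.

Lemma smooth_g c : A c -> smooth_mx (cimg c) (g c).
Proof. by move=> Ac i j; exact: (metric_smooth rm). Qed.

Lemma smooth_trans c c' j : A c -> A c' -> smooth_on (overlap c c') (fun x => trans c c' x 0 j).
Proof. by move=> Ac Ac'; exact: (manifold_compatible sm j Ac Ac'). Qed.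

Lemma smooth_function_continuous h : smooth_function A h -> continuous h.
Proof.
move=> sh p; have [c Ac cp] := manifold_cover sm p; have cc := chartP Ac.
have [U [G [oU Ux kG FG]]] := smooth_onP (sh c Ac) (cimg_cmap cp).
have [Q oQ [Qp hQ]] := cmap_open cc oU cp Ux.
apply: (@continuous_near_eq _ _ _ (G \o cmap c)).
  apply: filterS (open_nbhs_nbhs (conj oQ Qp)) => q Qq.
  have [cq Uq] := hQ q Qq.
  by rewrite /= FG//; [rewrite /= cinvK|exact: cimg_cmap].
apply: continuous_comp; first exact: cmap_continuous.
exact: (Ck_cont (kG 0%N)).
Qed.

(** Near [x0] the transition map is [J]-linear up to an error [b] of size [e * |z - y|];
    [metric_change] makes [quad G' (v *m J)] equal to [quad G v], and [quad_perturb] absorbs [b]. *)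
Lemma metric_compare c c' x0 d : A c -> A c' -> overlap c c' x0 -> 0 < d < 1 ->
  exists2 r : R, 0 < r & forall y z, overlap c c' y -> overlap c c' z ->
    `|x0 - y| < r -> `|x0 - z| < r ->
    (1 - d) * quad (g c x0) (z - y) <=
    quad (g c' (trans c c' x0)) (trans c c' z - trans c c' y).
Proof.
move=> Ac Ac' ox /andP[d0 d1]; have cc := chartP Ac; have cc' := chartP Ac'.
have pG := posdef_g Ac (overlap_cimg ox).
have pG' := posdef_g Ac' (overlap_cimgr cc ox).
set G := g c x0 in pG *; set G' := g c' _ in pG' *.
have GE : G = Defs.jacobian c c' x0 *m G' *m (Defs.jacobian c c' x0)^T.
  exact: (metric_change rm Ac Ac' ox).
set J := Defs.jacobian c c' x0 in GE.
have [l l0 hl] := posdef_lower pG; have [L L0 hL] := quad_upper G'.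
(* This [e] ensures [quad G' b <= d ^+ 2 / 4 * quad G (z - y)], so that [quad_perturb] with
   parameter [d / 2] loses at most the fraction [d]. *)
pose e := Num.min 1 (d ^+ 2 * l / (4 * L)).
have e0 : 0 < e by rewrite lt_min ltr01 divr_gt0 ?mulr_gt0 ?exprn_gt0.
have e1 : e <= 1 by rewrite ge_min lexx.
have eL : e * (4 * L) <= d ^+ 2 * l.
  by rewrite -ler_pdivlMr ?mulr_gt0// ge_min lexx orbT.
have /choice[r hr] : forall j : 'I_m.+1, exists r : R, 0 < r /\
    forall y z, overlap c c' y -> overlap c c' z -> `|x0 - y| < r -> `|x0 - z| < r ->
    `|trans c c' z 0 j - trans c c' y 0 j - \sum_i (z 0 i - y 0 i) * J i j| <= e * `|z - y|.
  move=> j; have [U [F sF]] := smooth_onP (smooth_trans j Ac Ac') ox.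
  have [oU Ux kF FE] := sF.
  have [r r0 h] := strict_diff oU Ux (kF 1%N) e0.
  have /nbhs_ballP[r' r'0 hU] := open_nbhs1 oU Ux.
  exists (Num.min r r'); split; first by rewrite lt_min r0.
  move=> y z oy oz; rewrite !lt_min => /andP[y1 y2] /andP[z1 z2].
  have Uy : U y by apply: hU; rewrite -ball_normE.
  have Uz : U z by apply: hU; rewrite -ball_normE.
  have := h y z y1 z1; rewrite !FE//.
  congr (`| _ - _| <= _); apply: eq_bigr => i _; congr (_ * _).
  by rewrite /J mxE -(smooth_ext_partial i (relopen_overlap cc cc') sF Ux ox).
have [r1 r10 hr1] := fin_radius (fun j => (hr j).1).
exists r1 => // y z oy oz y1 z1.
pose a := (z - y) *m J; pose b := trans c c' z - trans c c' y - a.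
have -> : trans c c' z - trans c c' y = a + b by rewrite /b [a + _]addrC subrK.
have bv : `|b| <= e * `|z - y|.
  apply/normrv_le; first by rewrite mulr_ge0// ltW.
  move=> j; have := (hr j).2 y z oy oz (lt_le_trans y1 (hr1 j)) (lt_le_trans z1 (hr1 j)).
  rewrite /b !rvD !rvN; congr (`|_ - _| <= _); rewrite /a mxE.
  by apply: eq_bigr => i _; rewrite rvD rvN.
have d2 : 0 < d / 2 < 1 by apply/andP; split; lra.
apply: le_trans (quad_perturb a b pG' d2).
have -> : quad G' a = quad G (z - y) by rewrite GE quad_conj.
have qb : quad G' b <= L * (e ^+ 2 * `|z - y| ^+ 2).
  apply: le_trans (hL b) _; apply: ler_wpM2l; first exact: ltW.
  by rewrite -exprMn; apply: lerXn2r => //; rewrite nnegrE// mulr_ge0// ltW.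
have qv := hl (z - y).
move: (quad G (z - y)) (quad G' b) qv qb => Q Qb qv qb.
set v := `|z - y| ^+ 2 in qv qb.
have v0 : 0 <= v by exact: sqr_ge0.
clearbody v; clear -d0 d1 l0 L0 e0 e1 eL qv qb v0.
have h1 : Qb <= L * e * v.
  apply: le_trans qb _; rewrite mulrA; apply: ler_wpM2r => //; apply: ler_wpM2l; first exact: ltW.
  by rewrite expr2 ler_piMl// ltW.
have h2 : d * Qb <= d ^+ 3 / 4 * Q.
  have : L * e * v * 4 <= d ^+ 2 * Q.
    apply: (@le_trans _ _ (d ^+ 2 * l * v)).
      have -> : L * e * v * 4 = e * (4 * L) * v by ring.
      exact: ler_wpM2r.
    by rewrite -mulrA ler_wpM2l// sqr_ge0.
  move=> h3; have -> : d ^+ 3 / 4 * Q = d * (d ^+ 2 * Q / 4) by field.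
  apply: ler_wpM2l; first exact: ltW.
  lra.
have Q0 : 0 <= Q by apply: le_trans qv; rewrite mulr_ge0// ltW.
have Qb4 : Qb <= d ^+ 2 / 4 * Q.
  rewrite -(ler_pM2l d0); apply: le_trans h2 _.
  by rewrite le_eqVlt; apply/orP; left; apply/eqP; field.
have K0 : 0 <= (d / 2)^-1 - 1.
  by rewrite subr_ge0 invf_ge1 ?divr_gt0//; lra.
have := ler_wpM2l K0 Qb4.
have -> : ((d / 2)^-1 - 1) * (d ^+ 2 / 4 * Q) = (d / 2 - d ^+ 2 / 4) * Q.
  by field; rewrite gt_eqF.
have : 0 <= d ^+ 2 * Q by rewrite mulr_ge0// sqr_ge0.
lra.
Qed.

Hypothesis horiented : oriented A.

(* A transition map between two charts cannot send an interior point to the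
   boundary hyperplane: its first component would have an interior minimum
   there, and the jacobian a zero column. *)
Lemma boundary_coord c p : A c -> cdom c p -> boundary A p -> cmap c p 0 ord0 = 0.
Proof.
move=> Ac cp [c' Ac' [c'p p0]]; have cc := chartP Ac; have cc' := chartP Ac'.
have oc : overlap c c' (cmap c p) by exists p.
have oD := relopen_overlap cc cc'.
set x := cmap c p in oc *.
have x0 : 0 <= x 0 ord0 by exact: relopen_half oD oc.
apply/eqP; rewrite eq_le x0 andbT leNgt; apply/negP => xpos.
pose T y := transition c c' ord0 y.
have sT : smooth_on (overlap c c') T by exact: smooth_trans.
have Tx : T x = 0 by rewrite /T /transition /x cinvK.
have T0 y : overlap c c' y -> 0 <= T y.
  by move=> oy; exact: (cimg_half cc' (overlap_cimgr cc oy)).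
have dT i : partial (overlap c c') i T x = 0.
  have nD := relopen_interior oD oc xpos.
  have /nbhs_ballP[r r0 hr] := nD.
  have bD t : `|t| < r -> overlap c c' (x + t *: ed i).
    by move=> tr; apply: hr; rewrite -ball_normE /= opprD addNKr normrN norm_ed.
  have := partial_cvg (i := i) oD sT oc.
  pose q t := t^-1 * (T (x + t *: ed i) - T x); rewrite -/q => qL.
  have nS : nbhs (0 : R) [set t | overlap c c' (x + t *: ed i)].
    by apply/nbhs_ballP; exists r => // t; rewrite /ball/= sub0r normrN => /bD.
  have qL' := within_cvg nS qL.
  apply: (cvg_sign0 r0 qL') => t.
    move=> t0 tr; rewrite /q Tx subr0 mulr_ge0// ?invr_ge0 ?(ltW t0)//; apply: T0; apply: bD.
    by rewrite gtr0_norm.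
  move=> tr t0; rewrite /q Tx subr0 mulr_le0_ge0 ?invr_le0 ?(ltW t0)//; apply: T0; apply: bD.
  by rewrite ltr0_norm// ltrNl.
have := horiented Ac Ac' oc.
have -> : \det (Defs.jacobian c c' x) = 0.
  rewrite (expand_det_col _ ord0) big1// => i _.
  by rewrite mxE -/T dT mul0r.
by rewrite ltxx.
Qed.

Definition cfun c h x : R := h (cinv c x) * dens (g c) x.

(** It has an invariant meaning only for [h] vanishing off a closed subset of [cdom c], whence the
    set [K] in the lemmas that follow. *)
Definition cint c h : R := hint (ext0 (cimg c) (cfun c h)).

Lemma cmap_compact c (K : set M) : A c -> closed K -> K `<=` cdom c ->
  compact (cmap c @` K) /\ cmap c @` K `<=` cimg c.
Proof.
move=> Ac clK Kc; split; last by move=> _ [p Kp <-]; exact: cimg_cmap (Kc _ Kp).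
apply: continuous_compact.
  apply: continuous_in_subspaceT => p /set_mem Kp.
  by apply: cmap_continuous (Kc _ Kp); exact: chartP.
by apply: subclosed_compact hcompact _.
Qed.

Lemma cfun_off c (K : set M) h x : A c -> (forall p, ~ K p -> h p = 0) ->
  cimg c x -> ~ (cmap c @` K) x -> cfun c h x = 0.
Proof.
move=> Ac hK cx nK; rewrite /cfun hK ?mul0r// => Kx; apply: nK.
by exists (cinv c x) => //; apply: cmapK => //; exact: chartP.
Qed.

Lemma cfun_cont c h x e : A c -> continuous h -> cimg c x -> 0 < e ->
  exists2 d : R, 0 < d & forall y, cimg c y -> `|x - y| < d -> `|cfun c h x - cfun c h y| < e.
Proof.
move=> Ac ch cx; have cc := chartP Ac; apply: rel_contM => e' e'0.
  exact: cinv_rel_cont.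
apply: smooth_rel_cont => //; apply: smooth_dens; first exact: smooth_g.
by move=> y; exact: posdef_g.
Qed.

Lemma cint_ucs c (K : set M) : A c -> closed K -> K `<=` cdom c ->
  exists2 B, 0 <= B & forall h, continuous h -> (forall p, ~ K p -> h p = 0) ->
  ucs H B (ext0 (cimg c) (cfun c h)).
Proof.
move=> Ac clK Kc; have [cK Kc'] := cmap_compact Ac clK Kc.
have [B B0 hB] := compact_ext0_ucs cK; exists B => // h ch hK.
apply: hB => //; first by apply: relopen_cimg; exact: chartP.
  by move=> x cx e e0; exact: cfun_cont.
by move=> x cx nK; exact: cfun_off nK.
Qed.

Lemma dens_ge0 c x : 0 <= dens (g c) x.
Proof. exact: sqrtr_ge0. Qed.

Lemma cfun_ge0 c h x : (forall p, 0 <= h p) -> 0 <= ext0 (cimg c) (cfun c h) x.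
Proof. by move=> h0; rewrite /ext0 mulr_ge0// mulr_ge0// dens_ge0. Qed.

(** A boundary-defining function: continuous on [M] and positive exactly at interior points, it
    allows cut-offs near the boundary that do not depend on the chart. *)
Variable f : M -> R.
Hypothesis cf : continuous f.
Hypothesis f0 : forall p, 0 <= f p.
Hypothesis fpos : forall c x, A c -> cimg c x -> (0 < f (cinv c x)) = (0 < x 0 ord0).

Lemma cfun_interior c (K : set M) h : A c -> closed K -> K `<=` cdom c ->
  (forall p, K p -> 0 < f p) -> continuous h -> (forall p, ~ K p -> h p = 0) ->
  (forall x, (cmap c @` K) x -> {for x, continuous (ext0 (cimg c) (fun y => h (cinv c y)))}) /\
  cint c h = intn (ext0 (cimg c) (cfun c h)).
Proof.
move=> Ac clK Kc Kf ch hK; have [cK Kc'] := cmap_compact Ac clK Kc.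
have cc := chartP Ac; have oD := relopen_cimg cc.
have int x : (cmap c @` K) x -> nbhs x (cimg c).
  move=> Kx; have cx := Kc' _ Kx; apply: relopen_interior => //.
  rewrite -(fpos Ac cx); apply: Kf; case: Kx => p Kp <-.
  by rewrite cinvK//; exact: Kc.
have rel F x : (cmap c @` K) x -> (forall e, 0 < e -> exists2 d : R, 0 < d &
     forall y, cimg c y -> `|x - y| < d -> `|F x - F y| < e) ->
    {for x, continuous (ext0 (cimg c) F)}.
  move=> Kx hF; apply/(@cvgrPdist_lt _ _ _ (nbhs x) (nbhs_filter x)) => e e0.
  have [d d0 hd] := hF e e0.
  have nb : nbhs x (ball x d) by exact: nbhsx_ballx.
  apply: (nbhs_mono (filterI (int x Kx) nb)) => y [cy]; rewrite -ball_normE => xy.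
  by rewrite /= !ext0_in//; [exact: hd|exact: Kc'].
split.
  by move=> x Kx; apply: rel => // e e0; exact: cinv_rel_cont (Kc' _ Kx) e0.
have [B B0 hB] := compact_sub_ucs cK.
apply: (hint_intn B0).
  apply: hB => x Kx.
    by apply: rel => // e e0; exact: cfun_cont (Kc' _ Kx) e0.
  by apply: (ext0_off (K := cmap c @` K)) => // y cy; exact: cfun_off.
by move=> x nH; rewrite ext0_out// => cx; apply: nH; exact: cimg_half cx.
Qed.

(** Positivity of [f] on [K] keeps the support off the hyperplane in both charts, so [chart_le]
    applies to the open sets of interior points of the overlaps, where relative smoothness yields
    ordinary continuity. *)
Lemma cint_le_int c c' (K : set M) h : A c -> A c' -> closed K -> K `<=` cdom c ->
  K `<=` cdom c' -> (forall p, K p -> 0 < f p) -> continuous h ->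
  (forall p, ~ K p -> h p = 0) -> (forall p, 0 <= h p) -> cint c h <= cint c' h.
Proof.
move=> Ac Ac' clK Kc Kc' Kf ch hK h0.
have cc := chartP Ac; have cc' := chartP Ac'.
have [hcont ->] := cfun_interior Ac clK Kc Kf ch hK.
have [_ ->] := cfun_interior Ac' clK Kc' Kf ch hK.
have [cK Kc2] := cmap_compact Ac clK Kc.
pose U := [set x | overlap c c' x /\ 0 < x 0 ord0].
pose U' := [set x | overlap c' c x /\ 0 < x 0 ord0].
have opU (d d' : chart) : is_chart d -> is_chart d' -> open [set x | overlap d d' x /\ 0 < x 0 ord0].
  by move=> dd dd'; apply: relopen_pos; exact: relopen_overlap.
have pos_trans d d' x : A d -> A d' -> overlap d d' x -> 0 < x 0 ord0 ->
    0 < trans d d' x 0 ord0.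
  move=> Ad Ad' ox; have dd := chartP Ad; have dd' := chartP Ad'.
  rewrite -(fpos Ad (overlap_cimg ox)) -(cinv_trans dd dd' ox) (fpos Ad')//.
  exact: overlap_cimgr.
have ctr d d' x : A d -> A d' -> overlap d d' x -> 0 < x 0 ord0 ->
    {for x, continuous (trans d d')}.
  move=> Ad Ad' ox x0; apply: continuous_rv => j.
  apply: smooth_continuous (smooth_trans j Ad Ad') ox x0.
  by apply: relopen_overlap; exact: chartP.
have cdens d x : A d -> cimg d x -> 0 < x 0 ord0 -> {for x, continuous (dens (g d))}.
  move=> Ad dx x0; apply: (smooth_continuous (relopen_cimg (chartP Ad)) _ dx x0).
  by apply: smooth_dens; [exact: smooth_g|move=> y; exact: posdef_g].
pose k := ext0 (cimg c) (fun y => h (cinv c y)).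
have -> : ext0 (cimg c) (cfun c h) = (fun y => k y * dens (g c) y).
  by apply/funext => y; rewrite /k /ext0 /cfun mulrA.
have -> : ext0 (cimg c') (cfun c' h) =
    (fun z => \1_U' z * (k (trans c' c z) * dens (g c') z)).
  apply/funext => z; have [Uz|Uz] := pselect (U' z).
    have [oz z0] := Uz; rewrite ext0_in; last exact: overlap_cimg oz.
    rewrite indicE mem_set// mul1r /k ext0_in; last exact: (overlap_cimgr cc' oz).
    by rewrite /cfun cinv_trans.
  rewrite [in RHS]indicE memNset// mul0r.
  have [c'z|c'z] := pselect (cimg c' z); last by rewrite ext0_out.
  rewrite ext0_in// /cfun hK ?mul0r// => Kz; apply: Uz.
  split; last by rewrite -(fpos Ac' c'z); exact: Kf.
  by rewrite overlapE//; split=> //; exact: Kc.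
apply: (@chart_le _ _ U U' (trans c c') (trans c' c) _ _ (cmap c @` K)).
- exact: opU.
- exact: opU.
- by move=> y [oy y0]; split; [exact: trans_overlap|exact: pos_trans].
- by move=> y [oy y0]; split; [exact: trans_overlap|exact: pos_trans].
- by move=> y [oy y0]; exact: transK.
- by move=> y [oy y0]; exact: transK.
- by move=> y [oy y0]; exact: ctr.
- by move=> y [oy y0]; exact: ctr.
- by move=> y [oy y0]; apply: cdens => //; exact: overlap_cimg oy.
- by move=> y [oy y0]; apply: cdens => //; exact: overlap_cimg oy.
- move=> y [oy y0]; exists (g c y), (g c' (trans c c' y)); split=> //.
  + exact: posdef_g (overlap_cimg oy).
  + exact: posdef_g (overlap_cimgr cc oy).
  + move=> d d01; have [r r0 hr] := metric_compare Ac Ac' oy d01.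
    by exists r => // a b ya yb [oa _] [ob _]; exact: hr.
- exact: cK.
- move=> _ [p Kp <-]; split; first by exists p => //; split; [exact: Kc|exact: Kc'].
  rewrite -(fpos Ac); last by apply: cimg_cmap; exact: Kc.
  by rewrite cinvK ?Kf//; exact: Kc.
- exact: hcont.
- move=> y nK; apply: (ext0_off (K := cmap c @` K)) => // z cz nz.
  by rewrite hK// => Kz; apply: nz; exists (cinv c z) => //; exact: cmapK.
- by move=> y; rewrite /k /ext0 mulr_ge0.
- by move=> y _; exact: dens_ge0.
- by move=> y _; exact: dens_ge0.
Qed.

Lemma cint_le c (K : set M) h k : A c -> closed K -> K `<=` cdom c -> continuous h ->
  continuous k -> (forall p, ~ K p -> h p = 0) -> (forall p, ~ K p -> k p = 0) ->
  (forall p, h p <= k p) -> cint c h <= cint c k.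
Proof.
move=> Ac clK Kc ch ck hK kK hk; have [B B0 hB] := cint_ucs Ac clK Kc.
apply: (hint_le B0 (hB _ ch hK) (hB _ ck kK)) => x _.
by rewrite /ext0 ler_wpM2l// /cfun ler_wpM2r// dens_ge0.
Qed.

Lemma cint_sum c (K : set M) (I : Type) (r : seq I) (h : I -> M -> R) : A c ->
  closed K -> K `<=` cdom c -> (forall i, continuous (h i)) ->
  (forall i p, ~ K p -> h i p = 0) ->
  cint c (fun p => \sum_(i <- r) h i p) = \sum_(i <- r) cint c (h i).
Proof.
move=> Ac clK Kc ch hK; have [B B0 hB] := cint_ucs Ac clK Kc.
rewrite /cint -(hint_sum r B0 (fun i => hB _ (ch i) (hK i))).
congr hint; apply/funext => x; rewrite /ext0 /cfun -mulr_sumr; congr (_ * _).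
by rewrite mulr_suml.
Qed.

Lemma cintZ c (K : set M) a h : A c -> closed K -> K `<=` cdom c -> continuous h ->
  (forall p, ~ K p -> h p = 0) -> cint c (fun p => a * h p) = a * cint c h.
Proof.
move=> Ac clK Kc ch hK; have [B B0 hB] := cint_ucs Ac clK Kc.
rewrite /cint -(hintZ a B0 (hB _ ch hK)); congr hint; apply/funext => x.
by rewrite /ext0 /cfun; ring.
Qed.

Lemma cintD c (K : set M) h k : A c -> closed K -> K `<=` cdom c -> continuous h ->
  continuous k -> (forall p, ~ K p -> h p = 0) -> (forall p, ~ K p -> k p = 0) ->
  cint c (fun p => h p + k p) = cint c h + cint c k.
Proof.
move=> Ac clK Kc ch ck hK kK; have [B B0 hB] := cint_ucs Ac clK Kc.
rewrite /cint -(hintD B0 (hB _ ch hK) (hB _ ck kK)); congr hint; apply/funext => x.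
by rewrite /ext0 /cfun mulrDl mulrDr.
Qed.

Lemma clamp_continuous : continuous (clamp : R -> R).
Proof.
apply: ucont_continuous => e e0; exists e => // x y _ _ xy.
exact: le_lt_trans (clamp_lip x y) xy.
Qed.

(* h is cut off near the zero set of f, that is, near the boundary; the error is
   at most proportional to the width of the removed layer. *)
Lemma cint_change_le c c' (K : set M) h : A c -> A c' -> closed K -> K `<=` cdom c ->
  K `<=` cdom c' -> continuous h -> (forall p, ~ K p -> h p = 0) ->
  (forall p, 0 <= h p) -> cint c h <= cint c' h.
Proof.
move=> Ac Ac' clK Kc Kc' ch hK h0.
have cc := chartP Ac; have cc' := chartP Ac'.
have [cK Kc2] := cmap_compact Ac clK Kc.
have [B B0 hB] := cint_ucs Ac clK Kc.
have [Mh Mh0 hMh] := ucs_bound (ucs_habs (hB _ ch hK)).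
have hb x : H x -> `|ext0 (cimg c) (cfun c h) x| <= Mh.
  by move=> Hx; rewrite -(habs_half Hx).
apply: (@ler_of_small _ _ _ ((2 * B) ^+ m * Mh)).
  by rewrite mulr_ge0// exprn_ge0// mulr_ge0.
move=> d d0.
(* On this compact part [f] is bounded away from 0; the rest of the support lies in a layer of width
   [d]. *)
pose C := (cmap c @` K) `&` [set x : 'rV[R]_m.+1 | d <= x 0 ord0].
have cC : compact C.
  apply: compact_closedI => //.
  rewrite (_ : [set x : 'rV[R]_m.+1 | d <= x 0 ord0] =
    (fun x : 'rV[R]_m.+1 => x 0 ord0) @^-1` [set t | d <= t])//.
  apply: preimage_closed; last exact: closed_ge.
  by move=> x _; exact: coord_continuous.
have cL : compact (cinv c @` C).
  apply: continuous_compact => //; have [_ _ _ _ ci] := cc.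
  by apply: continuous_subspaceW ci => x [/Kc2].
have fL p : (cinv c @` C) p -> 0 < f p.
  move=> [x [Kx dx] <-]; rewrite (fpos Ac (Kc2 _ Kx)); exact: lt_le_trans dx.
have [Mf Mf0 hMf] : exists2 Mf, 0 <= Mf & forall p, (cinv c @` C) p -> `|(f p)^-1| <= Mf.
  apply: compact_bound => // p Lp; apply: cvgV; last exact: cf.
  by rewrite gt_eqF// fL.
(* With this [k], the cut-off [eta] is 1 on the compact part above, where [(Mf + 1) * f >= 1], and 0
   where [f <= k^-1]. *)
pose k := 2 * (Mf + 1); have k0 : 0 < k by rewrite /k; lra.
pose eta p := clamp (k * f p - 1).
have ceta : continuous eta.
  move=> p; apply: (@continuous_comp _ _ _ (fun q => k * f q - 1) clamp); last exact: clamp_continuous.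
  apply: cvgB; last exact: cvg_cst.
  by apply: cvgM; [exact: cvg_cst|exact: cf].
have eta01 p : 0 <= eta p <= 1 by exact: clamp_bounds.
pose he p := h p * eta p; pose hr p := h p * (1 - eta p).
have che : continuous he by move=> p; apply: cvgM; [exact: ch|exact: ceta].
have chr : continuous hr.
  by move=> p; apply: cvgM; [exact: ch|apply: cvgB; [exact: cvg_cst|exact: ceta]].
have heK p : ~ K p -> he p = 0 by move=> Kp; rewrite /he hK// mul0r.
have hrK p : ~ K p -> hr p = 0 by move=> Kp; rewrite /hr hK// mul0r.
have -> : cint c h = cint c he + cint c hr.
  rewrite -(cintD Ac clK Kc che chr heK hrK); congr cint; apply/funext => p.
  by rewrite /he /hr -mulrDr addrC subrK mulr1.
apply: lerD.
  apply: (@le_trans _ _ (cint c' he)); last first.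
    apply: (cint_le Ac' clK Kc' che ch heK hK) => p; rewrite /he ler_piMr//.
    by case/andP: (eta01 p).
  pose K2 := K `&` [set p | k^-1 <= f p].
  apply: (@cint_le_int c c' K2) => //.
  + apply: closedI => //.
    rewrite (_ : [set p | k^-1 <= f p] = f @^-1` [set t | k^-1 <= t])//.
    by apply: preimage_closed; [move=> p _; exact: cf|exact: closed_ge].
  + by move=> p [/Kc].
  + by move=> p [/Kc'].
  + by move=> p [_]; apply: lt_le_trans; rewrite invr_gt0.
  + move=> p nK2; have [Kp|Kp] := pselect (K p); last exact: heK.
    rewrite /he /eta clamp0 ?mulr0// subr_le0.
    have : ~ (k^-1 <= f p) by move=> h1; apply: nK2.
    move=> /negP; rewrite -ltNge => /ltW fk.
    by rewrite -(@mulfV _ k) ?gt_eqF// ler_pM2l.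
  + by move=> p; rewrite /he mulr_ge0//; case/andP: (eta01 p).
apply: le_trans (ler_norm _) _; rewrite mulrC.
apply: (hint_small B0 (ltW d0) Mh0 (hB _ chr hrK)).
  move=> x Hx; apply: le_trans (hb x Hx); rewrite /ext0 /cfun /hr !normrM.
  apply: ler_wpM2l => //; apply: ler_wpM2r => //; rewrite ler_piMr//.
  have /andP[e0 e1] := eta01 (cinv c x).
  by rewrite ger0_norm ?subr_ge0//; lra.
move=> x Hx dx; have [cx|cx] := pselect (cimg c x); last by rewrite ext0_out.
rewrite ext0_in// /cfun; have [Kx|Kx] := pselect (K (cinv c x)); last by rewrite hrK// mul0r.
have Lx : (cinv c @` C) (cinv c x).
  exists x => //; split; last exact: ltW.
  by exists (cinv c x) => //; exact: cmapK.
have fx := fL _ Lx; have := hMf _ Lx.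
rewrite ger0_norm ?invr_ge0 ?(ltW fx)// => Mx.
rewrite /hr /eta clamp1 ?subrr ?mulr0 ?mul0r//.
have : 1 <= (Mf + 1) * f (cinv c x).
  by rewrite -ler_pdivrMr// div1r (le_trans Mx)// lerDl.
by rewrite /k; lra.
Qed.

(** The inequality for nonnegative functions is symmetric in the two charts; positive and negative
    parts give the general case. *)
Lemma cint_change c c' (K : set M) h : A c -> A c' -> closed K -> K `<=` cdom c ->
  K `<=` cdom c' -> continuous h -> (forall p, ~ K p -> h p = 0) ->
  cint c h = cint c' h.
Proof.
move=> Ac Ac' clK Kc Kc' ch hK.
pose hp p := Num.max 0 (h p); pose hn p := Num.max 0 (- h p).
have chp : continuous hp by move=> p; apply: continuous_max; [exact: cvg_cst|exact: ch].
have chn : continuous hn.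
  move=> p; apply: (@continuous_max _ _ (fun=> 0) (fun q => - h q)); first exact: cvg_cst.
  by apply: cvgN; exact: ch.
have hpK p : ~ K p -> hp p = 0 by move=> Kp; rewrite /hp hK// maxxx.
have hnK p : ~ K p -> hn p = 0 by move=> Kp; rewrite /hn hK// oppr0 maxxx.
have hp0 p : 0 <= hp p by rewrite le_max lexx.
have hn0 p : 0 <= hn p by rewrite le_max lexx.
have eq k : continuous k -> (forall p, ~ K p -> k p = 0) -> (forall p, 0 <= k p) ->
    cint c k = cint c' k.
  by move=> ck kK k0; apply/eqP; rewrite eq_le; apply/andP; split; exact: (@cint_change_le _ _ K).
have hE : h = fun p => hp p + (-1) * hn p.
  apply/funext => p; rewrite /hp /hn; case: (leP 0 (h p)) => a; case: (leP 0 (- h p)) => b; lra.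
have cz : continuous (fun p => (-1) * hn p).
  by move=> p; apply: cvgM; [exact: cvg_cst|exact: chn].
have zK p : ~ K p -> (-1) * hn p = 0 by move=> Kp; rewrite hnK// mulr0.
rewrite hE (cintD Ac clK Kc chp cz hpK zK) (cintD Ac' clK Kc' chp cz hpK zK).
by rewrite (cintZ _ Ac clK Kc chn hnK) (cintZ _ Ac' clK Kc' chn hnK) !eq.
Qed.

Section Partition.
Variables (N : nat) (ch : 'I_N -> chart) (chi : 'I_N -> M -> R).
Hypothesis P : partition_of_unity A ch chi.

Definition psupp i : set M := closure [set p | chi i p != 0].

Lemma psuppP i : [/\ A (ch i), closed (psupp i), psupp i `<=` cdom (ch i),
  continuous (chi i) & forall p, ~ psupp i p -> chi i p = 0].
Proof.
have [P1 P2 P3 P4 P5] := P; split => //.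
- exact: closed_closure.
- exact: P4.
- exact: smooth_function_continuous.
- move=> p np; apply/eqP; apply: contraT => n0; exfalso; apply: np.
  exact: subset_closure.
Qed.

End Partition.

(** Insert the sum of the [chi' j], move each product to the chart [c' j], and sum over [i] there.
    The outcome depends on the [h i] only through their sum. *)
Lemma cint_family (N N' : nat) (c : 'I_N -> chart) (chi : 'I_N -> M -> R)
    (c' : 'I_N' -> chart) (chi' : 'I_N' -> M -> R) (h : 'I_N -> M -> R) :
  partition_of_unity A c chi -> partition_of_unity A c' chi' ->
  (forall i, continuous (h i)) -> (forall i p, ~ psupp chi i p -> h i p = 0) ->
  \sum_i cint (c i) (h i) = \sum_j cint (c' j) (fun p => chi' j p * \sum_i h i p).
Proof.
move=> P P' hc hK.
have cM i j : continuous (fun p => chi' j p * h i p).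
  by move=> p; apply: cvgM; [have [_ _ _ cc _] := psuppP P' j; exact: cc|exact: hc].
transitivity (\sum_i \sum_j cint (c i) (fun p => chi' j p * h i p)).
  apply: eq_bigr => i _; have [Ai cl sub _ _] := psuppP P i.
  rewrite -(cint_sum _ Ai cl sub)//; last by move=> j p np; rewrite hK// mulr0.
  congr cint; apply/funext => p; rewrite -mulr_suml.
  by have [_ _ _ _ ->] := P'; rewrite mul1r.
rewrite exchange_big/=; apply: eq_bigr => j _.
have [Aj cl' sub' _ off'] := psuppP P' j.
transitivity (\sum_i cint (c' j) (fun p => chi' j p * h i p)).
  apply: eq_bigr => i _; have [Ai cl sub _ _] := psuppP P i.
  apply: (@cint_change _ _ (psupp chi i `&` psupp chi' j)) => //.
  - exact: closedI.
  - by move=> p [/sub].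
  - by move=> p [_ /sub'].
  - move=> p np; have [pi|pi] := pselect (psupp chi i p); last by rewrite hK// mulr0.
    have [pj|pj] := pselect (psupp chi' j p); first by exfalso; apply: np.
    by rewrite off'// mul0r.
rewrite -(cint_sum _ Aj cl' sub')//; last by move=> i p np; rewrite off'// mul0r.
by congr cint; apply/funext => p; rewrite mulr_sumr.
Qed.

(** Meant for the derivatives of the [chi i] along W, whose sum is the derivative of the constant
    1. *)
Lemma cint_family0 (N : nat) (c : 'I_N -> chart) (chi h : 'I_N -> M -> R) :
  partition_of_unity A c chi ->
  (forall i, continuous (h i)) -> (forall i p, ~ psupp chi i p -> h i p = 0) ->
  (forall p, \sum_i h i p = 0) -> \sum_i cint (c i) (h i) = 0.
Proof.
move=> P hc hK h0; rewrite (cint_family P P hc hK) big1// => j _.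
rewrite /cint /hint.
have -> : (fun x => ext0 (cimg (c j)) (cfun (c j) (fun p => chi j p * \sum_i h i p)) (habs x)) = (fun=> 0).
  by apply/funext => x; rewrite /ext0 /cfun h0 mulr0 mul0r mulr0.
by rewrite intn0 mulr0.
Qed.

Lemma cint_partition (N N' : nat) (c : 'I_N -> chart) (chi : 'I_N -> M -> R)
    (c' : 'I_N' -> chart) (chi' : 'I_N' -> M -> R) :
  partition_of_unity A c chi -> partition_of_unity A c' chi' ->
  \sum_i cint (c i) (chi i) = \sum_j cint (c' j) (chi' j).
Proof.
move=> P P'; rewrite (cint_family P P').
- apply: eq_bigr => j _; congr cint; apply/funext => p.
  by have [_ _ _ _ ->] := P; rewrite mulr1.
- by move=> i; have [] := psuppP P i.
- by move=> i; have [] := psuppP P i.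
Qed.

Lemma chart_volumeE c (K : set M) h : A c -> closed K -> K `<=` cdom c ->
  continuous h -> (forall p, ~ K p -> h p = 0) -> chart_volume g c h = (cint c h)%:E.
Proof.
move=> Ac clK Kc hc hK; have [B B0 hB] := cint_ucs Ac clK Kc.
apply: (integral_rV_hint B0 (hB _ hc hK)) => x nH; apply: ext0_out => cx.
by apply: nH; exact: cimg_half (chartP Ac) cx.
Qed.

Definition cface c h (y : 'rV[R]_m) : R :=
  \1_(cimg c) (vcons 0 y) *
    (h (cinv c (vcons 0 y)) * Num.sqrt (\det (face_metric g c y))).

Lemma cface_ucs c (K : set M) h : A c -> closed K -> K `<=` cdom c ->
  continuous h -> (forall p, ~ K p -> h p = 0) ->
  exists2 B, 0 <= B & ucs setT B (cface c h).
Proof.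
move=> Ac clK Kc hc hK; have [cK Kc2] := cmap_compact Ac clK Kc.
have [B B0 hB] := compact_ext0_ucs cK; exists B => //.
pose F x := h (cinv c x) * Num.sqrt (\det (\matrix_(a, b) g c x (lift ord0 a) (lift ord0 b) : 'M[R]_m)).
have FB : ucs H B (ext0 (cimg c) F).
  apply: hB => //; first by apply: relopen_cimg; exact: chartP.
    move=> x cx; apply: rel_contM => e e0; first exact: cinv_rel_cont (chartP Ac) hc cx e0.
    have sd : smooth_on (cimg c) (fun y => \det (\matrix_(a, b) g c y (lift ord0 a) (lift ord0 b) : 'M[R]_m)).
      apply: smooth_on_det => a b.
      by apply: smooth_on_congr (smooth_g Ac (lift ord0 a) (lift ord0 b)) => y _; rewrite mxE.
    apply: smooth_rel_cont e0 => //; apply: smooth_on_sqrt sd => y cy.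
    by apply: posdef_det; apply: posdef_minor; exact: posdef_g.
  move=> x cx nK; rewrite /F hK ?mul0r// => Kx; apply: nK.
  by exists (cinv c x) => //; exact: cmapK (chartP Ac) cx.
have sl (y : 'rV[R]_m) : H (vcons 0 y) by exact/vcons_half.
have := ucs_slice FB sl.
congr ucs; apply/funext => y; rewrite /ext0 /F /cface; congr (_ * (_ * _)).
by rewrite /face_metric faceE.
Qed.

Lemma chart_areaE c (K : set M) h : A c -> closed K -> K `<=` cdom c ->
  continuous h -> (forall p, ~ K p -> h p = 0) ->
  chart_area g c h = (intn (cface c h))%:E.
Proof.
move=> Ac clK Kc hc hK; have [B B0 sB] := cface_ucs Ac clK Kc hc hK.
rewrite -(integral_rVE B0 sB); congr integral_rV; apply/funext => y.
by rewrite /cface /= faceE.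
Qed.

Lemma smooth_on_local (D : set 'rV[R]_m.+1) (F : 'rV[R]_m.+1 -> R) :
  (forall x, D x -> exists V, [/\ open V, V x & smooth_on (D `&` V) F]) -> smooth_on D F.
Proof.
move=> h; apply: smooth_onI => x Dx; have [V [oV Vx sV]] := h x Dx.
have [U [G [oU Ux kG FG]]] := smooth_onP sV (conj Dx Vx).
exists (U `&` V), G; split=> //; first exact: openI.
- by move=> k; apply: Ck_sub (kG k) => y [].
- by move=> y [Uy Vy] Dy; apply: FG.
Qed.

Lemma bump_exists p : exists c b, [/\ A c, smooth_function A b,
  (forall q, 0 <= b q), closure [set q | b q != 0] `<=` cdom c & 0 < b p].
Proof.
have [c Ac cp] := manifold_cover sm p; have cc := chartP Ac; exists c.
set a := cmap c p; have ca : cimg c a by exact: cimg_cmap.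
have [r2 r20 hr2] := relopen_nbhs (relopen_cimg cc) ca.
pose r := r2 / 2; have r0 : 0 < r by rewrite divr_gt0.
(* A compact cube inside the chart. Its image in the Hausdorff space [M] is closed, so the bump
   vanishes on an open set reaching beyond the chart and is smooth in every other chart. *)
pose K := [set x : 'rV[R]_m.+1 | `|a - x| <= r] `&` H.
have Kc : K `<=` cimg c.
  by move=> x [/= ax Hx]; apply: hr2 => //; apply: le_lt_trans ax _; rewrite /r; lra.
have cK : compact K.
  apply: compact_closedI; last exact: closed_half.
  apply: (@subclosed_compact _ _ [set x : 'rV[R]_m.+1 | `|x| <= `|a| + r]).
  - rewrite (_ : [set x : 'rV[R]_m.+1 | `|a - x| <= r] =
      (fun x => r - `|a - x|) @^-1` [set t | 0 <= t]); last first.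
      by apply/seteqP; split=> x /=; rewrite subr_ge0.
    apply: preimage_closed; last exact: closed_ge.
    by move=> x _; exact: continuous_distB.
  - exact: compact_ball.
  - move=> x /= ax; rewrite -[x](subKr a); apply: le_trans (ler_normB _ _) _.
    by rewrite lerD2l.
have cKM : compact (cinv c @` K).
  apply: continuous_compact => //; have [_ _ _ _ ci] := cc.
  by apply: continuous_subspaceW ci => x /Kc.
have clKM : closed (cinv c @` K).
  by apply: compact_closed => //; exact: manifold_hausdorff sm.
have KMc : cinv c @` K `<=` cdom c by move=> _ [x Kx <-]; apply: cdom_cinv => //; exact: Kc.
pose b q := if `[< cdom c q >] then bump a r (cmap c q) else 0.
have bc q : cdom c q -> b q = bump a r (cmap c q) by move=> cq; rewrite /b asboolT.
have bK q : ~ (cinv c @` K) q -> b q = 0.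
  move=> nK; have [cq|cq] := pselect (cdom c q); last by rewrite /b asboolF.
  rewrite bc//; apply/eqP; apply: contraT => n0; exfalso; apply: nK.
  exists (cmap c q); last exact: cinvK.
  split; last by apply: (cimg_half cc); exact: cimg_cmap.
  by rewrite /=; apply/ltW; exact: bump_supp n0.
exists b; split=> //.
- move=> c' Ac'; have cc' := chartP Ac'; apply: smooth_on_local => x c'x.
  have [cx|cx] := pselect (cdom c (cinv c' x)).
    have ox : overlap c' c x by rewrite overlapE.
    have oD := relopen_overlap cc' cc.
    have [V oV VE] := oD.
    exists V; split=> //; first by move: ox; rewrite VE => -[].
    apply: (@smooth_on_sub _ _ (overlap c' c)).
      by move=> y [c'y Vy]; rewrite VE; split=> //; exact: cimg_half c'y.
    apply: (@smooth_on_congr _ _ _ (fun y => bump a r (trans c' c y))).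
      move=> y; rewrite overlapE// => -[c'y cy].
      by rewrite /= bc.
    apply: smooth_on_comp_global; first by move=> k; exact: Ck_bump.
    by move=> j; exact: smooth_trans.
  have nK : (~` (cinv c @` K)) (cinv c' x) by move=> /KMc.
  have [d d0 hd] := cinv_open cc' (closed_openC clKM) c'x nK.
  exists (ball x d); split; [exact: ball_open|exact: ballxx|].
  apply: (@smooth_on_congr _ _ _ (fun=> 0)); last exact: smooth_on_cst.
  move=> y [c'y]; rewrite -ball_normE => xy; rewrite /= bK//.
  by have [] := hd y xy (cimg_half cc' c'y).
- move=> q; have [cq|cq] := pselect (cdom c q); last by rewrite /b asboolF.
  by rewrite bc// bump_ge0.
- apply: subset_trans KMc.
  have <- : closure (cinv c @` K) = cinv c @` K by apply/esym/closure_id.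
  apply: closureS => q /= bq; apply: contrapT => nK.
  by move: bq; rewrite bK// eqxx.
- by rewrite bc// -/a bump_gt0.
Qed.

(** Makes the sets from which [volume] and [boundary_area] select a value nonempty. *)
Lemma partition_exists : exists N (c : 'I_N -> chart) chi, partition_of_unity A c chi.
Proof.
have /choice[c hc] := bump_exists.
have /choice[b hb] := hc.
have cb p : continuous (b p) by have [_ sb _ _ _] := hb p; exact: smooth_function_continuous.
have [s _ hs] : exists2 s : seq M, forall i, i \in s -> [set: M] i &
    forall y : M, [set: M] y -> exists2 i, i \in s & (fun p => [set q | 0 < b p q]) i y.
  apply: compact_seq_cover => //.
    move=> p _; rewrite (_ : [set q | 0 < b p q] = b p @^-1` [set t | 0 < t])//.
    by apply: (@open_comp _ _ (b p) [set t | 0 < t]); [move=> q _; exact: cb|exact: open_gt].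
  by move=> p _; exists p => //; have [] := hb p.
pose N := size s; pose pt (i : 'I_N) := tnth (in_tuple s) i.
pose S q := \sum_(i < N) b (pt i) q.
have b0 p q : 0 <= b p q by have [] := hb p.
have S0 q : 0 < S q.
  have [p ps bp] := hs q I.
  have ip : (index p s < N)%N by rewrite index_mem.
  have pE : pt (Ordinal ip) = p by rewrite /pt (tnth_nth p)/= nth_index.
  rewrite /S (bigD1 (Ordinal ip))//= pE ltr_pwDl// sumr_ge0//.
exists N, (fun i => c (pt i)), (fun i q => b (pt i) q / S q); split.
- by move=> i; have [] := hb (pt i).
- move=> i c' Ac'; apply: smooth_onM.
    by have [_ sb _ _ _] := hb (pt i); exact: sb.
  apply: smooth_onV; first by move=> x _; rewrite gt_eqF.
  by apply: smooth_on_sum => j; have [_ sb _ _ _] := hb (pt j); exact: sb.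
- by move=> i q; rewrite divr_ge0// ltW.
- move=> i; have [_ _ _ + _] := hb (pt i); apply: subset_trans.
  apply: closureS => q /=; apply: contra => /eqP ->; by rewrite mul0r.
- by move=> q; rewrite -mulr_suml -/(S q) divff// gt_eqF.
Qed.

End Manifold.

(** * The divergence theorem and the boundary *)

Lemma within_all (R : realType) (S P : set R) : (forall t, S t -> P t) ->
  within S (0 : R)^' P.
Proof. by move=> h; apply: (@filterE _ (0 : R)^' _ (fun t => S t -> P t)). Qed.

Section ChartDivergence.
Context {R : realType} {m : nat}.
Notation n := m.+1.
Notation H := (@half_space R m).
Variables (D : set 'rV[R]_n) (G : 'rV[R]_n -> 'M[R]_n).
Hypothesis oD : relopen D.
Hypothesis sG : smooth_mx D G.
Hypothesis pG : forall x, D x -> posdef (G x).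
Implicit Types (x : 'rV[R]_n) (h : 'rV[R]_n -> R).

(** The outward direction is opposite to the coordinate [ord0], whence the sign; tangential
    derivatives integrate to zero. *)
Lemma hint_dvg (K : set 'rV[R]_n) (Y : 'I_n -> 'rV[R]_n -> R) : compact K -> K `<=` D ->
  (forall j, smooth_on D (Y j)) -> (forall j x, D x -> ~ K x -> Y j x = 0) ->
  hint (ext0 D (fun x => dens G x * dvg D G Y x)) =
  - intn (fun y => ext0 D (fun x => dens G x * Y ord0 x) (vcons 0 y)).
Proof.
move=> cK KD sY YK; have [B B0 hB] := compact_norm_bound cK.
have sd := smooth_dens sG pG.
pose F j x := dens G x * Y j x.
have sF j : smooth_on D (F j) by exact: smooth_onM.
have FK j x : D x -> ~ K x -> F j x = 0 by move=> Dx nK; rewrite /F YK// mulr0.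
have sE j : smooth_on H (ext0 D (F j)) := smooth_ext0 oD cK KD (sF j) (FK j).
have uE j : supp H B (ext0 D (F j)).
  move=> x _ Bx; apply: (ext0_off (FK j)) => Kx.
  by have := hB _ Kx; rewrite leNgt Bx.
rewrite (@eq_hint _ _ _ (fun x => \sum_j partial H j (ext0 D (F j)) x)); last first.
  move=> x Hx; have [Dx|Dx] := pselect (D x); last first.
    rewrite ext0_out// big1// => j _.
    by rewrite (partial_ext0 _ oD cK KD (sF j) (FK j) Hx) ext0_out.
  rewrite ext0_in// -partial_dens_dvg//; apply: eq_bigr => j _.
  by rewrite (partial_ext0 _ oD cK KD (sF j) (FK j) Hx) ext0_in.
have uP j : ucs H B (partial H j (ext0 D (F j))).
  apply: smooth_ucs => //; first by apply: smooth_on_partial => //; exact: relopen_H.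
  exact: partial_supp.
rewrite (hint_sum _ B0 uP) big_ord_recl (hint_partial0 B0)// big1 ?addr0// => a _.
exact: (hint_partial_lift a B0).
Qed.

Section Face.
Variables (f : 'rV[R]_n -> R) (x : 'rV[R]_n).
Hypothesis sf : smooth_on D f.
Hypothesis Dx : D x.
Hypothesis x0 : x 0 ord0 = 0.
Hypothesis fface : forall y, D y -> y 0 ord0 = 0 -> f y = 0.
Hypothesis f0 : forall y, D y -> 0 <= f y.

Lemma partial_face (a : 'I_m) : partial D (lift ord0 a) f x = 0.
Proof.
have PF := line_within (lift ord0 a) oD Dx.
have h := partial_cvg (i := lift ord0 a) oD sf Dx.
have z : t^-1 * (f (x + t *: ed (lift ord0 a)) - f x) @[t -->
    within [set t : R | D (x + t *: ed (lift ord0 a))] 0^'] --> (0 : R).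
  apply: (@cvg_near_cst R R _ _ _ PF); apply: within_all => t St.
  rewrite !fface ?subrr ?mulr0//.
  by rewrite rvD rvZ edE (negbTE (neq_lift ord0 a)) mulr0 addr0.
exact: (cvg_unique _ h z).
Qed.

Lemma partial_face0 : 0 <= partial D ord0 f x.
Proof.
have PF := line_within ord0 oD Dx.
have h := partial_cvg (i := ord0) oD sf Dx.
rewrite -(cvg_lim _ h)//; apply: limr_ge; first by apply/cvg_ex; eexists; exact: h.
apply: within_all => t St; rewrite [f x]fface// subr0 mulr_ge0 ?f0// invr_ge0.
by have := relopen_half oD St; rewrite rvD rvZ edE eqxx mulr1 x0 add0r.
Qed.

Lemma grad_face : grad D G f ord0 x = invmx (G x) ord0 ord0 * partial D ord0 f x.
Proof.
rewrite /grad big_ord_recl big1 ?addr0// => a _.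
by rewrite partial_face mulr0.
Qed.

Lemma inner_face : inner D G f f x = invmx (G x) ord0 ord0 * partial D ord0 f x ^+ 2.
Proof.
rewrite /inner big_ord_recl big1 ?addr0 => [|a _].
  by rewrite grad_face expr2 mulrA.
by rewrite partial_face mulr0.
Qed.

Lemma invmx00 (B : 'M[R]_n) : B \in unitmx ->
  invmx B ord0 ord0 * \det B = \det (\matrix_(a < m, b < m) B (lift ord0 a) (lift ord0 b)).
Proof.
move=> uB; rewrite /invmx uB !mxE /cofactor addn0 expr0 mul1r.
rewrite mulrC mulrA mulfV ?mul1r; last by rewrite -unitfE -unitmxE.
by congr (\det _); apply/matrixP => a b; rewrite !mxE.
Qed.

(** Identifies the flux density of grad f. The cofactor formula expresses the face determinant as
    the (0,0) entry of the inverse metric times the full determinant; only the normal derivative of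
    [f] survives on the face, and it is nonnegative, so it can be taken out of the square root. *)
Lemma dens_face : dens G x * grad D G f ord0 x =
  Num.sqrt (inner D G f f x) *
  Num.sqrt (\det (\matrix_(a < m, b < m) G x (lift ord0 a) (lift ord0 b))).
Proof.
have uG := posdef_unit (pG Dx); have dG := posdef_det (pG Dx).
rewrite -(invmx00 uG) grad_face inner_face.
have P0 : 0 <= invmx (G x) ord0 ord0.
  rewrite -(pmulr_lge0 _ dG) (invmx00 uG); apply/ltW/posdef_det.
  exact: posdef_minor (pG Dx).
rewrite !(sqrtrM _ P0) sqrtr_sqr (ger0_norm partial_face0) /dens.
rewrite -[in LHS](sqr_sqrtr P0); ring.
Qed.

Hypothesis lap : laplacian D G f x = 0.
Hypothesis ric : traceless G x (hessian D G f x) = 0.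

Lemma partial_inner_face i : partial D i (inner D G f f) x = 0.
Proof.
have h0 : hessian D G f x = 0.
  by move: ric; rewrite /traceless -/(laplacian D G f x) lap mul0r scale0r subr0.
rewrite partial_inner// big1 ?mulr0// => k _.
by rewrite h0 mxE mul0r.
Qed.

End Face.

End ChartDivergence.

(** * Chart-independent functions *)

Section SmoothFunctions.
Context {R : realType} {m : nat} {M : topologicalType}.
Notation H := (@half_space R m).
Notation chart := (chart R m M).
Variables (A : set chart) (g : chart -> 'rV[R]_m.+1 -> 'M[R]_m.+1).
Hypothesis sm : smooth_manifold A.
Hypothesis rm : riemannian_metric A g.
Implicit Types (c : chart) (p q : M) (x y : 'rV[R]_m.+1) (h k a b : M -> R).

Notation loc c h := (fun x => h (cinv c x)).
Notation ginner c a b := (inner (cimg c) (g c) (loc c a) (loc c b)).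

Lemma smooth_loc c h : A c -> smooth_function A h -> smooth_on (cimg c) (loc c h).
Proof. by move=> Ac sh; exact: sh. Qed.

Lemma glue (F : chart -> 'rV[R]_m.+1 -> R) :
  (forall c c' x, A c -> A c' -> overlap c c' x -> F c x = F c' (trans c c' x)) ->
  exists h, forall c x, A c -> cimg c x -> h (cinv c x) = F c x.
Proof.
move=> FF; have /choice[k hk] : forall p, exists c, A c /\ cdom c p.
  by move=> p; have [c Ac cp] := manifold_cover sm p; exists c.
exists (fun p => F (k p) (cmap (k p) p)) => c x Ac cx.
have [Ak kp] := hk (cinv c x); have cc := chartP sm Ac.
by rewrite (FF c (k (cinv c x)))// overlapE.
Qed.

Lemma partial_trans a c c' x i : smooth_function A a -> A c -> A c' -> overlap c c' x ->
  partial (cimg c) i (loc c a) x =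
  \sum_j Defs.jacobian c c' x i j * partial (cimg c') j (loc c' a) (trans c c' x).
Proof.
move=> sa Ac Ac' ox; have cc := chartP sm Ac; have cc' := chartP sm Ac'.
have oD := relopen_overlap cc cc'; have oC := relopen_cimg cc; have oC' := relopen_cimg cc'.
have sub : overlap c c' `<=` cimg c by move=> y; exact: overlap_cimg.
have sc := smooth_loc Ac sa; have sc' := smooth_loc Ac' sa.
rewrite -(partial_sub i oC oD sub sc ox).
rewrite (@partial_congr _ _ _ _ (fun y => (loc c' a) (trans c c' y)) x i oD _ ox); first last.
- by move=> y oy; rewrite cinv_trans.
- exact: smooth_on_sub sc.
rewrite (@partial_chain _ _ _ (cimg c') (loc c' a) (trans c c'))//.
- by apply: eq_bigr => j _; rewrite mxE.
- by move=> y; exact: overlap_cimgr.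
- by move=> j; exact: (smooth_trans sm).
Qed.

Lemma inner_mx (D : set 'rV[R]_m.+1) (G : 'rV[R]_m.+1 -> 'M[R]_m.+1)
    (a b : 'rV[R]_m.+1 -> R) x :
  (invmx (G x))^T = invmx (G x) ->
  inner D G a b x = ((\row_i partial D i a x) *m invmx (G x) *m (\row_i partial D i b x)^T) 0 0.
Proof.
move=> sP; rewrite /inner mxE; apply: eq_bigr => j _; rewrite !mxE; congr (_ * _).
by apply: eq_bigr => k _; rewrite mxE mulrC -[in RHS]sP mxE.
Qed.

Lemma inner_trans a b c c' x : smooth_function A a -> smooth_function A b ->
  A c -> A c' -> overlap c c' x -> ginner c a b x = ginner c' a b (trans c c' x).
Proof.
move=> sa sb Ac Ac' ox; have cc := chartP sm Ac; have cc' := chartP sm Ac'.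
have cx := overlap_cimg ox; have c'x := overlap_cimgr cc ox.
have pG := posdef_g rm Ac cx; have pG' := posdef_g rm Ac' c'x.
rewrite !inner_mx; [|by rewrite trmx_inv pG'.1|by rewrite trmx_inv pG.1].
have GE := metric_change rm Ac Ac' ox.
set J := Defs.jacobian c c' x in GE.
have dE h : smooth_function A h -> (\row_i partial (cimg c) i (loc c h) x : 'rV[R]_m.+1) =
    (\row_i partial (cimg c') i (loc c' h) (trans c c' x)) *m J^T.
  move=> sh; apply/rowP => i; rewrite !mxE (partial_trans i sh Ac Ac' ox).
  by apply: eq_bigr => j _; rewrite !mxE mulrC.
rewrite (dE a sa) (dE b sb) trmx_mul trmxK.
set da := \row_i _; set db := \row_i _.
have uG := posdef_unit pG; have uG' := posdef_unit pG'.
have uJ : J \in unitmx.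
  by move: uG; rewrite GE unitmx_mul unitmx_tr => /andP[].
(* The transformation law of the inverse metric; it compensates the factors [J^T] picked up by the
   two differentials. *)
have PE : J^T *m invmx (g c x) *m J = invmx (g c' (trans c c' x)).
  have E : J^T *m invmx (g c x) *m J *m g c' (trans c c' x) = 1%:M.
    have E2 : J *m g c' (trans c c' x) = g c x *m invmx J^T.
      by rewrite GE mulmxK// unitmx_tr.
    by rewrite -mulmxA E2 -mulmxA mulKmx// mulmxV// unitmx_tr.
  by rewrite -[LHS](mulmxK uG') E mul1mx.
by rewrite -PE !mulmxA.
Qed.

(** Supplies the squared norm of grad f, and the derivatives of partition functions along gradients,
    as functions on [M]; change of charts for integrals is stated for such functions. *)
Lemma inner_exists a b : smooth_function A a -> smooth_function A b ->
  exists2 h, smooth_function A h &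
  forall c x, A c -> cimg c x -> h (cinv c x) = ginner c a b x.
Proof.
move=> sa sb; have [h hE] := @glue (fun c x => ginner c a b x)
  (fun c c' x Ac Ac' ox => inner_trans sa sb Ac Ac' ox).
exists h => // c Ac; have cc := chartP sm Ac.
apply: (@smooth_on_congr _ _ _ (ginner c a b)).
  by move=> x cx; rewrite /= hE.
apply: smooth_inner.
- exact: relopen_cimg.
- exact: (smooth_g rm Ac).
- by move=> x; exact: (posdef_g rm Ac).
- exact: smooth_loc.
- exact: smooth_loc.
Qed.

End SmoothFunctions.

(** * Functions with vanishing tangential derivatives on a face *)

Section LocallyConstant.
Context {R : realType} {m : nat}.
Variables (D : set 'rV[R]_m.+1) (h : 'rV[R]_m.+1 -> R).
Hypothesis oD : relopen D.
Hypothesis sh : smooth_on D h.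

Lemma is_derive_face (w : 'rV[R]_m) (a : 'I_m) : D (vcons 0 w) ->
  is_derive w (ed a) (fun z => h (vcons 0 z)) (partial D (lift ord0 a) h (vcons 0 w)).
Proof.
move=> Dw; have [r r0 hr] := relopen_nbhs oD Dw.
have := partial_cvg (i := lift ord0 a) oD sh Dw.
have E t : vcons 0 w + t *: ed (lift ord0 a) = vcons 0 (w + t *: ed a) :> 'rV[R]_m.+1.
  apply/rowP => i; rewrite rvD rvZ edE.
  case: (unliftP ord0 i) => [j ->|->]; last first.
    by rewrite !vcons0 (negbTE (neq_lift ord0 a)) mulr0 addr0.
  by rewrite !vconsS rvD rvZ edE (inj_eq (@lift_inj _ ord0)).
move=> /within_cvg qL; apply: cvg_derive.
have -> : (fun t : R => t^-1 * (h (vcons 0 (w + t *: ed a)) - h (vcons 0 w))) =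
  (fun t => t^-1 * (h (vcons 0 w + t *: ed (lift ord0 a)) - h (vcons 0 w))).
  by apply/funext => t; rewrite E.
apply: qL; apply/nbhs_ballP; exists r => // t; rewrite /ball/= sub0r normrN => tr.
apply: hr; first by rewrite opprD addNKr normrN norm_ed.
by rewrite E vcons0.
Qed.

(** The mean value theorem is applied in the face coordinates: the box between two face points of
    the ball remains in the face and in [D]. *)
Lemma face_constant (x y : 'rV[R]_m.+1) (r : R) : D x -> x 0 ord0 = 0 -> y 0 ord0 = 0 ->
  (forall z, `|x - z| < r -> half_space z -> D z) -> `|x - y| < r ->
  (forall z (a : 'I_m), D z -> z 0 ord0 = 0 -> partial D (lift ord0 a) h z = 0) ->
  h y = h x.
Proof.
move=> Dx x0 y0 hr xy dh.
have xE := vconsP x; have yE := vconsP y; rewrite x0 in xE; rewrite y0 in yE.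
set wx := \row_i _ in xE; set wy := \row_i _ in yE.
have r0 : 0 < r by apply: le_lt_trans xy.
have zD z : between wx wy z -> D (vcons 0 z).
  move=> bz; apply: hr; last by apply/vcons_half.
  rewrite xE vconsB subrr vcons_norm_lt ?normr0//.
  apply: (between_ball bz); first by rewrite subrr normr0.
  by apply: le_lt_trans xy; rewrite xE yE vconsB; exact: vcons_normr.
have dz z : between wx wy z -> forall i, derivable (fun w => h (vcons 0 w)) z (ed i).
  by move=> bz i; have [] := is_derive_face i (zD z bz).
have [xi hxi E] := mvt_path dz.
rewrite xE yE; apply/eqP; rewrite -subr_eq0; apply/eqP; rewrite E big1// => j _.
have [_ ->] := is_derive_face j (zD _ (hxi j)).
by rewrite dh ?mulr0//; [exact: zD|exact: vcons0].
Qed.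

End LocallyConstant.

(** * Static perfect fluids *)

Section PerfectFluid.
Context {R : realType} {m : nat} {M : topologicalType}.
Notation H := (@half_space R m).
Notation chart := (chart R m M).
Variables (A : set chart) (g : chart -> 'rV[R]_m.+1 -> 'M[R]_m.+1).
Variables (f rho : M -> R) (Lambda Rmin : R).
Hypothesis hcompact : compact [set: M].
Hypothesis horiented : oriented A.
Hypothesis hspf : static_perfect_fluid A g f rho.
Hypothesis hconnected : connected (boundary A).
Hypothesis hscal : forall c x, A c -> cimg c x -> 0 < scal g c x.
Hypothesis hLambda : 0 < Lambda.
Hypothesis hrho : forall c x, A c -> cimg c x ->
  (m.+1%:R - 2) / (2 * (m.+1%:R - 1)) * scal g c x
  + m.+1%:R / (m.+1%:R - 1) * rho (cinv c x) = - Lambda.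
Hypothesis hRmin : is_min_scal A g Rmin.
Implicit Types (c : chart) (p q : M) (x y : 'rV[R]_m.+1).

Notation loc c h := (fun x => h (cinv c x)).

Let sm : smooth_manifold A := spf_manifold hspf.
Let rm : riemannian_metric A g := spf_metric hspf.
Let sf : smooth_function A f := spf_smooth_f hspf.
Let cf : continuous f := smooth_function_continuous sm sf.

Lemma fluid_zero p : f p = 0 <-> boundary A p.
Proof.
have := spf_zero hspf => /seteqP[h1 h2]; split; first exact: h1.
by move=> /h2.
Qed.

Lemma fluid_ge0 p : 0 <= f p.
Proof.
have [bp|bp] := pselect (boundary A p); first by rewrite (iffRL (fluid_zero p) bp).
exact/ltW/(spf_pos hspf).
Qed.

Lemma fluid_pos c x : A c -> cimg c x -> (0 < f (cinv c x)) = (0 < x 0 ord0).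
Proof.
move=> Ac cx; have cc := chartP sm Ac; have Hx : 0 <= x 0 ord0 := cimg_half cc cx.
have [x0|x0] := ltP 0 (x 0 ord0).
  rewrite lt_neqAle fluid_ge0 andbT eq_sym; apply/eqP => /fluid_zero b.
  have := boundary_coord sm horiented Ac (cdom_cinv cc cx) b.
  by rewrite cmapK// => e; rewrite e ltxx in x0.
have x00 : x 0 ord0 = 0 by apply/eqP; rewrite eq_le x0.
have -> : f (cinv c x) = 0; last by rewrite ltxx.
by apply/fluid_zero; exists c => //; split; [exact: cdom_cinv|rewrite cmapK].
Qed.

Lemma fluid_lap c x : A c -> cimg c x ->
  laplacian (cimg c) (g c) (loc c f) x = - Lambda * f (cinv c x).
Proof. by move=> Ac cx; rewrite (spf_laplacian hspf Ac cx) (hrho Ac cx). Qed.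

Lemma fluid_face c x : A c -> cimg c x -> x 0 ord0 = 0 -> f (cinv c x) = 0.
Proof.
move=> Ac cx x0; apply/eqP; rewrite eq_le fluid_ge0 andbT leNgt (fluid_pos Ac cx) x0.
by rewrite ltxx.
Qed.

Lemma Rmin_gt0 : 0 < Rmin.
Proof. by have [[c [x [Ac cx <-]]] _] := hRmin; exact: hscal. Qed.

Variable u : M -> R.
Hypothesis su : smooth_function A u.
Hypothesis uE : forall c x, A c -> cimg c x ->
  u (cinv c x) = inner (cimg c) (g c) (loc c f) (loc c f) x.

Lemma u_ge0 p : 0 <= u p.
Proof.
have [c Ac cp] := manifold_cover sm p; have cc := chartP sm Ac.
rewrite -(cinvK cc cp) uE//; last exact: cimg_cmap.
have pg y : cimg c y -> posdef (g c y) by move=> cy; exact: (posdef_g rm Ac).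
exact: (inner_ge0 pg _ (cimg_cmap cp)).
Qed.

Lemma partial_u_face c x (i : 'I_m.+1) : A c -> cimg c x -> x 0 ord0 = 0 ->
  partial (cimg c) i (loc c u) x = 0.
Proof.
move=> Ac cx x0; have cc := chartP sm Ac; have fx := fluid_face Ac cx x0.
rewrite (@partial_congr _ _ _ _ (inner (cimg c) (g c) (loc c f) (loc c f)) x i)//.
- apply: partial_inner_face => //.
  + exact: relopen_cimg.
  + exact: (smooth_g rm Ac).
  + by move=> y; exact: (posdef_g rm Ac).
  + exact: (sf Ac).
  + by rewrite fluid_lap// fx mulr0.
  + by rewrite -(spf_ricci hspf Ac cx) fx scale0r.
- exact: relopen_cimg.
- exact: (su Ac).
- by move=> y cy; rewrite uE.
Qed.

Lemma u_locally_constant p : boundary A p ->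
  exists2 Q : set M, open Q & Q p /\ forall q, Q q -> boundary A q -> u q = u p.
Proof.
move=> bp; have [c Ac cp] := manifold_cover sm p; have cc := chartP sm Ac.
have cx := cimg_cmap cp; set x := cmap c p in cx.
have x0 : x 0 ord0 = 0 := boundary_coord sm horiented Ac cp bp.
have [r r0 hr] := relopen_nbhs (relopen_cimg cc) cx.
have [Q oQ [Qp hQ]] := cmap_open cc (ball_open x r) cp (ballxx x r0).
exists Q => //; split=> // q Qq bq; have [cq] := hQ q Qq; rewrite -ball_normE => xq.
rewrite -(cinvK cc cp) -(cinvK cc cq).
apply: (@face_constant _ _ (cimg c) (loc c u) (relopen_cimg cc) (su Ac) x (cmap c q) r) => //.
- exact: (boundary_coord sm horiented Ac).
- by move=> z a cz z0; exact: partial_u_face.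
Qed.

Lemma u_boundary p q : boundary A p -> boundary A q -> u q = u p.
Proof.
move=> bp bq; pose B := [set q | boundary A q /\ u q = u p].
have cu := smooth_function_continuous sm su.
suff E : B = boundary A by have : B q; [rewrite E|move=> []].
(* [B] is nonempty, relatively open by [u_locally_constant] and relatively closed by continuity of
   [u]. *)
apply: hconnected.
- by exists p.
- exists [set q | boundary A q -> u q = u p]°; first exact: open_interior.
  apply/seteqP; split=> z.
    move=> [bz uz]; split=> //; have [Q oQ [Qz hQ]] := u_locally_constant bz.
    apply: (nbhs_mono (open_nbhs_nbhs (conj oQ Qz))) => w Qw bw.
    by rewrite (hQ w Qw bw).
  by move=> [bz /interior_subset h]; split=> //; exact: h.
- exists (u @^-1` [set u p]); last by [].
  by apply: preimage_closed; [move=> z _; exact: cu|exact: closed_eq].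
Qed.

Section Flux.
Variables (beta K : R).
Notation W c := (fluid_field (cimg c) (g c) (loc c f) beta K).

Lemma smooth_W c j : A c -> smooth_on (cimg c) (W c j).
Proof.
move=> Ac; apply: smooth_fluid_field => //.
- by apply: relopen_cimg; exact: (chartP sm Ac).
- exact: (smooth_g rm Ac).
- by move=> y; exact: (posdef_g rm Ac).
- exact: (sf Ac).
Qed.

Lemma grad_u c j x : A c -> cimg c x ->
  grad (cimg c) (g c) (inner (cimg c) (g c) (loc c f) (loc c f)) j x =
  grad (cimg c) (g c) (loc c u) j x.
Proof.
move=> Ac cx; apply: eq_bigr => k _; congr (_ * _).
apply/esym/partial_congr => //.
- by apply: relopen_cimg; exact: (chartP sm Ac).
- exact: (su Ac).
- by move=> y cy; rewrite uE.
Qed.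

(* W h only involves the inner products of grad h with grad u and grad f, so it
   does not depend on the chart. *)
Lemma W_derivative (h : M -> R) : smooth_function A h ->
  exists2 d : M -> R, continuous d & forall c x, A c -> cimg c x ->
    d (cinv c x) = \sum_j W c j x * partial (cimg c) j (loc c h) x.
Proof.
move=> sh; have [du sdu duE] := inner_exists sm rm su sh.
have [df sdf dfE] := inner_exists sm rm sf sh.
have cu := smooth_function_continuous sm su.
have cdu := smooth_function_continuous sm sdu.
have cdf := smooth_function_continuous sm sdf.
exists (fun p => 2^-1 * f p * du p - (u p + beta / 2 * f p ^+ 2 - 3 * K) * df p).
  move=> p; apply: cvgB.
    by apply: cvgM; [apply: cvgM; [exact: cvg_cst|exact: cf]|exact: cdu].
  apply: cvgM; last exact: cdf.
  apply: cvgB; last exact: cvg_cst.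
  apply: cvgD; first exact: cu.
  by apply: cvgM; [exact: cvg_cst|apply: cvgM; exact: cf].
move=> c x Ac cx; rewrite duE// dfE// uE// /inner /fluid_field.
transitivity (\sum_j (2^-1 * f (cinv c x) *
    (grad (cimg c) (g c) (loc c u) j x * partial (cimg c) j (loc c h) x)
  - (inner (cimg c) (g c) (loc c f) (loc c f) x +
       beta / 2 * f (cinv c x) ^+ 2 - 3 * K) *
    (grad (cimg c) (g c) (loc c f) j x * partial (cimg c) j (loc c h) x))).
  by rewrite sumrB -!mulr_sumr.
by apply: eq_bigr => j _; rewrite grad_u//; ring.
Qed.

Lemma W_derivative_off (h d : M -> R) p : smooth_function A h ->
  (forall c x, A c -> cimg c x ->
    d (cinv c x) = \sum_j W c j x * partial (cimg c) j (loc c h) x) ->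
  ~ closure [set q | h q != 0] p -> d p = 0.
Proof.
move=> sh dE np; have [c Ac cp] := manifold_cover sm p; have cc := chartP sm Ac.
have cx := cimg_cmap cp.
rewrite -(cinvK cc cp) dE// big1// => j _.
have np' : (~` closure [set q | h q != 0]) (cinv c (cmap c p)) by rewrite cinvK.
have [r r0 hr] := cinv_open cc (closed_openC (@closed_closure _ _)) cx np'.
have oD := relopen_cimg cc.
have hP := @partial_ext _ _ (cimg c) (ball (cmap c p) r) (loc c h) (fun=> 0) (cmap c p) j
  oD cx (ball_open _ _) (ballxx _ r0).
rewrite (hP _ _).2 ?derive_cst ?mulr0//.
move=> y; rewrite -ball_normE => xy cy; have [_ ny] := hr y xy (cimg_half cc cy).
apply/eqP; rewrite eq_sym; apply: contraT => n0; exfalso; apply: ny.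
exact: subset_closure.
Qed.

Section Divergence.
Variables (N : nat) (c : 'I_N -> chart) (chi : 'I_N -> M -> R).
Hypothesis P : partition_of_unity A c chi.
Hypothesis uK : forall p, boundary A p -> u p = K.
Variables (q : M -> R).
Hypothesis cq : continuous q.
Hypothesis qW : forall c x, A c -> cimg c x -> q (cinv c x) <= dvg (cimg c) (g c) (W c) x.

(** The divergence theorem for W multiplied by [chi i]: the product rule gives [chi i] times div W,
    bounded below by [chi i * q], plus the derivative [d] of [chi i] along W. *)
Lemma divergence_chart i (d : M -> R) : continuous d ->
  (forall c x, A c -> cimg c x ->
    d (cinv c x) = \sum_j W c j x * partial (cimg c) j (loc c (chi i)) x) ->
  cint g (c i) (fun p => chi i p * q p) <=
  - (2 * K * Num.sqrt K) * intn (cface g (c i) (chi i)) - cint g (c i) d.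
Proof.
move=> cd dE; have [Ai cl sub cchi off] := psuppP sm P i.
have [_ schi chi0 _ _] := P.
set cc := c i in Ai sub *; set ch := chi i in cchi off *.
have ccc := chartP sm Ai; have oD := relopen_cimg ccc.
have sch : smooth_on (cimg cc) (loc cc ch) := schi i cc Ai.
have pg y : cimg cc y -> posdef (g cc y) by move=> cy; exact: (posdef_g rm Ai).
have sg := smooth_g rm Ai.
have [cK KD] := cmap_compact sm hcompact Ai cl sub.
have offD x : cimg cc x -> ~ (cmap cc @` psupp chi i) x -> ch (cinv cc x) = 0.
  move=> cx nK; apply: off => Kx; apply: nK; exists (cinv cc x) => //.
  exact: cmapK.
pose Y j x := ch (cinv cc x) * W cc j x.
have sY j : smooth_on (cimg cc) (Y j) by apply: smooth_onM => //; exact: smooth_W.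
have YK j x : cimg cc x -> ~ (cmap cc @` psupp chi i) x -> Y j x = 0.
  by move=> cx nK; rewrite /Y offD// mul0r.
have E := hint_dvg oD sg pg cK KD sY YK.
have [B B0 hB] := compact_ext0_ucs cK.
pose F1 x := dens (g cc) x * (ch (cinv cc x) * dvg (cimg cc) (g cc) (W cc) x).
have sdens := smooth_dens sg pg.
have sdvg : smooth_on (cimg cc) (dvg (cimg cc) (g cc) (W cc)).
  apply: smooth_onD; apply: smooth_on_sum => j.
    by apply: smooth_on_partial => //; exact: smooth_W.
  apply: smooth_on_sum => k; apply: smooth_onM; last exact: smooth_W.
  exact: (smooth_chr oD sg pg).
have sF1 : smooth_on (cimg cc) F1 by apply: smooth_onM => //; exact: smooth_onM.
have uF1 : ucs H B (ext0 (cimg cc) F1).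
  apply: hB => //; first by move=> x cx e e0; exact: smooth_rel_cont.
  by move=> x cx nK; rewrite /F1 offD// mul0r mulr0.
have dK p : ~ psupp chi i p -> d p = 0 by exact: W_derivative_off (schi i) dE.
have cfd : ucs H B (ext0 (cimg cc) (cfun g cc d)).
  apply: hB => //; first by move=> x cx e e0; exact: (cfun_cont sm rm).
  by move=> x cx nK; exact: (cfun_off g sm Ai dK cx nK).
have cfq : ucs H B (ext0 (cimg cc) (cfun g cc (fun p => ch p * q p))).
  have ccq : continuous (fun p => ch p * q p).
    by move=> p; apply: cvgM; [exact: cchi|exact: cq].
  apply: hB => //; first by move=> x cx e e0; exact: (cfun_cont sm rm).
  by move=> x cx nK; rewrite /cfun offD// mul0r mul0r.
have lhs : hint (ext0 (cimg cc) (fun x => dens (g cc) x * dvg (cimg cc) (g cc) Y x)) =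
    hint (ext0 (cimg cc) F1) + cint g cc d.
  rewrite /cint -(hintD B0 uF1 cfd); apply: eq_hint => x _.
  have [cx|cx] := pselect (cimg cc x); last by rewrite !ext0_out// addr0.
  rewrite !ext0_in// /F1 /cfun (dE _ _ Ai cx).
  rewrite (dvgM (g cc) oD sch (fun j => smooth_W j Ai) cx); ring.
have rhs : (fun y : 'rV[R]_m => ext0 (cimg cc) (fun x => dens (g cc) x * Y ord0 x) (vcons 0 y)) =
    (fun y : 'rV[R]_m => (2 * K * Num.sqrt K) * cface g cc ch y).
  apply/funext => y; rewrite /cface.
  have [cx|cx] := pselect (cimg cc (vcons 0 y)); last first.
    by rewrite ext0_out// indicE memNset// mul0r mulr0.
  rewrite ext0_in// indicE mem_set// mul1r.
  set x := vcons 0 y in cx *; have x0 : x 0 ord0 = 0 by exact: vcons0.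
  have fx := fluid_face Ai cx x0.
  have bx : boundary A (cinv cc x) by apply/fluid_zero.
  have ux : inner (cimg cc) (g cc) (loc cc f) (loc cc f) x = K by rewrite -uE// uK.
  have := @dens_face _ _ (cimg cc) (g cc) oD pg (loc cc f) x (sf Ai) cx x0
    (fun z cz => fluid_face Ai cz) (fun z _ => fluid_ge0 (cinv cc z)).
  rewrite ux => dE2; rewrite /Y /fluid_field fx ux.
  (* On the face [f = 0] and [u = K], so W reduces to [2 * K] times grad f; [dens_face] contributes
     the remaining factor [Num.sqrt K] and the area density. *)
  have -> : dens (g cc) x * (ch (cinv cc x) * (2^-1 * 0 *
      grad (cimg cc) (g cc) (inner (cimg cc) (g cc) (loc cc f) (loc cc f)) ord0 x -
      (K + beta / 2 * 0 ^+ 2 - 3 * K) * grad (cimg cc) (g cc) (loc cc f) ord0 x)) =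
    ch (cinv cc x) * (2 * K) * (dens (g cc) x * grad (cimg cc) (g cc) (loc cc f) ord0 x) by ring.
  rewrite dE2 /face_metric faceE; ring.
have [B' B'0 hB'] := cface_ucs sm rm hcompact Ai cl sub cchi off.
have E2 : hint (ext0 (cimg cc) F1) =
    - (2 * K * Num.sqrt K) * intn (cface g cc ch) - cint g cc d.
  apply/eqP; rewrite eq_sym subr_eq; apply/eqP.
  by rewrite -lhs E rhs (intnZ _ B'0 hB') mulNr.
rewrite -E2; apply: (hint_le B0 cfq uF1) => x _.
have [cx|cx] := pselect (cimg cc x); last by rewrite !ext0_out.
rewrite !ext0_in// /cfun /F1 mulrC ler_wpM2l ?dens_ge0//.
by rewrite ler_wpM2l ?chi0// qW.
Qed.

Lemma divergence_le :
  \sum_i cint g (c i) (fun p => chi i p * q p) <=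
  - (2 * K * Num.sqrt K) * \sum_i intn (cface g (c i) (chi i)).
Proof.
have [_ schi _ _ chi1] := P.
have /choice[d hd] : forall i, exists d : M -> R, continuous d /\
    forall c x, A c -> cimg c x ->
    d (cinv c x) = \sum_j W c j x * partial (cimg c) j (loc c (chi i)) x.
  by move=> i; have [d cd dE] := W_derivative (schi i); exists d.
(* The functions [d i] add up to the derivative of the constant 1 along W. *)
have d0 : \sum_i cint g (c i) (d i) = 0.
  apply: (cint_family0 sm rm hcompact cf fluid_pos P).
  - by move=> i; case: (hd i).
  - move=> i p; have [_ dE] := hd i; exact: W_derivative_off (schi i) dE.
  - move=> p; have [cc Ac cp] := manifold_cover sm p; have ccc := chartP sm Ac.
    have cx := cimg_cmap cp; have oD := relopen_cimg ccc.
    rewrite -(cinvK ccc cp).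
    transitivity (\sum_j W cc j (cmap cc p) *
        partial (cimg cc) j (fun x => \sum_i chi i (cinv cc x)) (cmap cc p)).
      transitivity (\sum_i \sum_j W cc j (cmap cc p) *
          partial (cimg cc) j (loc cc (chi i)) (cmap cc p)).
        by apply: eq_bigr => i _; rewrite (hd i).2.
      rewrite exchange_big/=; apply: eq_bigr => j _; rewrite -mulr_sumr.
      by rewrite partial_sum// => i; exact: (schi i cc Ac).
    rewrite big1// => j _.
    have -> : (fun x => \sum_i chi i (cinv cc x)) = (fun=> 1).
      by apply/funext => x; rewrite chi1.
    by rewrite partial_cst// mulr0.
have -> : - (2 * K * Num.sqrt K) * \sum_i intn (cface g (c i) (chi i)) =
    \sum_i (- (2 * K * Num.sqrt K) * intn (cface g (c i) (chi i)) - cint g (c i) (d i)).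
  by rewrite sumrB d0 subr0 mulr_sumr.
apply: ler_sum => i _.
by apply: divergence_chart; case: (hd i).
Qed.

End Divergence.

End Flux.

Lemma cint_gt0 c (B : set M) (h : M -> R) p : A c -> closed B -> B `<=` cdom c ->
  continuous h -> (forall p, ~ B p -> h p = 0) -> (forall p, 0 <= h p) -> 0 < h p ->
  0 < cint g c h.
Proof.
move=> Ac clB Bc ch hB h0 hp; have cc := chartP sm Ac.
have cp : cdom c p.
  by apply: Bc; apply: contrapT => nB; rewrite hB// ltxx in hp.
have [b b0 ub] := cint_ucs sm rm hcompact Ac clB Bc.
have cx := cimg_cmap cp.
apply: (hint_gt0 b0 (ub _ ch hB) _ (cimg_half cc cx)).
  by move=> x _; apply: cfun_ge0.
rewrite ext0_in// /cfun cinvK// mulr_gt0//.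
by apply: dens_gt0 cx => y; exact: (posdef_g rm Ac).
Qed.

Lemma fluid_pos_exists : exists p, 0 < f p.
Proof.
have [p [c Ac [cp p0]]] := spf_boundary hspf; have cc := chartP sm Ac.
have cx := cimg_cmap cp; have [r r0 hr] := relopen_nbhs (relopen_cimg cc) cx.
pose y : 'rV[R]_m.+1 := cmap c p + (r / 2) *: ed ord0.
have y0 : y 0 ord0 = r / 2 by rewrite rvD rvZ edE eqxx mulr1 p0 add0r.
have cy : cimg c y.
  apply: hr; last by rewrite y0 divr_ge0// ltW.
  rewrite opprD addNKr normrN norm_ed ger0_norm; first by lra.
  by rewrite divr_ge0// ltW.
by exists (cinv c y); rewrite (fluid_pos Ac cy) y0 divr_gt0.
Qed.

(** Here [t] stands for k^3. Were it 0, the hypothesis would read [X <= 0]; so it is positive and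
    can be cancelled, and [X] makes the inequality strict. *)
Lemma volume_area_alg (sa k t X V B : R) : 0 < sa -> 0 <= t -> 0 < X ->
  X - 2 * Lambda * (t / sa) * V <= - (2 * t) * B -> Lambda^-1 * sa * B < V.
Proof.
move=> sa0 t0 X0 h.
have t1 : 0 < t.
  rewrite lt_neqAle t0 andbT; apply/eqP => e.
  by move: h; rewrite -e mul0r !mulr0 mul0r subr0 oppr0 mul0r leNgt X0.
have h2 : t * B < t * (Lambda * (V / sa)).
  have -> : t * (Lambda * (V / sa)) = Lambda * (t / sa) * V by field; rewrite gt_eqF.
  lra.
rewrite ltr_pM2l// in h2.
rewrite -mulrA -ltr_pdivlMl ?invr_gt0// invrK -ltr_pdivlMl//.
by have -> : sa^-1 * (Lambda * V) = Lambda * (V / sa) by ring.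
Qed.

Lemma volume_area_lt (N : nat) (c : 'I_N -> chart) (chi : 'I_N -> M -> R) :
  partition_of_unity A c chi ->
  Lambda^-1 * Num.sqrt ((Rmin + 3 * Lambda) / (2 * m.+1%:R)) *
    (\sum_i intn (cface g (c i) (chi i))) < \sum_i cint g (c i) (chi i).
Proof.
move=> P; have [p0 bp0] := spf_boundary hspf.
set a := (Rmin + 3 * Lambda) / (2 * m.+1%:R).
have a0 : 0 < a.
  by rewrite divr_gt0 ?mulr_gt0 ?ltr0n//; have := Rmin_gt0; have := hLambda; lra.
set sa := Num.sqrt a; have sa0 : 0 < sa by rewrite sqrtr_gt0.
have saE : sa ^+ 2 = a by rewrite sqr_sqrtr// ltW.
pose K0 := u p0; have K00 : 0 <= K0 by exact: u_ge0.
pose k := Num.sqrt K0; have k0 : 0 <= k by exact: sqrtr_ge0.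
have kE : k ^+ 2 = K0 by rewrite sqr_sqrtr.
pose q p := Lambda * a * f p ^+ 3 - 3 * K0 * Lambda * f p.
have cq : continuous q.
  move=> p; apply: cvgB; apply: cvgM; try exact: cvg_cst; last exact: cf.
  by apply: cvgM; [exact: cf|apply: cvgM; exact: cf].
have qW c' x : A c' -> cimg c' x -> q (cinv c' x) <= dvg (cimg c') (g c')
    (fluid_field (cimg c') (g c') (loc c' f) ((Rmin + Lambda) / m.+1%:R) K0) x.
  move=> Ac cx; apply: dvg_fluid_field_ge => //.
  - by apply: relopen_cimg; exact: (chartP sm Ac).
  - exact: (smooth_g rm Ac).
  - by move=> y; exact: (posdef_g rm Ac).
  - exact: (sf Ac).
  - by move=> y cy; exact: fluid_lap.
  - by move=> y cy; exact: (spf_ricci hspf Ac cy).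
  - exact: fluid_ge0.
  - by have [_ h] := hRmin; exact: (h c' x Ac cx).
have uK p : boundary A p -> u p = K0 by move=> bp; exact: u_boundary bp0 bp.
have D := divergence_le P uK cq qW.
(* The minimum point of the cubic on the half-line of nonnegative values; subtracting the minimum
   leaves a double root at [s]. *)
pose s := k / sa; have s0 : 0 <= s by rewrite divr_ge0// ltW.
pose r p := (f p - s) ^+ 2 * (f p + 2 * s).
have r0 p : 0 <= r p.
  by rewrite mulr_ge0 ?sqr_ge0// addr_ge0 ?fluid_ge0// mulr_ge0.
have qE p : q p = Lambda * a * r p + - (2 * Lambda * (K0 * k / sa)) * 1.
  rewrite /q /r /s -kE -saE; field; by rewrite gt_eqF.
have cr : continuous r.
  have c1 : continuous (fun p => f p - s) by move=> p; apply: cvgB; [exact: cf|exact: cvg_cst].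
  move=> p; apply: cvgM; first by apply: cvgM; exact: c1.
  by apply: cvgD; [exact: cf|exact: cvg_cst].
(* One point with [r > 0] gives strictness: if [K0 > 0], a boundary point, where [f = 0] differs
   from [s]; otherwise [s = 0], [r] is the cube of [f], and an interior point serves. *)
have [pr rp] : exists p, 0 < r p.
  have [K1|K1] := ltP 0 K0.
    have k1 : 0 < k by rewrite sqrtr_gt0.
    have s1 : 0 < s by rewrite divr_gt0.
    exists p0; rewrite /r (iffRL (fluid_zero p0) bp0) sub0r add0r sqrrN.
    by rewrite mulr_gt0 ?exprn_gt0// mulr_gt0.
  have [p fp] := fluid_pos_exists.
  have s1 : s = 0 by rewrite /s /k ler0_sqrtr// mul0r.
  by exists p; rewrite /r s1 subr0 mulr0 addr0 mulr_gt0// exprn_gt0.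
have [_ _ chi0 _ chi1] := P.
have ccr i : continuous (fun p => chi i p * r p).
  by move=> p; have [_ _ _ cchi _] := psuppP sm P i; apply: cvgM; [exact: cchi|exact: cr].
have offr i p : ~ psupp chi i p -> chi i p * r p = 0.
  by move=> np; have [_ _ _ _ ->] := psuppP sm P i; rewrite ?mul0r.
have X0 : 0 < \sum_i cint g (c i) (fun p => chi i p * r p).
  have [i chip] : exists i, 0 < chi i pr.
    apply: contrapT => h; have := chi1 pr; rewrite big1 => [/eqP|i _].
      by rewrite eq_sym oner_eq0.
    by apply/eqP; rewrite eq_le chi0 andbT leNgt; apply/negP => hi; apply: h; exists i.
  rewrite (bigD1 i)//= ltr_pwDl//.
    have [Ai cl sub _ _] := psuppP sm P i.
    apply: (cint_gt0 (p := pr) Ai cl sub (ccr i) (offr i)) => [p|]; first by rewrite mulr_ge0.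
    exact: mulr_gt0.
  by apply: sumr_ge0 => j _; apply: hint_ge0 => x _; apply: cfun_ge0 => p; rewrite mulr_ge0.
apply: (@volume_area_alg sa k (K0 * k) (Lambda * a * \sum_i cint g (c i) (fun p => chi i p * r p))) => //.
- by rewrite mulr_ge0.
- by apply: mulr_gt0 => //; exact: mulr_gt0.
- rewrite [2 * (K0 * k)]mulrA; apply: le_trans D.
  rewrite mulr_sumr -mulNr mulr_sumr -big_split/= le_eqVlt; apply/orP; left; apply/eqP.
  apply: eq_bigr => i _; have [Ai cl sub cchi off] := psuppP sm P i.
  have E1 := cintZ sm rm hcompact (Lambda * a) Ai cl sub (ccr i) (offr i).
  have E2 := cintZ sm rm hcompact (- (2 * Lambda * (K0 * k / sa))) Ai cl sub cchi off.
  rewrite -E1 -E2 -(cintD sm rm hcompact Ai cl sub).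
  + by congr cint; apply/funext => p; rewrite qE; ring.
  + by move=> p; apply: cvgM; [exact: cvg_cst|exact: ccr].
  + by move=> p; apply: cvgM; [exact: cvg_cst|exact: cchi].
  + by move=> p np; rewrite offr// mulr0.
  + by move=> p np; rewrite off// mulr0.
Qed.

(** The values selected for [volume] and [boundary_area] may come from different partitions. Only
    the volume is transported, by [cint_partition], to the partition that computes the area. *)
Lemma volume_lt :
  Lambda^-1 * Num.sqrt ((Rmin + 3 * Lambda) / (2 * m.+1%:R)) * boundary_area A g
    < volume A g.
Proof.
have [N0 [c0 [chi0 P0]]] := partition_exists sm hcompact.
have volE N (c : 'I_N -> chart) chi : partition_of_unity A c chi ->
    (\sum_(i < N) cint g (c i) (chi i))%:E = (\sum_(i < N) chart_volume g (c i) (chi i))%E.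
  move=> P; rewrite -sumEFin; apply: eq_bigr => i _.
  by have [Ai cl sub cchi off] := psuppP sm P i; rewrite (chart_volumeE sm rm hcompact Ai cl sub).
have areaE N (c : 'I_N -> chart) chi : partition_of_unity A c chi ->
    (\sum_(i < N) intn (cface g (c i) (chi i)))%:E = (\sum_(i < N) chart_area g (c i) (chi i))%E.
  move=> P; rewrite -sumEFin; apply: eq_bigr => i _.
  by have [Ai cl sub cchi off] := psuppP sm P i; rewrite (chart_areaE sm rm hcompact Ai cl sub).
pose SV := [set V : R | exists N (c : 'I_N -> chart) (chi : 'I_N -> M -> R),
    partition_of_unity A c chi /\
    V%:E = (\sum_(i < N) chart_volume g (c i) (chi i))%E].
pose SA := [set V : R | exists N (c : 'I_N -> chart) (chi : 'I_N -> M -> R),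
    partition_of_unity A c chi /\
    V%:E = (\sum_(i < N) chart_area g (c i) (chi i))%E].
have [N1 [c1 [chi1 [P1 V1]]]] : SV (volume A g).
  apply: (@getPex _ SV); exists (\sum_(i < N0) cint g (c0 i) (chi0 i)).
  by exists N0, c0, chi0; split=> //; exact: volE.
have [N2 [c2 [chi2 [P2 V2]]]] : SA (boundary_area A g).
  apply: (@getPex _ SA); exists (\sum_(i < N0) intn (cface g (c0 i) (chi0 i))).
  by exists N0, c0, chi0; split=> //; exact: areaE.
have -> : volume A g = \sum_i cint g (c2 i) (chi2 i).
  apply: EFin_inj; rewrite V1 -volE//; congr EFin.
  exact: (cint_partition sm rm hcompact cf fluid_pos P1 P2).
have -> : boundary_area A g = \sum_i intn (cface g (c2 i) (chi2 i)).
  by apply: EFin_inj; rewrite V2 -areaE.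
exact: volume_area_lt.
Qed.

End PerfectFluid.

(* The dimension of the manifold is n = m.+1. *)
Theorem theorem1 (R : realType) (m : nat) (hn : (3 <= m.+1)%N)
    (M : topologicalType) (A : set (chart R m M))
    (g : chart R m M -> 'rV[R]_m.+1 -> 'M[R]_m.+1)
    (f rho : M -> R) (Lambda Rmin : R)
    (hcompact : compact [set: M])
    (horiented : oriented A)
    (hspf : static_perfect_fluid A g f rho)
    (hconnected : connected (boundary A))
    (hscal : forall c x, A c -> cimg c x -> 0 < scal g c x)
    (hLambda : 0 < Lambda)
    (hrho : forall c x, A c -> cimg c x ->
       (m.+1%:R - 2) / (2 * (m.+1%:R - 1)) * scal g c x
       + m.+1%:R / (m.+1%:R - 1) * rho (cinv c x) = - Lambda)
    (hRmin : is_min_scal A g Rmin) :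
  Lambda^-1 * Num.sqrt ((Rmin + 3 * Lambda) / (2 * m.+1%:R)) * boundary_area A g
    <= volume A g
  /\ (volume A g
        = Lambda^-1 * Num.sqrt ((Rmin + 3 * Lambda) / (2 * m.+1%:R))
          * boundary_area A g ->
      exists2 r : R, 0 < r & isometric_to_hemisphere A g r).

Proof.
have sm := spf_manifold hspf; have sf := spf_smooth_f hspf.
have [u su uE] := inner_exists sm (spf_metric hspf) sf sf.
have lt := volume_lt hcompact horiented hspf hconnected hscal hLambda hrho hRmin su uE.
split; first exact: ltW.
by move=> eq_vol; rewrite eq_vol ltxx in lt.
Qed.
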